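(* Let $\alpha\in(0,1)$ and suppose the expansion condition (E) stated in the context holds. For every $n$ and $j=1,\dots,k$ let $\hat\nu^2_{j,n}\ge0$ be an estimator of $\mathbb{V}_n(r_n^{(j)})$ and let $\hat K_n\ge0$ be an estimator of $K_{1-\alpha}(\operatorname{corr}(\mathbb{V}_n(r_n)))$ (all estimators being measurable functions on $\mathbb{R}^{n\times\ell}$), such that $$\kappa_n=\frac{K_{1-\alpha}(\operatorname{corr}(\mathbb{V}_n(r_n)))}{\hat K_n}\max_{j=1,\dots,k}\sqrt{\frac{[\mathbb{V}_n(r_n)]_j}{\hat\nu^2_{j,n}}}$$ satisfies $$\mathbb{P}_n(\kappa_n\ge1+\varepsilon)\to0\quad\text{for every }\varepsilon>0 \qquad( * )$$ (implicitly including that $\mathbb{P}_n(\kappa_n\text{ is well defined})\to1$), or, equivalently (the two requirements are equivalent), such that $( * )$ holds with $\kappa_n$ replaced by $$\frac{K_{1-\alpha}(\operatorname{corr}(S_n))}{\hat K_n}\max_{j=1,\dots,k}\sqrt{\frac{[S_n]_j}{\hat\nu^2_{j,n}}}.$$ For $\mathbb{M}\in\mathsf{M}_n$ and $j=1,\dots,m(\mathbb{M})$ define $$\mathrm{CI}^{(j),\mathrm{oest}}_{1-\alpha,\mathbb{M}}=\hat\theta^{(j)}_{\mathbb{M},n}\pm\sqrt{\hat\nu^2_{\rho(\mathbb{M})+j,n}}\;\hat K_n .$$ Then for every sequence of (measurable) model selection procedures $\hat{\mathbb{M}}_n:\mathbb{R}^{n\times\ell}\to\mathsf{M}_n$, $$\liminf_{n\to\infty}\mathbb{P}_n\left(\theta^{*(j)}_{\hat{\mathbb{M}}_n,n}\in\mathrm{CI}^{(j),\mathrm{oest}}_{1-\alpha,\hat{\mathbb{M}}_n}\text{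 for all }j=1,\dots,m(\hat{\mathbb{M}}_n)\right)\ge1-\alpha .$$ Moreover, in the special case where $\hat K_n\ge K_{1-\alpha}(\operatorname{corr}(\mathbb{V}_n(r_n)))$ holds for all sufficiently large $n$, condition $( * )$ is implied by the condition that for every $j=1,\dots,k$ $$\mathbb{P}_n\left(\sqrt{[S_n]_j/\hat\nu^2_{j,n}}\ge1+\varepsilon\right)\to0\quad\text{for every }\varepsilon>0,$$ or, equivalently, that for every $j=1,\dots,k$ $$\mathbb{P}_n\left(\sqrt{[\mathbb{V}_n(r_n)]_j/\hat\nu^2_{j,n}}\ge1+\varepsilon\right)\to0\quad\text{for every }\varepsilon>0 .$$
   Context: Framework. Fix integers $\ell,d\ge1$. For each $n$, $\mathbb{P}_n=\bigotimes_{i=1}^n\mathbb{P}_{i,n}$ is a product probability measure on the Borel sets of $\mathbb{R}^{n\times\ell}$, with $\mathbb{P}_{i,n}$ the marginal law (on $\mathbb{R}^{1\times\ell}$) of the $i$-th row $y_i$ of $y\in\mathbb{R}^{n\times\ell}$. $\mathbb{E}_n,\mathbb{V}_n$ denote expectation and variance-covariance operator under $\mathbb{P}_n$; $\mathbb{E}_{i,n}$ denotes expectation under $\mathbb{P}_{i,n}$. $\mathsf{M}_n=\{\mathbb{M}_{1,n},\dots,\mathbb{M}_{d,n}\}$ is a set of $d$ nonempty sets of probability distributions (candidate models) on $\mathbb{R}^{n\times\ell}$; $\mathbb{P}_n$ need not belong to any of them. For each $\mathbb{M}\in\mathsf{M}_n$ there is given a nonrandom target $\theta^*_{\mathbb{M},n}\in\mathbb{R}^{m(\mathbb{M})}$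 (possibly depending on $\mathbb{P}_n$) and a measurable estimator $\hat\theta_{\mathbb{M},n}:\mathbb{R}^{n\times\ell}\to\mathbb{R}^{m(\mathbb{M})}$; the dimension $m(\mathbb{M}_{j,n})$ does not depend on $n$. Let $\hat\theta_n$ and $\theta^*_n$ be the vectors obtained by stacking $\hat\theta_{\mathbb{M}_{j,n},n}$, respectively $\theta^*_{\mathbb{M}_{j,n},n}$, $j=1,\dots,d$; both have dimension $k=\sum_{j=1}^d m(\mathbb{M}_{j,n})$. For $\mathbb{M}=\mathbb{M}_{j,n}$ put $\rho(\mathbb{M})=\sum_{l=1}^{j-1}m(\mathbb{M}_{l,n})$ (empty sum $=0$). Superscript $(j)$ denotes the $j$-th coordinate of a vector. Condition (E). There exist Borel functions $g_{i,n}:\mathbb{R}^{1\times\ell}\to\mathbb{R}^k$ ($i=1,\dots,n$) and $\Delta_n:\mathbb{R}^{n\times\ell}\to\mathbb{R}^k$, possibly depending on $\theta_n^*$, with $\hat\theta_n(y)-\theta^*_n=\sum_{i=1}^n g_{i,n}(y_i)+\Delta_n(y)$ for all $y$, such that, writing $r_n(y)=\sum_{i=1}^n g_{i,n}(y_i)$, for every $i$ and every $j\in\{1,\dots,k\}$: $\mathbb{E}_{i,n}(g^{(j)}_{i,n})=0$ and $0<\mathbb{V}_n(r_n^{(j)})<\infty$; and, for every $j$ and every $\varepsilon>0$, as $n\to\infty$, $$\mathbb{V}_n^{-1}(r_n^{(j)})\sum_{i=1}^n\int [g_{i,n}^{(j)}]^2\,\mathbf{1}\{|g_{i,n}^{(j)}|\ge\varepsilon\mathbb{V}_n^{1/2}(r_n^{(j)})\}\,d\mathbb{P}_{i,n}\to0,\qquad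 \mathbb{P}_n\big(|\mathbb{V}_n^{-1/2}(r_n^{(j)})\Delta_n^{(j)}|\ge\varepsilon\big)\to0 .$$ $S_n(y)=\sum_{i=1}^n g_{i,n}(y_i)g_{i,n}(y_i)'$. Notation. $\operatorname{diag}(A)$: the matrix $A$ with off-diagonal entries set to $0$; $A^\dagger$: Moore–Penrose inverse; $A^{\dagger/2}=(A^\dagger)^{1/2}$; $\operatorname{corr}(\Sigma)=\operatorname{diag}(\Sigma)^{\dagger/2}\Sigma\operatorname{diag}(\Sigma)^{\dagger/2}$; $[A]_j$: $j$-th diagonal entry. For a covariance matrix $\Gamma$, $K_{1-\alpha}(\Gamma)$ is the $(1-\alpha)$-quantile of $\|Z\|_\infty$ with $Z\sim N(0,\Gamma)$. $a\pm b$ denotes the interval $[a-b,a+b]$. Statements of the form $\mathbb{P}_n(\text{ratio}\ge c)\to0$ implicitly include that the ratio is well defined with $\mathbb{P}_n$-probability tending to $1$. *)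

(* Defs.v *)
From HB Require Import structures.
From mathcomp Require Import all_boot all_order all_algebra.
From mathcomp Require Import all_classical all_reals all_analysis.
From mathcomp Require Import measurable_realfun lra.
Set Implicit Arguments.
Unset Strict Implicit.
Unset Printing Implicit Defensive.
Import Order.TTheory GRing.Theory Num.Theory.
Import numFieldNormedType.Exports.
Local Open Scope classical_set_scope.
Local Open Scope ring_scope.

Definition matrix_display : measure_display.
Proof. exact: default_measure_display. Qed.

(* Real matrices (hence row and column vectors) carry the Borel sigma-algebra
   of their usual topology. *)
Section borel_matrix.
Context {R : realType} {m n : nat}.

Let borel : set (set 'M[R]_(m, n)) := <<s [set U | open U] >>.

Let borel0 : borel set0.
Proof. exact: sigma_algebra0. Qed.

Let borelC A : borel A -> borel (~` A).
Proof. exact: sigma_algebraC. Qed.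

Let borel_bigcup (F : (set 'M[R]_(m, n))^nat) :
  (forall i, borel (F i)) -> borel (\bigcup_i F i).
Proof. exact: sigma_algebra_bigcup. Qed.

HB.instance Definition _ := @isMeasurable.Build matrix_display 'M[R]_(m, n)
  borel borel0 borelC borel_bigcup.

End borel_matrix.

Section measurable_matrix.
Context {R : realType}.

Lemma measurable_entry m n (i : 'I_m) (j : 'I_n) :
  measurable_fun [set: 'M[R]_(m, n)] (fun A => A i j).
Proof.
apply: (measurability _ (RGenOpens.measurableE R)) => _ [_ [a [b ->] <-]].
rewrite setTI; apply: sub_sigma_algebra => /=.
have /continuousP := @coord_continuous R m n i j.
by apply; exact: interval_open.
Qed.

Lemma measurable_fun_matrixP d (T : measurableType d) m n
    (f : T -> 'M[R]_(m, n)) :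
  measurable_fun [set: T] f <->
  forall i j, measurable_fun [set: T] (fun x => f x i j).
Proof.
split=> [mf i j|mf].
  exact: (measurableT_comp (measurable_entry i j)).
apply: (@measurability _ _ _ _ _ _ [set U : set 'M[R]_(m, n) | open U]) => //.
move=> _ [U oU <-]; rewrite setTI.
pose box (p : 'M[rat]_(m, n) * rat) : set 'M[R]_(m, n) :=
  [set A | forall i j, A i j \in
    `](ratr (p.1 i j) - ratr p.2 : R), ratr (p.1 i j) + ratr p.2[ ].
pose F k : set T := if unpickle k is Some p then
  [set x | box p `<=` U /\ box p (f x)] else set0.
have -> : f @^-1` U = \bigcup_k F k.
  apply/seteqP; split=> [x /= Ufx|x [k _]]; last first.
    by rewrite /F; case: unpickle => // p [pU pfx]; exact: pU.
  have /nbhs_ballP[e /= e0 eU] := open_nbhs_nbhs (conj oU Ufx).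
  have /rat_in_itvoo[r] : 0 < e / 2 by rewrite divr_gt0.
  rewrite in_itv/= => /andP[r0 re].
  have qP i j : exists q, `|f x i j - ratr q| < ratr r.
    have /rat_in_itvoo[q] : f x i j - ratr r < f x i j + ratr r by lra.
    rewrite in_itv/= => /andP[q1 q2]; exists q.
    by rewrite ltr_norml; apply/andP; split; lra.
  pose p : 'M[rat]_(m, n) * rat := (\matrix_(i, j) xchoose (qP i j), r).
  exists (pickle p) => //; rewrite /F pickleK; split.
    move=> A /= Ab; apply: eU; split=> // i j.
    move: (Ab i j) (xchooseP (qP i j)); rewrite mxE in_itv/= /ball/=.
    move=> /andP[a1 a2]; rewrite !ltr_norml => /andP[b1 b2].
    by apply/andP; split; lra.
  move=> i j; rewrite mxE/= in_itv/=.
  move: (xchooseP (qP i j)); rewrite ltr_norml => /andP[b1 b2].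
  by apply/andP; split; lra.
apply: bigcup_measurable => k _; rewrite /F; case: unpickle => // p.
have [pU|npU] := pselect (box p `<=` U); last first.
  by rewrite (_ : [set _ | _] = set0) //; apply/seteqP; split=> // x [].
rewrite (_ : [set _ | _] = \big[setI/setT]_i \big[setI/setT]_j
  ((fun x => f x i j) @^-1`
    [set` `](ratr (p.1 i j) - ratr p.2 : R), ratr (p.1 i j) + ratr p.2[ ])).
  apply: bigsetI_measurable => i _; apply: bigsetI_measurable => j _.
  by rewrite -[X in measurable X]setTI; exact: mf.
apply/seteqP; split=> [x [_ bx]|x].
  rewrite -!bigcap_seq => i _; rewrite /= -bigcap_seq => j _; exact: bx.
rewrite -bigcap_seq => bx; split=> // i j.
have := bx i (mem_index_enum _); rewrite -bigcap_seq; apply.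
exact: mem_index_enum.
Qed.
End measurable_matrix.

Definition cons_tuple (R : realType) k
  (x : measurableTypeR R * k.-tuple (measurableTypeR R)) :
  k.+1.-tuple (measurableTypeR R) := [tuple of x.1 :: x.2].

Lemma measurable_cons_tuple (R : realType) k :
  measurable_fun setT (@cons_tuple R k).
Proof. exact: measurable_cons. Qed.

HB.instance Definition _ (R : realType) k :=
  @isMeasurableFun.Build _ _ _ _ (@cons_tuple R k)
    (@measurable_cons_tuple R k).

Section gaussian.
Context {R : realType}.

(* The law of k independent standard normal variables. *)

Fixpoint iid_normal k : probability (k.-tuple (measurableTypeR R)) R :=
  if k is k'.+1 then
    distribution (normal_prob (0 : R) 1 \x iid_normal k')%E (@cons_tuple R k')
  else \d_[tuple].

(* Some A with A A' = G; one exists exactly when G is a covariance matrix, and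
   the law of A W for W standard normal does not depend on its choice. *)
Definition cov_factor k (G : 'M[R]_k) : 'M[R]_k := xget 0 [set A | A *m A^T = G].

Definition gaussian_vec k (G : 'M[R]_k) (w : k.-tuple (measurableTypeR R)) :
  'cV[R]_k := cov_factor G *m \col_i tnth w i.

Lemma measurable_gaussian_vec k (G : 'M[R]_k) :
  measurable_fun setT (gaussian_vec G).
Proof.
apply/measurable_fun_matrixP => i j; rewrite /gaussian_vec.
under eq_fun do rewrite mxE.
apply: measurable_sum => l.
apply: measurable_funM => //; under eq_fun do rewrite mxE.
exact: measurable_tnth.
Qed.

HB.instance Definition _ k (G : 'M[R]_k) :=
  @isMeasurableFun.Build _ _ _ _ (gaussian_vec G) (measurable_gaussian_vec G).

Definition mvnormal k (G : 'M[R]_k) : probability 'cV[R]_k R :=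
  distribution (iid_normal k) (gaussian_vec G).

(* The p-quantile of the sup-norm of Z ~ N(0, G); the norm of the library on
   matrices is the largest absolute entry (mx_normrE). *)
Definition Kquantile (p : R) k (G : 'M[R]_k) : R :=
  inf [set t : R | (p%:E <= mvnormal G [set z : 'cV[R]_k | (`|z| <= t)%R])%E].

End gaussian.

Section correlation.
Context {R : realType} {k : nat}.
Implicit Types A : 'M[R]_k.

Definition diag_part A : 'M[R]_k := diag_mx (\row_i A i i).

Definition is_pinv A B :=
  [/\ A *m B *m A = A, B *m A *m B = B,
      (A *m B)^T = A *m B & (B *m A)^T = B *m A].

(* The Moore-Penrose inverse. *)
Definition pinv A : 'M[R]_k := xget 0 [set B | is_pinv A B].

Definition psd A :=
  A^T = A /\ forall x : 'cV[R]_k, 0 <= (x^T *m A *m x) 0 0.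

(* The unique symmetric positive semidefinite square root, for psd A. *)
Definition psd_sqrt A : 'M[R]_k := xget 0 [set B | psd B /\ B *m B = A].

Definition corr A : 'M[R]_k :=
  psd_sqrt (pinv (diag_part A)) *m A *m psd_sqrt (pinv (diag_part A)).

End correlation.

Section model.
Context {R : realType} {l k : nat}.
Variable P : forall n, probability 'M[R]_(n, l) R.
Variable Pm : forall n, 'I_n -> probability 'rV[R]_l R.

(* A real function on matrices with n rows for each n: a statistic. *)
Implicit Type X : forall n, 'M[R]_(n, l) -> R.

(* P n is the product of the laws Pm n i of the rows; taking B j = setT for
   j != i shows that Pm n i is the marginal law of row i. *)
Definition product_law n :=
  forall B : 'I_n -> set 'rV[R]_l, (forall i, measurable (B i)) ->
    P n [set y | forall i, B i (row i y)] = (\prod_(i < n) Pm i (B i))%E.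

Variable g : forall n, 'I_n -> 'rV[R]_l -> 'cV[R]_k.
Variable Delta : forall n, 'M[R]_(n, l) -> 'cV[R]_k.

Definition rsum n (y : 'M[R]_(n, l)) : 'cV[R]_k := \sum_(i < n) g i (row i y).

Definition rvar n (j : 'I_k) : \bar R := 'V_(P n)[(fun y => rsum y j 0)%R]%E.

Definition rcov n : 'M[R]_k :=
  \matrix_(a, b) fine (covariance (P n) (fun y => rsum y a 0)
                                        (fun y => rsum y b 0)).

Definition Smat n (y : 'M[R]_(n, l)) : 'M[R]_k :=
  \sum_(i < n) g i (row i y) *m (g i (row i y))^T.

(* Since the variances are required to be positive, everything is only asked of
   sample sizes n > 0. *)
Definition expansion (err : forall n, 'M[R]_(n, l) -> 'cV[R]_k) : Prop :=
  [/\ forall n, (0 < n)%N ->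
       (forall i : 'I_n, measurable_fun [set: 'rV[R]_l] (g i)) /\
       measurable_fun [set: 'M[R]_(n, l)] (@Delta n),
      forall n, (0 < n)%N -> forall y : 'M[R]_(n, l),
        err n y = rsum y + Delta y,
      forall n, (0 < n)%N -> forall j : 'I_k,
        (forall i : 'I_n, 'E_(Pm i)[(fun x => g i x j 0)%R]%E = 0%E) /\
        (0 < rvar n j < +oo)%E,
      forall (j : 'I_k) (eps : R), 0 < eps ->
        ((fine (rvar n j))^-1%:E * \sum_(i < n)
          \int[Pm i]_(x in [set x | (eps * Num.sqrt (fine (rvar n j))
                                       <= `|g i x j 0|)%R])
            ((g i x j 0) ^+ 2)%:E)%E @[n --> \oo] --> 0%E
    & forall (j : 'I_k) (eps : R), 0 < eps ->
        P n [set y | eps <= `|(Num.sqrt (fine (rvar n j)))^-1 * Delta y j 0|]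
          @[n --> \oo] --> 0%E].

(* "P n (X >= 1 + eps) -> 0 for every eps > 0" for a ratio X which is well
   defined on the events wd n only. *)
Definition asym_le1 (wd : forall n, set 'M[R]_(n, l)) X :=
  P n (@wd n) @[n --> \oo] --> 1%E /\
  forall eps : R, 0 < eps ->
    P n (@wd n `&` [set y | 1 + eps <= X n y]) @[n --> \oo] --> 0%E.

Variable nu2 : forall n, 'I_k -> 'M[R]_(n, l) -> R.
Variable Khat : forall n, 'M[R]_(n, l) -> R.
Variable alpha : R.

(* The estimators are nonnegative, so that this says that all denominators in
   kappa are nonzero. *)
Definition kappa_wd n : set 'M[R]_(n, l) :=
  [set y | 0 < Khat y /\ forall j, 0 < nu2 j y].

(* The terms of the maximum are nonnegative, so that starting it at 0 is
   harmless. *)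
Definition kappa (A : forall n, 'M[R]_(n, l) -> 'M[R]_k) n (y : 'M[R]_(n, l)) :=
  Kquantile (1 - alpha) (corr (A n y)) / Khat y *
  \big[Num.max/0]_(j < k) Num.sqrt (A n y j j / nu2 j y).

Definition kappa_condition A := asym_le1 kappa_wd (kappa A).

Definition marginal_condition (A : forall n, 'M[R]_(n, l) -> 'M[R]_k) :=
  forall j, asym_le1 (fun n => [set y | 0 < nu2 j y])
    (fun n y => Num.sqrt (A n y j j / nu2 j y)).

End model.

(* tagnat.Rank j i is the position rho(M_j) + i of the i-th parameter of the
   j-th model in the stacked vector (tagnat.RankEsum). *)
Definition CI (R : realType) (d : nat) (m : 'I_d -> nat) (T : Type)
    (thetahat : forall j, T -> 'cV[R]_(m j))
    (nu2 : 'I_(\sum_(j < d) m j) -> T -> R) (Khat : T -> R)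
    (y : T) (j : 'I_d) (i : 'I_(m j)) : interval R :=
  let h := Num.sqrt (nu2 (tagnat.Rank j i) y) * Khat y in
  `[thetahat j y i 0 - h, thetahat j y i 0 + h].

(* Main.v *)
(* Fix the sample size n and let s_j be the standard deviation of r_n^(j). As
   corr(V_n(r_n)) need not converge, everything is done with explicit error
   bounds, not along subsequences. By Lindeberg's replacement argument the
   characteristic function of (r_n^(j) / s_j)_j is close to that of
   N(0, corr V), uniformly on bounded sets of frequencies. Approximating the
   indicator of a box by a trigonometric polynomial turns this into a comparison
   of box probabilities up to a small enlargement of the box. Since Gaussian
   boxes are anticoncentrated, P(|r_j| <= s_j (K - c) for all j) >= 1 - alpha - o(1)
   for small c, and the loss c absorbs both Delta_n and kappa_n - 1.
   For S_n in place of V_n(r_n), truncation gives the weak law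
   S_ab / (s_a s_b) - corr(V)_ab -> 0; as K_{1-alpha} is bounded below and
   uniformly continuous on correlation matrices, the ratio of the two kappa_n
   tends to 1 in probability. *)
Require Import Defs.
From mathcomp Require Import all_boot all_order all_algebra.
From mathcomp Require Import all_classical all_reals all_analysis.
From mathcomp Require Import measurable_realfun ring lra.
Set Implicit Arguments.
Unset Strict Implicit.
Unset Printing Implicit Defensive.
Import Order.TTheory GRing.Theory Num.Theory.
Import numFieldNormedType.Exports.
Local Open Scope classical_set_scope.
Local Open Scope ring_scope.

(** * Integrals of products of independent variables *)

(** [P n] is known only through its values on rectangles, so every expectation below rests on a rule
    for products of functions of the rows. Characteristic functions stay real: the means of
    [cos (. + c)] for all phases [c] carry the same information. The correlation matrices vary with
    n and may be singular, which shapes the rest. The constants [M] and [eta] of [box_comparison]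
    are fixed before the two laws are. No joint density of N(0, corr V) is used: anticoncentration
    comes from the one-dimensional marginals, and strict growth of box probabilities from one
    explicit cube. Gaussian vectors enter through a factor [A], of which only [A *m A^T] matters.
    S_n may have zero diagonal entries, hence a correlation matrix may have both 0 and 1 on its
    diagonal. Since [corr] is discontinuous where a diagonal entry vanishes, measurability of the
    kappa built on S_n needs an argument of its own. *)

Lemma measurable_forall_ord d (T : measurableType d) k (F : 'I_k -> set T) :
  (forall j, measurable (F j)) -> measurable [set x | forall j, F j x].
Proof.
move=> mF; rewrite (_ : [set x | _] = \big[setI/setT]_(j < k) F j).
  exact: bigsetI_measurable.
apply/seteqP; split=> x.
  by move=> Fx; rewrite -bigcap_seq => j _; exact: Fx.
by rewrite -bigcap_seq => Fx j; apply: Fx; rewrite /= mem_index_enum.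
Qed.

Section weighted_integral.
Context d d' (T : measurableType d) (U : measurableType d') (R : realType).
Variables (P : {measure set T -> \bar R}) (Q : {measure set U -> \bar R}).
Variables (X : T -> U) (G : T -> R) (c : R).
Hypotheses (mX : measurable_fun setT X) (mG : measurable_fun setT G).
Hypotheses (G0 : forall x, 0 <= G x).
Hypothesis PQ : forall B, measurable B ->
  (\int[P]_x (G x * \1_B (X x))%:E = c%:E * Q B)%E.

Import HBNNSimple.

Let integral_weighted_nnsfun (f : {nnsfun U >-> R}) :
  (\int[P]_x (G x * f (X x))%:E = c%:E * \int[Q]_u (f u)%:E)%E.
Proof.
have mfX r : measurable_fun setT (fun x => r * \1_(f @^-1` [set r]) (X x) : R).
  by apply: measurable_funM => //; apply: measurableT_comp.
have f0 r u : 0 <= r * \1_(f @^-1` [set r]) u.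
  by rewrite -lee_fin EFinM nnfun_muleindic_ge0.
transitivity (\int[P]_x \sum_(r \in range f)
    (G x * (r * \1_(f @^-1` [set r]) (X x)))%:E)%E.
  apply: eq_integral => x _; rewrite fimfunE EFinM -fsumEFin//.
  by rewrite ge0_mule_fsumr// => r; rewrite lee_fin.
rewrite ge0_integral_fsum//; last 2 first.
  - by move=> r; apply/measurable_EFinP/measurable_funM.
  - by move=> r x _; rewrite lee_fin mulr_ge0.
under [in RHS]eq_integral do rewrite fimfunE -fsumEFin//.
rewrite [in RHS]ge0_integral_fsum//; last 2 first.
  - by move=> r; apply/measurable_EFinP/measurable_funM.
  - by move=> r x _; rewrite lee_fin.
rewrite ge0_mule_fsumr; last first.
  by move=> r; apply: integral_ge0 => x _; rewrite lee_fin.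
apply: eq_fsbigr => r _.
rewrite integralZl_indic_nnsfun// integral_indic// setIT.
have [r0|r0] := leP 0 r.
  rewrite muleCA -PQ// -ge0_integralZl_EFin//=.
  - by apply: eq_integral => x _; rewrite -!EFinM mulrCA.
  - by move=> x _; rewrite lee_fin mulr_ge0.
  - apply/measurable_EFinP/measurable_funM => //.
    exact: measurableT_comp.
have fr : f @^-1` [set r] = set0.
  by apply/seteqP; split=> // u /= fu; have : 0 <= f u by []; rewrite fu leNgt r0.
rewrite fr measure0 !mule0 integral0_eq// => x _.
by rewrite indicE in_set0 !mulr0.
Qed.

(** [PQ] says that the image under [X] of the measure with density [G] is [c] times [Q]. The rule
    passes from indicators to simple functions and then to limits by monotone convergence. It serves
    with [G] the product of the other independent factors, and with [G] the normal density. *)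
Lemma ge0_integral_weighted (f : U -> \bar R) :
  measurable_fun setT f -> (forall u, (0 <= f u)%E) ->
  (\int[P]_x ((G x)%:E * f (X x)) = c%:E * \int[Q]_u f u)%E.
Proof.
move=> mf f0; pose g := nnsfun_approx measurableT mf.
have gf u : (g n u)%:E @[n --> \oo] --> f u by exact: cvg_nnsfun_approx.
have ndg u a b : (a <= b)%N -> g a u <= g b u.
  by move=> ab; exact/lefP/nd_nnsfun_approx.
have cP : (\int[P]_x ((G x)%:E * (g n (X x))%:E))%E @[n --> \oo] -->
    (\int[P]_x ((G x)%:E * f (X x)))%E.
  rewrite (_ : (fun x => _ * f _)%E =
      fun x => limn (fun n => (G x)%:E * (g n (X x))%:E)%E); last first.
    apply/funext => x; apply/esym/cvg_lim => //; apply: cvgeZl => //; exact: gf.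
  apply: cvg_monotone_convergence => //.
  - move=> n; apply/measurable_EFinP/measurable_funM => //.
    exact: measurableT_comp.
  - by move=> n x _; rewrite lee_fin mulr_ge0.
  - by move=> x _ a b ab; rewrite lee_fin ler_wpM2l// ndg.
have cQ : (\int[Q]_u (g n u)%:E)%E @[n --> \oo] --> (\int[Q]_u f u)%E.
  rewrite (_ : f = fun u => limn (fun n => (g n u)%:E)); last first.
    by apply/funext => u; apply/esym/cvg_lim => //; exact: gf.
  apply: cvg_monotone_convergence => //.
  - by move=> n; apply/measurable_EFinP.
  - by move=> n u _; rewrite lee_fin.
  - by move=> u _ a b ab; rewrite lee_fin ndg.
have := cvgeZl (erefl : c%:E \is a fin_num) cQ.
under eq_fun do rewrite -integral_weighted_nnsfun.
by move=> cQ'; exact: (cvg_unique _ cP cQ').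
Qed.

Lemma integrable_weighted (f : U -> R) : Q.-integrable setT (EFin \o f) ->
  P.-integrable setT (EFin \o (fun x => G x * f (X x))).
Proof.
move=> intf; have mf : measurable_fun setT f.
  by apply/measurable_EFinP; exact: measurable_int intf.
apply/integrableP; split.
  by apply/measurable_EFinP/measurable_funM => //; exact: measurableT_comp.
under eq_integral do rewrite /= normrM (ger0_norm (G0 _)) EFinM.
rewrite (ge0_integral_weighted (f := fun u => `|f u|%:E))//; last first.
  by apply/measurable_EFinP; exact: measurableT_comp.
have /integrableP[_ foo] := intf.
rewrite -(@fineK _ (\int[Q]_u `|f u|%:E)%E) -?EFinM ?ltry//.
by rewrite ge0_fin_numE//; apply: integral_ge0.
Qed.

Lemma Rintegral_weighted (f : U -> R) : Q.-integrable setT (EFin \o f) ->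
  \int[P]_x (G x * f (X x)) = c * \int[Q]_u f u.
Proof.
move=> intf.
have rule (g : U -> R) : Q.-integrable setT (EFin \o g) ->
    (forall u, 0 <= g u) -> \int[P]_x (G x * g (X x)) = c * \int[Q]_u g u.
  move=> intg g0; rewrite /Rintegral; under eq_integral do rewrite EFinM.
  have mg : measurable_fun setT (EFin \o g) by exact: measurable_int intg.
  have g0' u : (0 <= (EFin \o g) u)%E by rewrite lee_fin.
  rewrite (ge0_integral_weighted mg g0').
  by rewrite fineM//; apply: integrable_fin_num => //; exact: intg.
have intp := integrable_funrpos measurableT intf.
have intn := integrable_funrneg measurableT intf.
have fE u : f u = f^\+ u - f^\- u by rewrite -[in LHS](funrposBneg f).
transitivity (\int[P]_x (G x * f^\+ (X x)) - \int[P]_x (G x * f^\- (X x))).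
  rewrite -RintegralB//=; [|exact: integrable_weighted..].
  by apply: eq_Rintegral => x _; rewrite -mulrBr -fE.
rewrite !rule// -mulrBr -RintegralB//; congr (_ * _).
by apply: eq_Rintegral => u _; rewrite /= -fE.
Qed.

End weighted_integral.

Section product_rule.
Context d d' (T : measurableType d) (U : measurableType d') (R : realType).
Context (n : nat) (P : probability T R) (Q : 'I_n -> probability U R).
Variable X : 'I_n -> T -> U.
Hypothesis mX : forall i, measurable_fun setT (X i).
Hypothesis PQ : forall B, (forall i, measurable (B i)) ->
  P [set x | forall i, B i (X i x)] = (\prod_(i < n) Q i (B i))%E.

Let measurable_prodX (p : pred 'I_n) (f : 'I_n -> U -> R) :
  (forall i, measurable_fun setT (f i)) ->
  measurable_fun setT (fun x => \prod_(i | p i) f i (X i x)).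
Proof.
move=> mf; rewrite (_ : (fun _ => _) =
    fun x => \prod_(i <- enum p) f i (X i x)); last first.
  by apply/funext => x; rewrite big_enum.
by apply: measurable_prod => i _; exact: measurableT_comp.
Qed.

(** Factors of index at least [m] are indicators. For [m = 0] the claim is the formula [PQ] on
    rectangles; each induction step frees one factor. *)
Let ge0_product_rule_rec m (f : 'I_n -> U -> R) :
  (forall i, measurable_fun setT (f i)) -> (forall i u, 0 <= f i u) ->
  (forall i, (Q i).-integrable setT (EFin \o f i)) ->
  (forall i : 'I_n, (m <= i)%N -> exists2 B, measurable B & f i = \1_B) ->
  (\int[P]_x (\prod_i f i (X i x))%:E =
   (\prod_i \int[Q i]_u f i u)%:E)%E.
Proof.
elim: m f => [|m ih] f mf f0 intf indf.
  have /choice[B BP] : forall i, exists B, measurable B /\ f i = \1_B.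
    by move=> i; have [B mB fB] := indf i (leq0n i); exists B.
  have mA : measurable [set x | forall i, B i (X i x)].
    apply: measurable_forall_ord => i; rewrite -[X in measurable X]setTI.
    by apply: mX => //; case: (BP i).
  transitivity (\int[P]_x (\1_[set x | forall i, B i (X i x)] x)%:E)%E.
    apply: eq_integral => x _; congr EFin.
    have [Bx|/existsNP[i nBx]] := pselect (forall i, B i (X i x)).
      rewrite indicE mem_set// big1// => i _; have [_ ->] := BP i.
      by rewrite indicE mem_set.
    rewrite indicE memNset; [|by move=> /(_ i)].
    rewrite (bigD1 i)//=; have [_ ->] := BP i.
    by rewrite indicE memNset// mul0r.
  rewrite integral_indic// setIT.
  transitivity (\prod_(i < n) Q i (B i))%E.
    by apply: PQ => i; case: (BP i).
  rewrite -prodEFin; apply: eq_bigr => i _.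
  have [mB ->] := BP i.
  by rewrite /Rintegral integral_indic// setIT fineK// fin_num_measure.
have [mn|nm] := ltnP m n; last first.
  by apply: ih => // i mi; have := ltn_ord i; rewrite ltnNge (leq_trans nm mi).
pose i0 := Ordinal mn.
pose G x := \prod_(i | i != i0) f i (X i x).
pose c := \prod_(i | i != i0) \int[Q i]_u f i u.
have G0 x : 0 <= G x by apply: prodr_ge0.
have mG : measurable_fun setT G by exact: measurable_prodX.
have c0 : 0 <= c by apply: prodr_ge0 => i _; apply: Rintegral_ge0.
(* With the factor [i0] replaced by an indicator the induction hypothesis applies; hence the law of
   [X i0], weighted by the remaining factors, is [c] times [Q i0]. *)
have GQ B : measurable B ->
    (\int[P]_x (G x * \1_B (X i0 x))%:E = c%:E * Q i0 B)%E.
  move=> mB; pose f' i := if i == i0 then \1_B else f i : U -> R.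
  have fB i : i != i0 -> f' i = f i by rewrite /f' => /negPf->.
  have fi0 : f' i0 = \1_B by rewrite /f' eqxx.
  transitivity (\int[P]_x (\prod_i f' i (X i x))%:E)%E.
    apply: eq_integral => x _; rewrite (bigD1 i0)//= mulrC fi0; congr (_ * _)%:E.
    by apply: eq_bigr => i /fB ->.
  rewrite ih.
  - rewrite (bigD1 i0)//= mulrC EFinM fi0; congr (_ * _)%E.
      by congr EFin; apply: eq_bigr => i /fB ->.
    by rewrite /Rintegral integral_indic// setIT fineK// fin_num_measure.
  - by move=> i; rewrite /f'; case: ifP.
  - by move=> i u; rewrite /f'; case: ifP.
  - move=> i; rewrite /f'; case: ifP => // _.
    exact: integrable_indic.
  - move=> i mi; rewrite /f'; case: eqVneq => [_|ii0]; first by exists B.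
    apply: indf; rewrite ltn_neqAle mi andbT; apply: contra_neq ii0 => mi'.
    exact/val_inj.
have fi0 : (\int[Q i0]_u f i0 u)%R%:E = (\int[Q i0]_u (f i0 u)%:E)%E.
  by rewrite /Rintegral fineK//; apply: integrable_fin_num => //; exact: intf.
rewrite [in RHS](bigD1 i0)//= mulrC EFinM fi0.
rewrite -(ge0_integral_weighted (mX i0) mG G0 GQ (f := EFin \o f i0)).
- by apply: eq_integral => x _; rewrite (bigD1 i0)//= mulrC EFinM.
- exact/measurable_EFinP.
- by move=> u; rewrite lee_fin.
Qed.

Let ge0_product_rule (f : 'I_n -> U -> R) :
  (forall i, measurable_fun setT (f i)) -> (forall i u, 0 <= f i u) ->
  (forall i, (Q i).-integrable setT (EFin \o f i)) ->
  (\int[P]_x (\prod_i f i (X i x))%:E =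
   (\prod_i \int[Q i]_u f i u)%:E)%E.
Proof.
move=> mf f0 intf; apply: (@ge0_product_rule_rec n) => // i ni.
by have := ltn_ord i; rewrite ltnNge ni.
Qed.

Lemma integrable_prod (f : 'I_n -> U -> R) :
  (forall i, (Q i).-integrable setT (EFin \o f i)) ->
  P.-integrable setT (EFin \o (fun x => \prod_i f i (X i x))).
Proof.
move=> intf.
have mf i : measurable_fun setT (f i).
  by apply/measurable_EFinP; exact: measurable_int (intf i).
apply/integrableP; split.
  by apply/measurable_EFinP; exact: measurable_prodX.
under eq_integral do rewrite /= normr_prod.
rewrite (@ge0_product_rule (fun i u => `|f i u|)) ?ltry// => i.
- exact: measurableT_comp.
- exact: (integrable_norm (intf i)).
Qed.

Lemma Rintegral_prod (f : 'I_n -> U -> R) :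
  (forall i, (Q i).-integrable setT (EFin \o f i)) ->
  \int[P]_x (\prod_i f i (X i x)) = \prod_i \int[Q i]_u f i u.
Proof.
(* Here factors of index at least [m] are nonnegative; each step splits one signed factor into its
   positive and negative parts. *)
suff rec m g : (forall i, (Q i).-integrable setT (EFin \o g i)) ->
    (forall (i : 'I_n) u, (m <= i)%N -> 0 <= g i u) ->
    \int[P]_x (\prod_i g i (X i x)) = \prod_i \int[Q i]_u g i u.
  by move=> intf; apply: (rec n) => // i u ni; have := ltn_ord i; rewrite ltnNge ni.
elim: m g => [|m ih] g intg g0.
  rewrite /Rintegral ge0_product_rule// => i.
  - by apply/measurable_EFinP; exact: measurable_int (intg i).
  - by move=> u; exact: g0.
have [mn|nm] := ltnP m n; last first.
  by apply: ih => // i u mi; have := ltn_ord i; rewrite ltnNge (leq_trans nm mi).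
pose i0 := Ordinal mn.
pose h b i := if i == i0 then (if b then (g i)^\+ else (g i)^\-) else g i.
have inth b i : (Q i).-integrable setT (EFin \o h b i).
  rewrite /h; case: ifP => // _; case: b => //.
    exact: (integrable_funrpos measurableT (intg i)).
  exact: (integrable_funrneg measurableT (intg i)).
have h0 b (i : 'I_n) u : (m <= i)%N -> 0 <= h b i u.
  move=> mi; rewrite /h; case: eqVneq => [_|ii0].
    by case: b; [exact: funrpos_ge0|exact: funrneg_ge0].
  apply: g0; rewrite ltn_neqAle mi andbT; apply: contra_neq ii0 => mi'.
  exact/val_inj.
have hi0 b : h b i0 = if b then (g i0)^\+ else (g i0)^\- by rewrite /h eqxx.
have hi b i : i != i0 -> h b i = g i by rewrite /h => /negPf->.
have gE u : g i0 u = h true i0 u - h false i0 u.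
  by rewrite !hi0 -[in LHS](funrposBneg (g i0)).
have hG b x : \prod_i h b i (X i x) =
    h b i0 (X i0 x) * \prod_(i | i != i0) g i (X i x).
  by rewrite (bigD1 i0)//=; congr (_ * _); apply: eq_bigr => i /hi ->.
have hI b : \prod_i \int[Q i]_u h b i u =
    \int[Q i0]_u h b i0 u * \prod_(i | i != i0) \int[Q i]_u g i u.
  by rewrite (bigD1 i0)//=; congr (_ * _); apply: eq_bigr => i /hi ->.
transitivity (\int[P]_x (\prod_i h true i (X i x)) -
              \int[P]_x (\prod_i h false i (X i x))).
  rewrite -RintegralB//=; [|exact: integrable_prod..].
  apply: eq_Rintegral => x _; rewrite !hG -mulrBl -gE.
  by rewrite (bigD1 i0).
rewrite (ih _ (inth true) (h0 true)) (ih _ (inth false) (h0 false)).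
rewrite (hI true) (hI false) -mulrBl.
rewrite -RintegralB//; [|exact: (inth _ i0)..].
rewrite [RHS](bigD1 i0)//=.
by congr (_ * _); apply: eq_Rintegral => u _; rewrite gE.
Qed.

End product_rule.

(** * Characteristic functions and the normal law *)

Section elementary.
Context {R : realType}.
Implicit Types x y : R.

(** Mean value theorem. The Taylor bounds for [sin] and [cos] below form a ladder: the derivative of
    each difference is the difference treated just before. *)
Lemma ge0_of_derive_ge0 (f df : R -> R) :
  (forall x, is_derive x 1 f (df x)) -> (forall x, 0 <= x -> 0 <= df x) ->
  f 0 = 0 -> forall x, 0 <= x -> 0 <= f x.
Proof.
move=> fdf df0 f0 x x0.
have [|c] := @MVT_segment _ f df _ _ x0 (fun y _ => fdf y).
  apply/continuous_subspaceT=> r.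
  exact/differentiable_continuous/derivable1_diffP.
rewrite in_itv/= => /andP[c0 _]; rewrite f0 !subr0 => ->.
by rewrite mulr_ge0// df0.
Qed.

Lemma sin_le_id x : 0 <= x -> sin x <= x.
Proof.
move=> x0; rewrite -subr_ge0.
apply: (@ge0_of_derive_ge0 (fun y => y - sin y) (fun y => 1 - cos y)) => //.
by rewrite sin0 subr0.
Qed.

Lemma cos_ge_sqr x : 1 - x ^+ 2 / 2 <= cos x.
Proof.
wlog x0 : x / 0 <= x.
  move=> h; have [/h//|x0] := leP 0 x.
  by have := h (- x); rewrite sqrrN cosN; apply; lra.
rewrite -subr_ge0.
apply: (@ge0_of_derive_ge0 (fun y => cos y - (1 - y ^+ 2 / 2))
  (fun y => y - sin y)) => //.
- move=> y; apply: is_derive_eq; rewrite /= /GRing.scale/=.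
  by field.
- by move=> y y0; rewrite subr_ge0 sin_le_id.
- by rewrite cos0; ring.
Qed.

Lemma sin_ge_cub x : 0 <= x -> x - x ^+ 3 / 6 <= sin x.
Proof.
move=> x0; rewrite -subr_ge0.
apply: (@ge0_of_derive_ge0 (fun y => sin y - (y - y ^+ 3 / 6))
  (fun y => cos y - (1 - y ^+ 2 / 2))) => //.
- by move=> y; apply: is_derive_eq; rewrite /= /GRing.scale/=; field.
- by move=> y _; rewrite subr_ge0 cos_ge_sqr.
- by rewrite sin0; ring.
Qed.

Lemma cos_le_quart x : cos x <= 1 - x ^+ 2 / 2 + x ^+ 4 / 24.
Proof.
wlog x0 : x / 0 <= x.
  move=> h; have [/h//|x0] := leP 0 x.
  have := h (- x); rewrite sqrrN cosN (_ : (- x) ^+ 4 = x ^+ 4); last by ring.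
  by apply; lra.
rewrite -subr_ge0.
apply: (@ge0_of_derive_ge0 (fun y => 1 - y ^+ 2 / 2 + y ^+ 4 / 24 - cos y)
  (fun y => sin y - (y - y ^+ 3 / 6))) => //.
- by move=> y; apply: is_derive_eq; rewrite /= /GRing.scale/=; field.
- by move=> y y0; rewrite subr_ge0 sin_ge_cub.
- by rewrite cos0; ring.
Qed.

Lemma norm_sin_sub_id x : `|sin x - x| <= x ^+ 2.
Proof.
wlog x0 : x / 0 <= x.
  move=> h; have [/h//|x0] := leP 0 x.
  have := h (- x); rewrite sqrrN sinN opprK -normrN opprD opprK; apply; lra.
have h1 := sin_le_id x0; have h2 := sin_ge_cub x0.
have [h3 h4] := (sin_geN1 x, sin_le1 x).
rewrite ler0_norm; last by rewrite subr_le0.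
have [x1|x1] := leP x 1; nra.
Qed.

(** The bound is uniform in [x]; integrated against the normal density, it gives differentiation
    under the integral sign in [normal_cos]. *)
Lemma cos_remainder x y : `|cos (x + y) - cos x + y * sin x| <= 2 * y ^+ 2.
Proof.
rewrite cosD [X in `|X|](_ : _ = cos x * (cos y - 1) - sin x * (sin y - y));
  last by ring.
apply: le_trans (ler_normB _ _) _; rewrite !normrM.
have h1 : `|cos x| <= 1 by rewrite ler_norml cos_geN1 cos_le1.
have h2 : `|sin x| <= 1 by rewrite ler_norml sin_geN1 sin_le1.
have h3 : `|cos y - 1| <= y ^+ 2.
  rewrite ler0_norm ?subr_le0 ?cos_le1//.
  by have := cos_ge_sqr y; have := sqr_ge0 y; lra.
have h4 := norm_sin_sub_id y.
rewrite mulrDl mul1r lerD//.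
  by rewrite -[leRHS]mul1r ler_pM.
by rewrite -[leRHS]mul1r ler_pM.
Qed.

(** The two terms mirror Lindeberg's condition: an argument below [e] costs a small multiple of its
    square, a larger one at most its full square. *)
Lemma cos_lindeberg x (e : R) : 0 < e ->
  `|cos x - (1 - x ^+ 2 / 2)| <= e * x ^+ 2 + x ^+ 2 * (e <= `|x|)%R%:R.
Proof.
move=> e0; have h1 := cos_ge_sqr x; have h2 := cos_le_quart x.
rewrite ger0_norm ?subr_ge0//; have h0 := sqr_ge0 x.
have h3 := cos_le1 x.
case: (leP e `|x|) => [ex|xe]; rewrite /= ?mulr1n ?mulr0n; first by rewrite mulr1; nra.
rewrite mulr0 addr0; have [e1|e1] := leP 1 e; first nra.
have x4 : x ^+ 4 = x ^+ 2 * x ^+ 2 by ring.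
have xe2 : x ^+ 2 <= e.
  by rewrite -real_normK ?num_real//; have := normr_ge0 x; nra.
by rewrite x4 in h2; nra.
Qed.

Lemma sin_lindeberg x (e : R) : 0 < e ->
  `|sin x - x| <= e * x ^+ 2 + x ^+ 2 * (e <= `|x|)%R%:R.
Proof.
move=> e0; have h0 := sqr_ge0 x.
have h1 := norm_sin_sub_id x.
case: (leP e `|x|) => [ex|xe]; rewrite /= ?mulr1n ?mulr0n; first by rewrite mulr1; nra.
rewrite mulr0 addr0.
wlog x0 : x h0 h1 xe / 0 <= x.
  move=> h; have [/h-> //|x0] := leP 0 x.
  have := h (- x); rewrite sqrrN sinN normrN opprK -(normrN (- _ + _)) opprD.
  by rewrite opprK; apply => //; lra.
have h2 := sin_le_id x0; have h3 := sin_ge_cub x0.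
rewrite ler0_norm; last by rewrite subr_le0.
move: xe; rewrite ger0_norm// => xe.
have x3 : x ^+ 3 = x ^+ 2 * x by ring.
by rewrite x3 in h3; nra.
Qed.

Lemma expR_remainder x : 0 <= x -> `|expR (- x) - (1 - x)| <= x ^+ 2.
Proof.
move=> x0; have h1 := expR_ge1Dx (- x); have h2 := expR_ge1Dx x.
rewrite ger0_norm; last by rewrite subr_ge0.
rewrite lerBlDr expRN.
rewrite (@le_trans _ _ (1 + x)^-1)//.
  by rewrite lef_pV2 ?posrE//; [exact: expR_gt0|lra].
by rewrite -div1r ler_pdivrMr; [have := exprn_ge0 3 x0|lra]; nra.
Qed.

End elementary.

Lemma bounded_integrable (R : realType) d (T : measurableType d) (P : probability T R)
    (f : T -> R) (M : R) :
  measurable_fun setT f -> (forall x, `|f x| <= M) ->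
  P.-integrable setT (EFin \o f).
Proof.
move=> mf fM; apply: measurable_bounded_integrable => //.
  by apply: le_lt_trans (ltry 1); exact: probability_le1.
exists M; split; first exact: num_real.
by move=> x Mx y _; apply: le_trans (fM y) (ltW Mx).
Qed.

Lemma Rintegral_cst_probability (R : realType) d (T : measurableType d)
    (P : probability T R) (c : R) : \int[P]_x c = c.
Proof.
rewrite Rintegral_cst// -[RHS]mulr1; congr (_ * _).
by rewrite -[RHS]/(fine 1%:E); congr fine; exact: probability_setT.
Qed.

Section gauss.
Context {R : realType}.
Implicit Types a c x y : R.
Notation N := (normal_prob (0 : R) 1).
Notation mu := (@lebesgue_measure R).
Notation pdf := (normal_pdf (0 : R) 1).

Lemma normal_pdf01E x : pdf x = normal_peak (1 : R) * expR (- x ^+ 2 / 2).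
Proof.
by rewrite normal_pdfE ?oner_neq0// /normal_fun subr0 expr1n.
Qed.

Lemma normal_prob_pdf B : measurable B ->
  (\int[mu]_x (pdf x * \1_B x)%:E = 1%:E * N B)%E.
Proof.
move=> mB; rewrite mul1e /normal_prob [RHS]integral_mkcond.
apply: eq_integral => x _; rewrite patchE indicE.
by case: ifP => _; rewrite ?mulr1 ?mulr0.
Qed.

Lemma integrable_sqr_pdf (k : R -> R) (M : R) : measurable_fun setT k ->
  (forall x, `|k x| <= M * (1 + x ^+ 2)) ->
  mu.-integrable setT (EFin \o (fun x => pdf x * k x)).
Proof.
move=> mk kM.
have M0 : 0 <= M by have := le_trans (normr_ge0 _) (kM 0); lra.
(* The dominating function is a multiple of the N(0, 4) density: [(1 + x ^+ 2) * exp (- x ^+ 2 / 2)]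
   is at most [8 / 3 * exp (- x ^+ 2 / 8)], by exp t >= 1 + t at t = 3 x^2 / 8. *)
pose C := M * normal_peak (1 : R) * (8 / 3) / normal_peak (2 : R).
have C0 : 0 <= C by rewrite /C !mulr_ge0 ?invr_ge0 ?normal_peak_ge0//; lra.
have intC : mu.-integrable setT (EFin \o (fun x => C * normal_pdf 0 2 x)).
  exact: (integrableZl measurableT C (integrable_normal_pdf 0 2)).
apply: (le_integrable measurableT _ _ intC) => /=.
  apply/measurable_EFinP/measurable_funM => //; exact: measurable_normal_pdf.
move=> x _; rewrite lee_fin normrM (ger0_norm (normal_pdf_ge0 _ _ _)).
rewrite [leRHS]ger0_norm; last by rewrite mulr_ge0// normal_pdf_ge0.
rewrite normal_pdf01E normal_pdfE ?pnatr_eq0// /normal_fun subr0.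
set e1 := expR _; set e2 := expR _.
have key : (1 + x ^+ 2) * e1 <= 8 / 3 * e2.
  rewrite /e1 (_ : - x ^+ 2 / 2 =
    - x ^+ 2 / (2 ^+ 2 *+ 2) + - (x ^+ 2 * (3 / 8))); last first.
    by rewrite -mulr_natr; field.
  rewrite expRD -/e2 mulrCA mulrC ler_wpM2r ?expR_ge0// expRN.
  rewrite ler_pdivrMr ?expR_gt0//.
  by have := expR_ge1Dx (x ^+ 2 * (3 / 8)); have := sqr_ge0 x; lra.
have p1 := normal_peak_ge0 (1 : R).
rewrite (_ : C * (normal_peak 2 * e2) = M * (normal_peak 1 * (8 / 3 * e2))).
  rewrite (@le_trans _ _ (M * (normal_peak 1 * ((1 + x ^+ 2) * e1))))//.
    rewrite (_ : M * _ = normal_peak 1 * e1 * (M * (1 + x ^+ 2))); last by ring.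
    by rewrite ler_wpM2l// mulr_ge0// expR_ge0.
  by rewrite !ler_wpM2l.
by rewrite /C; field; rewrite gt_eqF// normal_peak_gt0// pnatr_eq0.
Qed.

(** Stein's identity: the integrand is the derivative of [pdf x * sin (a * x + c)], which vanishes
    at infinity. The fundamental theorem of calculus on growing intervals and dominated convergence
    conclude. *)
Lemma integral_gauss_stein a c :
  \int[mu]_x (pdf x * (a * cos (a * x + c) - x * sin (a * x + c))) = 0.
Proof.
pose f x := pdf x * (a * cos (a * x + c) - x * sin (a * x + c)).
pose F x := pdf x * sin (a * x + c).
have Ff x : is_derive x 1 F (f x).
  rewrite (_ : F = fun x => normal_peak (1 : R) * expR (- x ^+ 2 / 2) *
                            sin (a * x + c)).
    apply: is_derive_eq; rewrite /= /GRing.scale/= /f normal_pdf01E.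
    by field.
  by apply/funext => y; rewrite /F normal_pdf01E.
have fE : f = fun x => normal_peak (1 : R) * expR (- x ^+ 2 / 2) *
    (a * cos (a * x + c) - x * sin (a * x + c)).
  by apply/funext => x; rewrite /f normal_pdf01E.
have cf : continuous f.
  move=> x; apply/differentiable_continuous/derivable1_diffP.
  by rewrite fE; exact: ex_derive.
have cF : continuous F.
  by move=> x; apply/differentiable_continuous/derivable1_diffP; exact: ex_derive.
pose D n : set R := `[- n.+1%:R, n.+1%:R]%classic.
have intf : mu.-integrable setT (EFin \o f).
  apply: (@integrable_sqr_pdf _ (`|a| + 1)).
    apply: continuous_measurable_fun => x.
    apply/differentiable_continuous/derivable1_diffP; exact: ex_derive.
  move=> x; apply: le_trans (ler_normB _ _) _; rewrite !normrM.
  have h1 : `|cos (a * x + c)| <= 1 by rewrite ler_norml cos_geN1 cos_le1.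
  have h2 : `|sin (a * x + c)| <= 1 by rewrite ler_norml sin_geN1 sin_le1.
  have h3 : `|x| <= 1 + x ^+ 2.
    by rewrite -(real_normK (num_real x)); have := normr_ge0 x; nra.
  have := normr_ge0 a; have := normr_ge0 x; have := sqr_ge0 x.
  have := normr_ge0 (cos (a * x + c)); have := normr_ge0 (sin (a * x + c)).
  nra.
have FTC n : (\int[mu]_x (EFin \o (fun x => f x * \1_(D n) x)%R) x =
    (F n.+1%:R - F (- n.+1%:R))%:E)%E.
  have n0 : - n.+1%:R < n.+1%:R :> R by rewrite gtrN.
  rewrite EFinB -(@continuous_FTC2 _ f F _ _ n0).
  - rewrite [RHS]integral_mkcond; apply: eq_integral => x _.
    by rewrite /= patchE indicE; case: ifP => _; rewrite ?mulr1 ?mulr0.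
  - exact: continuous_subspaceT.
  - split => [x _||]; first exact: ex_derive.
    + by apply: cvg_at_right_filter; exact: cF.
    + by apply: cvg_at_left_filter; exact: cF.
  - by move=> x _; rewrite derive1E; exact: derive_val.
have F0 : F n.+1%:R - F (- n.+1%:R) @[n --> \oo] --> 0.
  have Fle n (b : R) : `|b| = 1 ->
      `|F (b * n.+1%:R)| <= normal_peak (1 : R) * harmonic n.
    move=> b1; rewrite /F normrM ger0_norm ?normal_pdf_ge0//.
    rewrite -[leRHS]mulr1 ler_pM ?normal_pdf_ge0//; last first.
      by rewrite ler_norml sin_geN1 sin_le1.
    rewrite normal_pdf01E ler_wpM2l ?normal_peak_ge0// /harmonic/=.
    have b2 : b ^+ 2 = 1 by rewrite -(real_normK (num_real b)) b1 expr1n.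
    rewrite exprMn b2 mul1r mulNr expRN lef_pV2 ?posrE ?expR_gt0//.
    have := expR_ge1Dx (n.+1%:R ^+ 2 / 2 : R); have := sqr_ge0 (n.+1%:R - 1 : R).
    nra.
  apply/cvgr0Pnorm_le => e e0.
  have : normal_peak (1 : R) * 2 * harmonic n @[n --> \oo] -->
      normal_peak (1 : R) * 2 * 0.
    by apply: cvgM; [exact: cvg_cst|exact: cvg_harmonic].
  rewrite mulr0 => /cvgr0Pnorm_le/(_ _ e0); apply: filterS => n /=.
  apply: le_trans.
  have h1 := Fle n 1 (normr1 _); have h2 := Fle n (-1) (normrN1 _).
  rewrite mul1r mulN1r in h1 h2; apply: le_trans (ler_normB _ _) _.
  rewrite (le_trans (lerD h1 h2))// ger0_norm.
    by rewrite mulr2n mulrDr mulr1 mulrDl.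
  by rewrite !mulr_ge0 ?normal_peak_ge0// /harmonic/= invr_ge0.
have mf : measurable_fun setT f by exact: continuous_measurable_fun.
have := @dominated_convergence _ _ _ mu _ measurableT
  (fun n => EFin \o (fun x => f x * \1_(D n) x)) (EFin \o f) (fun x => `|f x|%:E).
case.
- move=> n; apply/measurable_EFinP/measurable_funM => //.
  apply: measurable_indic; exact: measurable_itv.
- exact/measurable_EFinP.
- apply: aeW => x _; apply: cvg_near_cst; near=> n.
  rewrite /= indicE mem_set ?mulr1// /D/= in_itv/= -ler_norml.
  apply: le_trans (_ : n%:R <= _); last by rewrite ler_nat.
  by near: n; exact: nbhs_infty_ger.
- exact: integrable_norm.
- apply: aeW => x n _; rewrite /= lee_fin normrM indicE.
  by case: (x \in _); rewrite ?normr1 ?normr0 ?mulr1 ?mulr0.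
move=> _ _; under eq_fun do rewrite FTC.
have : (F n.+1%:R - F (- n.+1%:R))%:E @[n --> \oo] --> 0%:E.
  by apply: cvg_EFin; [exact: nearW|exact: F0].
by move=> c1 c2; rewrite /Rintegral (cvg_unique _ c2 c1).
Unshelve. all: by end_near. Qed.

Lemma measurable_cos_affine a c :
  measurable_fun [set: R] (fun x => cos (a * x + c)).
Proof.
apply: continuous_measurable_fun => x.
by apply/differentiable_continuous/derivable1_diffP; exact: ex_derive.
Qed.

(** As a function of the frequency, the mean [phi] satisfies [phi' t = - t * phi t] by Stein's
    identity, so [phi t * expR (t ^+ 2 / 2)] is constant. *)
Lemma normal_cos a c :
  \int[N]_x cos (a * x + c) = cos c * expR (- a ^+ 2 / 2).
Proof.
pose phi t := \int[N]_x cos (t * x + c).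
have phiE t : phi t = \int[mu]_x (pdf x * cos (t * x + c)).
  have intN : N.-integrable setT (EFin \o (fun x => cos (t * x + c))).
    apply: (@bounded_integrable _ _ _ _ _ 1); first exact: measurable_cos_affine.
    by move=> x; rewrite ler_norml cos_geN1 cos_le1.
  have := @Rintegral_weighted _ _ (measurableTypeR R) (measurableTypeR R) R
    mu N (fun x => x) pdf 1 (@measurable_id _ _ setT) (measurable_normal_pdf 0 1)
    (@normal_pdf_ge0 R 0 1) normal_prob_pdf _ intN.
  by rewrite mul1r => ->.
have intcos t : mu.-integrable setT
    (EFin \o (fun x => pdf x * cos (t * x + c))).
  apply: (@integrable_sqr_pdf _ 1); first exact: measurable_cos_affine.
  move=> x; have : `|cos (t * x + c)| <= 1 by rewrite ler_norml cos_geN1 cos_le1.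
  by have := sqr_ge0 x; lra.
have intsin t : mu.-integrable setT
    (EFin \o (fun x => pdf x * (x * sin (t * x + c)))).
  apply: (@integrable_sqr_pdf _ 1).
    apply: continuous_measurable_fun => x.
    by apply/differentiable_continuous/derivable1_diffP; exact: ex_derive.
  move=> x; rewrite normrM.
  have h2 : `|sin (t * x + c)| <= 1 by rewrite ler_norml sin_geN1 sin_le1.
  have h3 : `|x| <= 1 + x ^+ 2.
    by rewrite -(real_normK (num_real x)); have := normr_ge0 x; nra.
  have := normr_ge0 (sin (t * x + c)); have := normr_ge0 x; nra.
have intsqr : mu.-integrable setT (EFin \o (fun x => pdf x * x ^+ 2)).
  apply: (@integrable_sqr_pdf _ 1) => // x.
  by rewrite ger0_norm ?sqr_ge0//; lra.
have intZ k (u : R -> R) : mu.-integrable setT (EFin \o u) ->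
    mu.-integrable setT (EFin \o (fun x => k * u x)).
  by move=> intu; exact: (integrableZl measurableT k intu).
have stein t : \int[mu]_x (pdf x * (x * sin (t * x + c))) = t * phi t.
  apply/eqP; rewrite eq_sym -subr_eq0 phiE -RintegralZl//.
  rewrite -RintegralB//; last exact: intZ.
  apply/eqP; rewrite -[RHS](integral_gauss_stein t c).
  by apply: eq_Rintegral => x _; rewrite mulrBr mulrCA.
pose M := 2 * \int[mu]_x (pdf x * x ^+ 2).
have dphi0 t h : `|phi (t + h) - phi t + h * (t * phi t)| <= M * h ^+ 2.
  rewrite -stein 2!phiE -RintegralZl// -RintegralB// -RintegralD//; last 2 first.
  - exact: (integrableB measurableT (intcos _) (intcos _)).
  - exact: intZ.
  have intD : mu.-integrable setT (EFin \o (fun x =>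
      pdf x * cos ((t + h) * x + c) - pdf x * cos (t * x + c) +
      h * (pdf x * (x * sin (t * x + c))))).
    exact: (integrableD measurableT
      (integrableB measurableT (intcos (t + h)) (intcos t)) (intZ h _ (intsin t))).
  apply: le_trans (le_normr_Rintegral measurableT intD) _.
  rewrite /M mulrAC -RintegralZl//; apply: le_Rintegral => //.
  - exact: integrable_norm.
  - exact: intZ.
  move=> x _; have := cos_remainder (t * x + c) (h * x).
  rewrite (_ : t * x + c + h * x = (t + h) * x + c); last by ring.
  rewrite [X in _ -> `|X| <= _](_ : _ = pdf x * (cos ((t + h) * x + c) - cos (t * x + c) +
    h * x * sin (t * x + c))); last by ring.
  rewrite normrM (ger0_norm (normal_pdf_ge0 _ _ _)).
  move=> /(ler_wpM2l (normal_pdf_ge0 0 1 x)) /le_trans; apply.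
  by rewrite (_ : _ * (2 * _) = 2 * h ^+ 2 * (pdf x * x ^+ 2)) //; ring.
have dphi (t : R) : is_derive t (1 : R) phi (- (t * phi t)).
  have cphi : h^-1 *: (phi (h *: 1 + t) - phi t) @[h --> 0^'] --> - (t * phi t).
    apply/cvgrPdist_le => e e0; near=> h.
    have h0 : h != 0 by near: h; exact: nbhs_dnbhs_neq.
    rewrite /GRing.scale/= mulr1 (addrC h) -opprD normrN.
    have -> : t * phi t + h^-1 * (phi (t + h) - phi t) =
        h^-1 * (phi (t + h) - phi t + h * (t * phi t)) by field.
    rewrite normrM normfV ler_pdivrMl ?normr_gt0//.
    have M1 : 0 < `|M| + 1 by have := normr_ge0 M; lra.
    apply: le_trans (dphi0 t h) _.
    rewrite -(real_normK (num_real h)) expr2 mulrA mulrC ler_wpM2l//.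
    have : `|h| <= e / (`|M| + 1).
      near: h; apply: dnbhs0_le; rewrite divr_gt0//.
    rewrite ler_pdivlMr// => hM.
    have := ler_norm M; have := normr_ge0 h; have := normr_ge0 M; nra.
  apply: DeriveDef; first by apply/cvg_ex; exists (- (t * phi t)).
  exact: cvg_lim.
have phi0 : phi 0 = cos c.
  rewrite /phi (_ : (fun x => _) = cst (cos c)); last first.
    by apply/funext => x; rewrite mul0r add0r.
  exact: Rintegral_cst_probability.
have : phi a * expR (a ^+ 2 / 2) = phi 0 * expR (0 ^+ 2 / 2).
  apply: (@is_derive_0_is_cst _ (fun t => phi t * expR (t ^+ 2 / 2))) => t.
  by apply: is_derive_eq; rewrite /= /GRing.scale/=; field.
rewrite phi0 expr0n/= mul0r expR0 mulr1 -/(phi a) => <-.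
by rewrite -mulrA -expRD mulNr subrr expR0 mulr1.
Unshelve. all: by end_near. Qed.

End gauss.

Section pr.
Context {d} {T : measurableType d} {R : realType}.
Implicit Types (P : probability T R) (A B C : set T).

Definition pr P A : R := fine (P A).

Lemma pr_EFin P A : measurable A -> P A = (pr P A)%:E.
Proof. by move=> mA; rewrite /pr fineK// fin_num_measure. Qed.

Lemma pr_ge0 P A : 0 <= pr P A. Proof. exact: fine_ge0. Qed.

Lemma pr_setT P : pr P setT = 1.
Proof. exact: (congr1 fine (probability_setT P)). Qed.

Lemma pr_le1 P A : measurable A -> pr P A <= 1.
Proof. by move=> mA; rewrite -lee_fin -pr_EFin// probability_le1. Qed.

Lemma pr_mono P A B : measurable A -> measurable B -> A `<=` B ->
  pr P A <= pr P B.
Proof.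
by move=> mA mB AB; rewrite -lee_fin -!pr_EFin// le_measure ?inE.
Qed.

Lemma pr_union P A B C : measurable A -> measurable B -> measurable C ->
  A `<=` B `|` C -> pr P A <= pr P B + pr P C.
Proof.
move=> mA mB mC ABC; have mBC : measurable (B `|` C) by exact: measurableU.
apply: le_trans (pr_mono P mA mBC ABC) _.
by rewrite -lee_fin EFinD -!pr_EFin// measureU2.
Qed.

Lemma pr_setC P A : measurable A -> pr P (~` A) = 1 - pr P A.
Proof.
move=> mA; apply: EFin_inj; rewrite -pr_EFin; last exact: measurableC.
by rewrite probability_setC// EFinB -pr_EFin.
Qed.

Lemma pr_bigcup P n (F : 'I_n -> set T) : (forall i, measurable (F i)) ->
  pr P [set x | exists i, F i x] <= \sum_i pr P (F i).
Proof.
move=> mF.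
rewrite (_ : [set _ | _] = \big[setU/set0]_(i < n) F i); last first.
  apply/seteqP; split=> x; rewrite -bigcup_seq.
    by case=> i Fix; exists i => //; exact: mem_index_enum.
  by case=> i _ Fix; exists i.
elim: (index_enum _) => [|i s ih]; first by rewrite !big_nil /pr measure0.
rewrite !big_cons; apply: le_trans (lerD (lexx _) ih).
apply: pr_union => //; last exact: bigsetU_measurable.
by apply: measurableU => //; exact: bigsetU_measurable.
Qed.

Lemma Rintegral_indic P A : measurable A -> \int[P]_x \1_A x = pr P A.
Proof.
by move=> mA; rewrite /Rintegral integral_indic// setIT.
Qed.

Lemma le_norm_Rintegral P (f : T -> R) M : measurable_fun setT f ->
  (forall x, `|f x| <= M) -> `|\int[P]_x f x| <= M.
Proof.
move=> mf fM; have intf := bounded_integrable P mf fM.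
apply: le_trans (le_normr_Rintegral measurableT intf) _.
rewrite -[leRHS](Rintegral_cst_probability P); apply: le_Rintegral => //.
  exact: integrable_norm.
apply: (@bounded_integrable _ _ _ _ _ `|M|) => // x.
Qed.

End pr.

(** * Replacement argument for cosines of independent sums *)

Section cos_product.
Context d d' (T : measurableType d) (U : measurableType d') (R : realType).
Context (n : nat) (P : probability T R) (Q : 'I_n -> probability U R).
Variables (X : 'I_n -> T -> U) (h : 'I_n -> U -> R).
Hypothesis mX : forall i, measurable_fun setT (X i).
Hypothesis PQ : forall B, (forall i, measurable (B i)) ->
  P [set x | forall i, B i (X i x)] = (\prod_(i < n) Q i (B i))%E.
Hypothesis mh : forall i, measurable_fun setT (h i).

Let mcosh i c : measurable_fun setT (fun u => cos (h i u + c)).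
Proof.
apply: (measurableT_comp (f := cos)).
  by apply: continuous_measurable_fun; exact: continuous_cos.
exact: measurable_funD.
Qed.

Let cos_le (x : R) : `|cos x| <= 1. Proof. by rewrite ler_norml cos_geN1 cos_le1. Qed.

(* [D s c] is the mean of [cos (c + sum_(i <- s) h i (X i))]. *)
Let D := fix D (s : seq 'I_n) (c : R) : R := if s is i :: s' then
  D s' c * \int[Q i]_u cos (h i u) + D s' (c + pi / 2) * \int[Q i]_u sin (h i u)
  else cos c.

(** Addition formula for means: phase [c + pi / 2] stands for minus the sine, so real numbers
    suffice. *)
Let DD s c x : D s (c + x) = D s c * cos x + D s (c + pi / 2) * sin x.
Proof.
elim: s c => [|i s ih] c /=; first by rewrite cosD cosDpihalf mulNr.
by rewrite addrAC !ih; ring.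
Qed.

Let measurable_cos_h i : measurable_fun setT (fun u => cos (h i u)).
Proof.
by apply: (eq_measurable_fun (fun u => cos (h i u + 0))) => // u _; rewrite addr0.
Qed.

Let measurable_sin_h i : measurable_fun setT (fun u => sin (h i u)).
Proof.
apply: (eq_measurable_fun (fun u => cos (h i u - pi / 2))) => // u _.
by rewrite cosBpihalf.
Qed.

Let measurable_prodX (p : pred 'I_n) (f : 'I_n -> U -> R) :
  (forall i, measurable_fun setT (f i)) ->
  measurable_fun setT (fun x => \prod_(i | p i) f i (X i x)).
Proof.
move=> mf; rewrite (_ : (fun _ => _) =
    fun x => \prod_(i <- enum p) f i (X i x)); last first.
  by apply/funext => x; rewrite big_enum.
by apply: measurable_prod => i _; exact: measurableT_comp.
Qed.

Let measurable_cos_sum s c :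
  measurable_fun setT (fun x => cos (\sum_(i <- s) h i (X i x) + c)).
Proof.
apply: (measurableT_comp (f := cos)).
  by apply: continuous_measurable_fun; exact: continuous_cos.
apply: measurable_funD => //; apply: measurable_sum => i.
exact: measurableT_comp.
Qed.

Let prod_le1 (p : pred 'I_n) (f : 'I_n -> R) : (forall i, `|f i| <= 1) ->
  `|\prod_(i | p i) f i| <= 1.
Proof.
by move=> f1; rewrite normr_prod; apply: prodr_ile1 => i _; rewrite normr_ge0 f1.
Qed.

Let integrable_cos_prod s c (p : pred 'I_n) (f : 'I_n -> U -> R) :
  (forall i, measurable_fun setT (f i)) -> (forall i u, `|f i u| <= 1) ->
  P.-integrable setT (EFin \o (fun x =>
    cos (\sum_(i <- s) h i (X i x) + c) * \prod_(i | p i) f i (X i x))).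
Proof.
move=> mf f1; apply: (@bounded_integrable _ _ _ _ _ 1).
  by apply: measurable_funM => //; exact: measurable_prodX.
by move=> x; rewrite normrM mulr_ile1// prod_le1.
Qed.

(** The addition formula splits the variable [i] off the sum and leaves a factor [cos (h i u)] or
    [sin (h i u)]. The induction needs a place to store it, hence the arbitrary product over the
    indices outside [s]. *)
Let DE s : uniq s -> forall c (f : 'I_n -> U -> R),
  (forall i, measurable_fun setT (f i)) -> (forall i u, `|f i u| <= 1) ->
  \int[P]_x (cos (\sum_(i <- s) h i (X i x) + c) *
             \prod_(i | i \notin s) f i (X i x)) =
  D s c * \prod_(i | i \notin s) \int[Q i]_u f i u.
Proof.
elim: s => [_ c f mf f1|i s ih /= /andP[nis us] c f mf f1].
  under eq_Rintegral do rewrite big_nil add0r /=.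
  have intf i : (Q i).-integrable setT (EFin \o f i).
    exact: (bounded_integrable _ (mf i) (f1 i)).
  rewrite RintegralZl//=; last exact: (integrable_prod mX PQ intf).
  by rewrite (Rintegral_prod mX PQ intf).
pose F (b : bool) j := if j == i then (fun u => if b then cos (h i u) else sin (h i u))
  else f j.
have mF b j : measurable_fun setT (F b j).
  by rewrite /F; case: ifP => // _; case: b.
have F1 b j u : `|F b j u| <= 1.
  rewrite /F; case: ifP => // _; case: b => //.
  by rewrite ler_norml sin_geN1 sin_le1.
have Fi b u : F b i u = if b then cos (h i u) else sin (h i u).
  by rewrite /F eqxx.
have Fj b j : j != i -> F b j = f j by rewrite /F => /negPf ->.
have splitE (G : 'I_n -> R) : \prod_(j | j \notin s) G j =
    G i * \prod_(j | j \notin i :: s) G j.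
  rewrite (bigD1 i)//=; congr (_ * _); apply: eq_bigl => j.
  by rewrite in_cons negb_or andbC.
have nF b (G : (U -> R) -> 'I_n -> R) :
    \prod_(j | j \notin i :: s) G (F b j) j = \prod_(j | j \notin i :: s) G (f j) j.
  by apply: eq_bigr => j; rewrite in_cons negb_or => /andP[/Fj ->].
have Is b : \int[P]_x (cos (\sum_(j <- s) h j (X j x) + (if b then c else c + pi / 2)) *
    \prod_(j | j \notin s) F b j (X j x)) =
    D s (if b then c else c + pi / 2) * (\int[Q i]_u F b i u *
    \prod_(j | j \notin i :: s) \int[Q j]_u f j u).
  by rewrite ih// splitE (nF b (fun g j => \int[Q j]_u g u)).
transitivity (\int[P]_x (cos (\sum_(j <- s) h j (X j x) + c) *
    \prod_(j | j \notin s) F true j (X j x)) +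
  \int[P]_x (cos (\sum_(j <- s) h j (X j x) + (c + pi / 2)) *
    \prod_(j | j \notin s) F false j (X j x))).
  rewrite -RintegralD//; [|exact: integrable_cos_prod..].
  apply: eq_Rintegral => x _; rewrite !splitE !Fi/=.
  rewrite !(nF _ (fun g j => g (X j x))) big_cons !mulrA -mulrDl; congr (_ * _).
  by rewrite -addrA addrC cosD addrA cosDpihalf; ring.
rewrite (Is true) (Is false).
transitivity ((D s c * \int[Q i]_u cos (h i u) +
  D s (c + pi / 2) * \int[Q i]_u sin (h i u)) *
  \prod_(j | j \notin i :: s) \int[Q j]_u f j u) => //.
have -> : \int[Q i]_u F true i u = \int[Q i]_u cos (h i u).
  by apply: eq_Rintegral => u _; rewrite Fi.
have -> : \int[Q i]_u F false i u = \int[Q i]_u sin (h i u).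
  by apply: eq_Rintegral => u _; rewrite Fi.
by set p := \prod_(j | _) _; ring.
Qed.

(** Lindeberg's replacement, one variable at a time: exchanging variable [i] costs [e i], because
    the other factors [r j] have product at most 1 in absolute value. All phases are treated
    together, since averaging over a variable shifts the phase. *)
Lemma cos_product_approx (r e : 'I_n -> R) :
  (forall i, `|r i| <= 1) ->
  (forall i c, `|\int[Q i]_u cos (h i u + c) - r i * cos c| <= e i) ->
  forall c, `|\int[P]_x cos (\sum_i h i (X i x) + c) - (\prod_i r i) * cos c|
            <= \sum_i e i.
Proof.
move=> r1 re c.
have -> : \int[P]_x cos (\sum_i h i (X i x) + c) = D (index_enum 'I_n) c.
  have m1 (i : 'I_n) : measurable_fun setT (fun _ : U => 1 : R) by [].
  have l1 (i : 'I_n) (u : U) : `|1 : R| <= 1 by rewrite normr1.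
  have := DE (index_enum_uniq _) c m1 l1.
  rewrite [in RHS]big_pred0 ?mulr1 => [<-|i]; last by rewrite mem_index_enum.
  apply: eq_Rintegral => x _; rewrite [X in _ * X]big_pred0 ?mulr1// => i.
  by rewrite mem_index_enum.
elim: (index_enum _) c => [|i s ih] c.
  by rewrite !big_nil mul1r subrr normr0.
rewrite !big_cons.
set ps := \prod_(j <- s) r j; set es := \sum_(j <- s) e j.
have ps1 : `|ps| <= 1.
  by rewrite /ps normr_prod; apply: prodr_ile1 => j _; rewrite normr_ge0 r1.
have intcs (b : bool) : (Q i).-integrable setT (EFin \o
    (fun u => D s (if b then c else c + pi / 2) * (if b then cos (h i u) else sin (h i u)))).
  apply: (@bounded_integrable _ _ _ _ _ `|D s (if b then c else c + pi / 2)|).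
    by apply: measurable_funM => //; case: b.
  move=> u; rewrite normrM -[leRHS]mulr1 ler_wpM2l//; case: b => //.
  by rewrite ler_norml sin_geN1 sin_le1.
have intc : (Q i).-integrable setT (EFin \o (fun u => cos (h i u + c))).
  by apply: (@bounded_integrable _ _ _ _ _ 1).
have intD : (Q i).-integrable setT (EFin \o (fun u => D s (c + h i u))).
  rewrite (_ : (fun u => _) = fun u => D s c * cos (h i u) +
    D s (c + pi / 2) * sin (h i u)); last by apply/funext => u; rewrite DD.
  exact: (integrableD measurableT (intcs true) (intcs false)).
(* The variable [i] is kept under the integral, where the induction hypothesis is used at the phase
   [c + h i u]. *)
have -> : D (i :: s) c = \int[Q i]_u D s (c + h i u).
  rewrite -[LHS]/(D s c * \int[Q i]_u cos (h i u) +
    D s (c + pi / 2) * \int[Q i]_u sin (h i u)).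
  rewrite -!RintegralZl//; last 2 first.
  - apply: (@bounded_integrable _ _ _ _ _ 1) => // u.
    by rewrite ler_norml sin_geN1 sin_le1.
  - by apply: (@bounded_integrable _ _ _ _ _ 1).
  rewrite -RintegralD//; [|exact: (intcs true)|exact: (intcs false)].
  by apply: eq_Rintegral => u _; rewrite [RHS]DD.
have intZc : (Q i).-integrable setT (EFin \o (fun u => ps * cos (h i u + c))).
  exact: (integrableZl measurableT ps intc).
rewrite (_ : _ - _ = \int[Q i]_u (D s (c + h i u) - ps * cos (h i u + c)) +
    ps * (\int[Q i]_u cos (h i u + c) - r i * cos c)); last first.
  by rewrite RintegralB// RintegralZl//; ring.
apply: le_trans (ler_normD _ _) _; rewrite addrC lerD//.
  by rewrite normrM -[leRHS]mul1r ler_pM.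
apply: le_norm_Rintegral.
  apply/measurable_EFinP; apply: measurable_int.
  exact: (integrableB measurableT intD intZc).
by move=> u; rewrite (addrC (h i u)) ih.
Qed.

End cos_product.

Lemma measurable_ge_set d (T : measurableType d) (R : realType) (f : T -> R) t :
  measurable_fun setT f -> measurable [set x | t <= f x].
Proof.
move=> mf; rewrite -[X in measurable X]setTI.
rewrite (_ : [set x | _] = f @^-1` `[t, +oo[); first exact: mf.
by apply/seteqP; split=> x /=; rewrite in_itv/= andbT.
Qed.

Lemma measurable_norm_ge d (T : measurableType d) (R : realType) (f : T -> R) t :
  measurable_fun setT f -> measurable [set x | t <= `|f x|].
Proof. by move=> mf; apply: measurable_ge_set; exact: measurableT_comp. Qed.

Lemma measurable_norm_le d (T : measurableType d) (R : realType) (f : T -> R) t :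
  measurable_fun setT f -> measurable [set x | `|f x| <= t].
Proof.
move=> mf; rewrite (_ : [set x | _] = [set x | - t <= - `|f x|]).
  by apply: measurable_ge_set; do 2 apply: measurableT_comp => //.
by apply/seteqP; split=> x /=; rewrite lerN2.
Qed.

Lemma pr_tail d (T : measurableType d) (R : realType) (P : probability T R)
    (f : T -> R) e : measurable_fun setT f -> 0 < e ->
  exists2 L, 0 < L & pr P [set x | `|f x| <= L] >= 1 - e.
Proof.
move=> mf e0; pose F n := [set x | `|f x| <= n%:R].
have mF n : measurable (F n) by exact: measurable_norm_le.
have : P (F n) @[n --> \oo] --> P (\bigcup_n F n).
  apply: nondecreasing_cvg_mu => //; first exact: bigcup_measurable.
  move=> n m nm; apply/subsetPset => x; rewrite /F/= => /le_trans; apply.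
  by rewrite ler_nat.
have -> : \bigcup_n F n = setT.
  rewrite -subTset => x _; exists (Num.truncn `|f x|).+1 => //.
  by rewrite /F/= ltW// Num.Theory.truncnS_gt.
rewrite probability_setT => /fine_cvgP[_ /cvgrPdist_le/(_ _ e0)].
move=> [n0 _ /(_ n0.+1 (leqnSn _))]/=.
rewrite -/(pr P (F n0.+1)) => h; exists n0.+1%:R => //.
by move: h; rewrite ler_distl => /andP[]; lra.
Qed.

Section normal_bounds.
Context {R : realType}.
Notation N := (normal_prob (0 : R) 1).
Notation mu := (@lebesgue_measure R).
Notation pdf := (normal_pdf (0 : R) 1).

Lemma normal_pdf01_le1 x : pdf x <= 1.
Proof.
apply: le_trans (normal_pdf_ub 0 x (oner_neq0 _)) _.
rewrite /normal_peak invf_le1 ?sqrtr_gt0.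
  rewrite -[leLHS]sqrtr1 ler_wsqrtr// expr1n mul1r.
  by have := @pi_ge2 R; rewrite mulr2n; lra.
by rewrite expr1n mul1r mulrn_wgt0// pi_gt0.
Qed.

Lemma pr_normal_itv_le (a b : R) : a <= b -> pr N `[a, b] <= b - a.
Proof.
move=> ab; rewrite -lee_fin -pr_EFin; last exact: measurable_itv.
rewrite -[leLHS]/(\int[mu]_(x in `[a, b]) (pdf x)%:E)%E.
apply: (@le_trans _ _ (\int[mu]_(x in `[a, b]) (cst 1%E x))%E).
  apply: ge0_le_integral => //=.
  - by move=> x _; rewrite lee_fin normal_pdf_ge0.
  - apply/measurable_EFinP; apply: measurable_funTS.
    exact: measurable_normal_pdf.
  - by move=> x _; rewrite lee_fin normal_pdf01_le1.
rewrite integral_cst//= mul1e lebesgue_measure_itv/= lte_fin.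
by case: ltP => // ba; rewrite lee_fin subr_ge0.
Qed.

Lemma pr_normal_itv_ge (a b t : R) : a <= b -> - t <= a -> b <= t ->
  (b - a) * pdf t <= pr N `[a, b].
Proof.
move=> ab ta bt; rewrite -lee_fin -pr_EFin; last exact: measurable_itv.
rewrite -[leRHS]/(\int[mu]_(x in `[a, b]) (pdf x)%:E)%E.
apply: (@le_trans _ _ (\int[mu]_(x in `[a, b]) (cst (pdf t)%:E x))%E).
  rewrite integral_cst//= lebesgue_measure_itv/= lte_fin.
  case: ltP => [|ba]; first by rewrite -EFinB -EFinM mulrC.
  rewrite mule0 lee_fin (_ : b - a = 0) ?mul0r//.
  by apply/eqP; rewrite subr_eq0 eq_le ba ab.
apply: ge0_le_integral => //=.
- by move=> x _; rewrite lee_fin normal_pdf_ge0.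
- apply/measurable_EFinP; apply: measurable_funTS.
  exact: measurable_normal_pdf.
- move=> x; rewrite in_itv/= => /andP[ax xb].
  rewrite lee_fin !normal_pdf01E ler_wpM2l ?normal_peak_ge0// ler_expR.
  have : 0 <= (t - x) * (t + x) by apply: mulr_ge0; lra.
  by nra.
Qed.

(** The difference of the two events lies in two intervals of length [e], on which the density is at
    most 1. *)
Lemma pr_normal_norm_cts (t e : R) : 0 <= t -> 0 <= e ->
  pr N [set x | `|x| <= t + e] <= pr N [set x | `|x| <= t] + 2 * e.
Proof.
move=> t0 e0.
have mN s : measurable [set x : measurableTypeR R | `|x| <= s].
  exact: measurable_norm_le.
have h1 := pr_normal_itv_le (ltac:(lra) : t <= t + e).
have h2 := pr_normal_itv_le (ltac:(lra) : - (t + e) <= - t).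
have h : [set x | `|x| <= t + e] `<=`
    [set x | `|x| <= t] `|` (`[t, t + e] `|` `[- (t + e), - t]).
  move=> x /=; rewrite !in_itv/= ler_norml => /andP[x1 x2].
  have [xt|xt] := leP `|x| t; [by left|right].
  have [x0|x0] := leP 0 x.
    by left; move: xt; rewrite ger0_norm// => xt; lra.
  by right; move: xt; rewrite ltr0_norm// => xt; lra.
have m1 : measurable (`[t, t + e] : set (measurableTypeR R)).
  exact: measurable_itv.
have m2 : measurable (`[- (t + e), - t] : set (measurableTypeR R)).
  exact: measurable_itv.
have := pr_union N (mN _) (mN _) (measurableU _ _ m1 m2) h.
have := pr_union N (measurableU _ _ m1 m2) m1 m2 (@subset_refl _ _).
by lra.
Qed.

(** Brings the recursive construction of [iid_normal] into the form that the independence results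
    assume. *)
Lemma iid_normal_product k (B : 'I_k -> set R) :
  (forall i, measurable (B i : set (measurableTypeR R))) ->
  iid_normal k [set w | forall i, B i (tnth w i)] = (\prod_i N (B i))%E.
Proof.
elim: k B => [|k ih] B mB.
  rewrite big_ord0 /= diracE mem_set// => i; by case: i.
rewrite big_ord_recl -ih//.
rewrite -[LHS]/((N \x iid_normal k)%E
  (@Defs.cons_tuple R k @^-1` [set w | forall i, B i (tnth w i)])).
rewrite (_ : _ @^-1` _ = B ord0 `*` [set w | forall i, B (lift ord0 i) (tnth w i)]);
  last first.
  apply/seteqP; split=> -[x w]/=.
    move=> Bw; split; first exact: (Bw ord0).
    by move=> i; have := Bw (lift ord0 i); rewrite tnthS.
  move=> [Bx Bw] i; case: (unliftP ord0 i) => [j ->|->//].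
  by rewrite tnthS.
rewrite product_measure1E//.
apply: measurable_forall_ord => i; rewrite -[X in measurable X]setTI.
by apply: measurable_tnth.
Qed.

(** An instance of [cos_product_approx] with all errors 0, as [normal_cos] is exact. *)
Lemma iid_normal_cos k (a : 'I_k -> R) c :
  \int[iid_normal k]_w cos (\sum_i a i * tnth w i + c) =
  expR (- (\sum_i a i ^+ 2) / 2) * cos c.
Proof.
pose r i := expR (- (a i) ^+ 2 / 2).
have mt (i : 'I_k) : measurable_fun setT
    (fun w : k.-tuple (measurableTypeR R) => tnth w i) by exact: measurable_tnth.
have ma (i : 'I_k) : measurable_fun setT (fun x : measurableTypeR R => a i * x).
  exact: measurable_funM.
have r1 i : `|r i| <= 1.
  rewrite ger0_norm ?expR_ge0// -[leRHS]expR0 ler_expR.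
  by have := sqr_ge0 (a i); lra.
have re i e : `|\int[N]_x cos (a i * x + e) - r i * cos e| <= 0.
  by rewrite normal_cos mulrC subrr normr0.
have := cos_product_approx mt (@iid_normal_product k) ma r1 re c.
rewrite [leRHS]big1// normr_le0 subr_eq0 -expR_sum => /eqP ->.
by rewrite -mulr_suml sumrN.
Qed.

End normal_bounds.

(** * Comparison of laws on boxes *)

Section trig_poly.
Context {R : realType} {k : nat}.
Implicit Types (f g : ('I_k -> R) -> R) (M C : R).

(** [M] bounds the frequencies and [C] the sum of the absolute values of the coefficients. If cosine
    means agree within e up to frequency [M], the means of [f] agree within [C] times e; tracking
    both numbers lets them be chosen before the laws are known. *)
Inductive trig_poly : R -> R -> (('I_k -> R) -> R) -> Prop :=
| trig_poly_cos u c M C : (forall j, `|u j| <= M) -> 1 <= C ->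
    trig_poly M C (fun z => cos (\sum_j u j * z j + c))
| trig_poly_add M C1 C2 C f g : trig_poly M C1 f -> trig_poly M C2 g ->
    C1 + C2 <= C -> trig_poly M C (fun z => f z + g z)
| trig_poly_scale a M C C' f : trig_poly M C f -> `|a| * C <= C' ->
    trig_poly M C' (fun z => a * f z).

Lemma trig_poly_ge0 M C f : trig_poly M C f -> 0 <= C.
Proof.
elim=> {M C f} [u c M C _ C1|M C1 C2 C f g _ c1 _ c2 ?|a M C C' f _ c0 ?].
- by lra.
- by lra.
- by have := normr_ge0 a; nra.
Qed.

Lemma trig_poly_eq M C f g : f =1 g -> trig_poly M C f -> trig_poly M C g.
Proof. by move=> /funext ->. Qed.

(** By the product-to-sum formula frequencies add up, and the coefficient bounds multiply. *)
Lemma trig_poly_mul M M' C C' f g : trig_poly M C f -> trig_poly M' C' g ->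
  trig_poly (M + M') (C * C') (fun z => f z * g z).
Proof.
move=> fP gP; have C'0 := trig_poly_ge0 gP.
elim: fP => {M C f}.
- move=> u c M C uM C1; elim: gP C'0 => {M' C' g}.
  + move=> v e M' C' vM' C'1 _.
    apply: (@trig_poly_eq _ _ (fun z =>
      2^-1 * cos (\sum_j (u j + v j) * z j + (c + e)) +
      2^-1 * cos (\sum_j (u j - v j) * z j + (c - e)))).
      move=> z; under eq_bigr do rewrite mulrDl.
      under [X in cos (X + (c - e))]eq_bigr do rewrite mulrBl.
      rewrite big_split/= sumrB.
      set s := \sum_j _; set t := \sum_j _.
      rewrite (_ : s + t + (c + e) = (s + c) + (t + e)); last by ring.
      rewrite (_ : s - t + (c - e) = (s + c) - (t + e)); last by ring.
      by rewrite cosD cosB; field.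
    apply: (@trig_poly_add _ 2^-1 2^-1); last by nra.
    * apply: (@trig_poly_scale _ _ 1); last by rewrite ger0_norm; lra.
      apply: trig_poly_cos => // j; apply: le_trans (ler_normD _ _) _.
      by rewrite lerD.
    * apply: (@trig_poly_scale _ _ 1); last by rewrite ger0_norm; lra.
      apply: trig_poly_cos => // j; apply: le_trans (ler_normB _ _) _.
      by rewrite lerD.
  + move=> M' C1' C2' C' f g fP ihf gP ihg CC _.
    have c1 := trig_poly_ge0 fP; have c2 := trig_poly_ge0 gP.
    have CC' : C * C1' + C * C2' <= C * C' by nra.
    apply: trig_poly_eq (trig_poly_add (ihf c1) (ihg c2) CC').
    by move=> z; rewrite mulrDr.
  + move=> a M' C0 C' f fP ihf aC _; have c0 := trig_poly_ge0 fP.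
    have aC' : `|a| * (C * C0) <= C * C' by rewrite mulrCA; nra.
    apply: trig_poly_eq (trig_poly_scale (ihf c0) aC').
    by move=> z; rewrite mulrCA.
- move=> M C1 C2 C f h fP ihf hP ihh CC.
  have CC'' : C1 * C' + C2 * C' <= C * C' by nra.
  apply: trig_poly_eq (trig_poly_add ihf ihh CC'').
  by move=> z; rewrite mulrDl.
- move=> a M C0 C f fP ihf aC.
  have aC' : `|a| * (C0 * C') <= C * C' by rewrite mulrA; nra.
  apply: trig_poly_eq (trig_poly_scale ihf aC').
  by move=> z; rewrite mulrA.
Qed.

Lemma trig_poly_cst M (c C : R) : 0 <= M -> `|c| <= C -> trig_poly M C (fun=> c).
Proof.
move=> M0 cC.
apply: (@trig_poly_eq _ _ (fun z => c * cos (\sum_j 0 * z j + 0))).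
  by move=> z; rewrite big1 ?addr0 ?cos0 ?mulr1// => j _; rewrite mul0r.
apply: (@trig_poly_scale _ _ 1); last by rewrite mulr1.
by apply: trig_poly_cos => // j; rewrite normr0.
Qed.

Lemma trig_poly_prod (I : Type) (s : seq I) M C (f : I -> ('I_k -> R) -> R) :
  (forall i, trig_poly M C (f i)) -> 0 <= M ->
  trig_poly (M *+ size s) (C ^+ size s) (fun z => \prod_(i <- s) f i z).
Proof.
move=> fP M0; elim: s => [|i s ih].
  apply: (trig_poly_eq (f := fun=> 1)); first by move=> z; rewrite big_nil.
  by apply: trig_poly_cst => //; rewrite normr1.
rewrite mulrS exprS; apply: trig_poly_eq (trig_poly_mul (fP i) ih).
by move=> z; rewrite big_cons.
Qed.

End trig_poly.

Section walk.
Context {R : realType}.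

(* The mean of [f S] for [S] binomial with parameters [N] and [x]. *)
Fixpoint binomial_mean N (f : nat -> R) (x : R) : R :=
  if N is N'.+1 then
    x * binomial_mean N' (fun i => f i.+1) x + (1 - x) * binomial_mean N' f x
  else f 0%N.

Lemma binomial_mean_le N f g (x : R) : 0 <= x <= 1 -> (forall i, f i <= g i) ->
  binomial_mean N f x <= binomial_mean N g x.
Proof.
move=> /andP[x0 x1]; elim: N f g => [|N ih] f g fg /=; first exact: fg.
by rewrite lerD// ler_wpM2l ?subr_ge0// ih.
Qed.

Lemma binomial_mean_affine N f a b x :
  binomial_mean N (fun i => a + b * f i) x = a + b * binomial_mean N f x.
Proof. by elim: N f => [//|N ih] f /=; rewrite !ih; ring. Qed.

Lemma binomial_mean_cst N c x : binomial_mean N (fun=> c) x = c.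
Proof. by elim: N => [//|N ih] /=; rewrite ih; ring. Qed.

Lemma binomial_mean_sqr N a x :
  binomial_mean N (fun i => (i%:R - a) ^+ 2) x =
  (N%:R * x - a) ^+ 2 + N%:R * x * (1 - x).
Proof.
elim: N a => [|N ih] a /=; first by ring.
rewrite (_ : (fun i => _) = fun i : nat => (i%:R - (a - 1)) ^+ 2).
  by rewrite !ih -natr1; ring.
by apply/funext => i; rewrite -natr1; congr (_ ^+ 2); ring.
Qed.

(** For [N > 0], the Bernstein polynomial of degree [N] in [x] of the indicator of [y, 1]: the
    probability that the average of [N] Bernoulli variables of mean [x] is at least [y]. *)
Definition smooth_step N (y x : R) : R :=
  binomial_mean N (fun i => (N%:R * y <= i%:R)%R%:R) x.

Lemma smooth_step_ge0 N (y x : R) : 0 <= x <= 1 -> 0 <= smooth_step N y x.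
Proof.
move=> x01; rewrite -(binomial_mean_cst N 0 x).
by apply: binomial_mean_le.
Qed.

Lemma smooth_step_le1 N (y x : R) : 0 <= x <= 1 -> smooth_step N y x <= 1.
Proof.
move=> x01; rewrite -[leRHS](binomial_mean_cst N 1 x).
by apply: binomial_mean_le => // i; case: (N%:R * y <= i%:R).
Qed.

(** Chebyshev's inequality: a binomial variable has variance [N x (1 - x)], at most [N], and to fall
    below [N y] it must deviate from its mean by at least [N e]. [smooth_step_lo] is the other
    side. *)
Lemma smooth_step_hi N (y x e : R) : (0 < N)%N -> 0 <= x <= 1 -> 0 < e -> y + e <= x ->
  1 - (N%:R * e ^+ 2)^-1 <= smooth_step N y x.
Proof.
move=> N0 x01 e0 yx; have N0' : 0 < N%:R :> R by rewrite ltr0n.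
pose c := (N%:R * e) ^- 2.
have c0 : 0 <= c by rewrite invr_ge0 sqr_ge0.
apply: (@le_trans _ _ (1 + - c * (N%:R * x * (1 - x)))).
  rewrite mulNr lerD2l lerN2.
  rewrite (_ : (_ * e ^+ 2)^-1 = c * N%:R); last first.
    by rewrite /c; field; rewrite !gt_eqF.
  by rewrite ler_wpM2l// -mulrA ler_piMr//; case/andP: x01 => *; nra.
have := binomial_mean_sqr N (N%:R * x) x.
rewrite subrr expr0n/= add0r => <-; rewrite -binomial_mean_affine.
apply: binomial_mean_le => // i.
case: (leP (N%:R * y) i%:R) => [_|iy].
  by rewrite mulNr gerBl mulr_ge0// sqr_ge0.
rewrite mulNr subr_le0 /c mulrC ler_pdivlMr ?exprn_gt0 ?mulr_gt0// mul1r.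
rewrite -[leRHS]sqrrN ler_sqr ?nnegrE; [|nra..].
by nra.
Qed.

Lemma smooth_step_lo N (y x e : R) : (0 < N)%N -> 0 <= x <= 1 -> 0 < e -> x <= y - e ->
  smooth_step N y x <= (N%:R * e ^+ 2)^-1.
Proof.
move=> N0 x01 e0 yx; have N0' : 0 < N%:R :> R by rewrite ltr0n.
pose c := (N%:R * e) ^- 2.
have c0 : 0 <= c by rewrite invr_ge0 sqr_ge0.
apply: (@le_trans _ _ (0 + c * (N%:R * x * (1 - x)))); last first.
  rewrite add0r (_ : (_ * e ^+ 2)^-1 = c * N%:R); last first.
    by rewrite /c; field; rewrite !gt_eqF.
  by rewrite ler_wpM2l// -mulrA ler_piMr//; case/andP: x01 => *; nra.
have := binomial_mean_sqr N (N%:R * x) x.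
rewrite subrr expr0n/= add0r => <-; rewrite -binomial_mean_affine.
apply: binomial_mean_le => // i; rewrite add0r.
case: (leP (N%:R * y) i%:R) => [iy|_]; last by rewrite mulr_ge0// sqr_ge0.
rewrite /c mulrC ler_pdivlMr ?exprn_gt0 ?mulr_gt0// mul1r.
by rewrite ler_sqr ?nnegrE; nra.
Qed.

End walk.

Lemma measurable_cos_lin (R : realType) d (T : measurableType d) k
    (X : 'I_k -> T -> R) (u : 'I_k -> R) c :
  (forall j, measurable_fun setT (X j)) ->
  measurable_fun setT (fun x => cos (\sum_j u j * X j x + c)).
Proof.
move=> mX; apply: (measurableT_comp (f := cos)).
  by apply: continuous_measurable_fun; exact: continuous_cos.
apply: measurable_funD => //; apply: measurable_sum => i.
exact: measurable_funM.
Qed.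

(** The phase makes cosines enough: [c = 0] compares the real parts of the characteristic functions,
    [c = - pi / 2] the imaginary parts. *)
Definition cf_close (R : realType) k (M e : R)
    d1 (T1 : measurableType d1) (P1 : probability T1 R) (X : 'I_k -> T1 -> R)
    d2 (T2 : measurableType d2) (P2 : probability T2 R) (Z : 'I_k -> T2 -> R) :=
  forall (u : 'I_k -> R) c, (forall j, `|u j| <= M) ->
    `|\int[P1]_x cos (\sum_j u j * X j x + c) -
      \int[P2]_x cos (\sum_j u j * Z j x + c)| <= e.

Lemma trig_poly_mean (R : realType) k d (T : measurableType d)
    (P : probability T R) (X : 'I_k -> T -> R) M C (f : ('I_k -> R) -> R) :
  (forall j, measurable_fun setT (X j)) -> trig_poly M C f ->
  P.-integrable setT (EFin \o (fun x => f (X ^~ x))).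
Proof.
move=> mX; elim=> {M C f}.
- move=> u c M C _ _; apply: (@bounded_integrable _ _ _ _ _ 1).
    exact: measurable_cos_lin.
  by move=> x; rewrite ler_norml cos_geN1 cos_le1.
- by move=> M C1 C2 C f g _ intf _ intg _; exact: (integrableD measurableT intf intg).
- by move=> a M C C' f _ intf _; exact: (integrableZl measurableT a intf).
Qed.

Lemma cf_close_trig_poly (R : realType) k (M e : R)
    d1 (T1 : measurableType d1) (P1 : probability T1 R) (X : 'I_k -> T1 -> R)
    d2 (T2 : measurableType d2) (P2 : probability T2 R) (Z : 'I_k -> T2 -> R)
    C (f : ('I_k -> R) -> R) :
  (forall j, measurable_fun setT (X j)) -> (forall j, measurable_fun setT (Z j)) ->
  0 <= e -> cf_close M e P1 X P2 Z -> trig_poly M C f ->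
  `|\int[P1]_x f (X ^~ x) - \int[P2]_x f (Z ^~ x)| <= C * e.
Proof.
move=> mX mZ e0 + fP; elim: fP => {M C f}.
- move=> u c M C uM C1 XZ; apply: le_trans (XZ _ c uM) _; nra.
- move=> M C1 C2 C f g fP ihf gP ihg CC XZ.
  rewrite !RintegralD//; try exact: (trig_poly_mean _ _ fP);
    try exact: (trig_poly_mean _ _ gP).
  rewrite opprD addrACA; apply: le_trans (ler_normD _ _) _.
  by apply: le_trans (lerD (ihf XZ) (ihg XZ)) _; nra.
- move=> a M C C' f fP ih aC XZ.
  rewrite !RintegralZl//; try exact: (trig_poly_mean _ _ fP).
  rewrite -mulrBr normrM.
  by apply: le_trans (ler_wpM2l (normr_ge0 a) (ih XZ)) _; nra.
Qed.

Lemma bernoulli_prod (R : realType) k (q : 'I_k -> R) (e : R) : 0 <= e <= 1 ->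
  (forall j, 1 - e <= q j) -> 1 - k%:R * e <= \prod_j q j.
Proof.
move=> /andP[e0 e1] qe.
have h : 1 - k%:R * e <= (1 - e) ^+ k.
  elim: (k) => [|n ih]; first by rewrite mul0r subr0 expr0.
  rewrite exprS; apply: (@le_trans _ _ ((1 - e) * (1 - n%:R * e))).
    have : 0 <= n%:R * (e * e) by rewrite !mulr_ge0.
    by rewrite -natr1; nra.
  by rewrite ler_wpM2l// subr_ge0.
apply: le_trans h _; rewrite -[in X in X <= _](card_ord k) -prodr_const.
by apply: ler_prod => j _; rewrite qe andbT subr_ge0.
Qed.

Section cos_gap.
Context {R : realType}.
Implicit Types (L t b z : R).

Lemma ler_cos_norm (x y : R) : `|x| <= `|y| -> `|y| <= pi -> cos y <= cos x.
Proof.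
have cosE (z : R) : cos z = cos `|z|.
  by case: (leP 0 z) => z0; [rewrite ger0_norm|rewrite ltr0_norm// cosN].
move=> xy ypi; rewrite (cosE x) (cosE y) leNgt ltr_cos ?in_itv/= ?normr_ge0//.
  by rewrite -leNgt.
exact: le_trans ypi.
Qed.

(** With midpoint x and half-length y of the interval, scaled by [pi / L], the difference is 2 sin x
    sin y, and sin y <= sin x because y <= x <= pi - y. *)
Lemma cos_gap L t b : 0 < b -> 0 <= t -> t + b <= L ->
  2 * sin (pi / L * (b / 2)) ^+ 2 <= cos (pi / L * t) - cos (pi / L * (t + b)).
Proof.
move=> b0 t0 tbL; have L0 : 0 < L by lra.
have pi0 := @pi_gt0 R; set w := pi / L.
have w0 : 0 < w by rewrite divr_gt0.
have wL : w * L = pi by rewrite /w divfK// gt_eqF.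
pose y := w * (b / 2); pose x := w * (t + b / 2).
have y0 : 0 < y by rewrite mulr_gt0//; lra.
have yx : y <= x by rewrite ler_wpM2l ?(ltW w0)//; lra.
have xy : x + y <= pi by rewrite -wL -mulrDr ler_wpM2l ?(ltW w0)//; lra.
rewrite (_ : w * t = x - y); last by rewrite /x /y; ring.
rewrite (_ : w * (t + b) = x + y); last by rewrite /x /y; field.
rewrite cosB cosD -/y.
have sy0 : 0 <= sin y by rewrite sin_ge0_pi//; lra.
have sxy : sin y <= sin x.
  rewrite -!cosBpihalf; apply: ler_cos_norm; last first.
    by rewrite ler_norml; lra.
  by rewrite [leRHS]ler0_norm; [rewrite ler_norml; lra|lra].
by nra.
Qed.

Lemma sin_period_gt0 L b : 0 < b -> b <= L -> 0 < sin (pi / L * (b / 2)).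
Proof.
move=> b0 bL; have L0 : 0 < L by lra.
have pi0 := @pi_gt0 R; apply: sin_gt0_pi.
have wL : pi / L * L = pi by rewrite divfK// gt_eqF.
have w0 : 0 < pi / L by rewrite divr_gt0.
by rewrite mulr_gt0//=; [nra|lra].
Qed.

End cos_gap.

Definition box (R : realType) k (T : Type) (X : 'I_k -> T -> R) (t : R) :=
  [set x | forall j, `|X j x| <= t].

Lemma measurable_box (R : realType) d (T : measurableType d) k
    (X : 'I_k -> T -> R) t :
  (forall j, measurable_fun setT (X j)) -> measurable (box X t).
Proof.
by move=> mX; apply: measurable_forall_ord => j; exact: measurable_norm_le.
Qed.

(* The indicator of the box [-t, t]^k is compared with a product of polynomials
   in [cos (w z_j)]; [z |-> cos (w z)] has period [2 L], whence the last term. *)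
Theorem box_comparison (R : realType) k (t0 b e L : R) : 0 < b -> 0 < e ->
  t0 + b <= L -> exists M eta, [/\ 0 <= M, 0 < eta &
    forall d1 (T1 : measurableType d1) (P1 : probability T1 R) (X : 'I_k -> T1 -> R)
           d2 (T2 : measurableType d2) (P2 : probability T2 R) (Z : 'I_k -> T2 -> R),
      (forall j, measurable_fun setT (X j)) -> (forall j, measurable_fun setT (Z j)) ->
      cf_close M eta P1 X P2 Z -> forall t : R, 0 <= t <= t0 ->
      pr P1 (box X t) <= pr P2 (box Z (t + b)) + e + (1 - pr P2 (box Z L))].
Proof.
move=> b0 e0 tbL.
(* If [L <= 0] or [t0 < 0], no [t] is admissible; if [e >= 1], the claim is trivial. *)
have [L0|L0] := leP L 0.
  exists 0, 1; split => // *; lra.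
have [t00|t00] := ltP t0 0.
  exists 0, 1; split => // *; lra.
have [e1|e1] := leP 1 e.
  exists 0, 1; split => // d1 T1 P1 X d2 T2 P2 Z mX mZ _ t _.
  have := pr_le1 P1 (measurable_box t mX).
  have := pr_le1 P2 (measurable_box L mZ).
  by have := pr_ge0 P2 (box Z (t + b)); lra.
pose w := pi / L.
have s0 : 0 < sin (w * (b / 2)) by apply: sin_period_gt0; lra.
(* By [cos_gap] the function [xi] below drops by at least [2 * gam] from [t] to [t + b], so the
   midpoint [y] of the two values is at distance at least [gam] from each. *)
pose gam := sin (w * (b / 2)) ^+ 2 / 2.
have gam0 : 0 < gam by rewrite divr_gt0// exprn_gt0.
(* [(N * gam ^+ 2)^-1] is the Chebyshev error of one smoothed step. It is paid [k] times in the
   lower bound for the box of [X] and once in the upper bound for that of [Z], in total at most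
   [e / 2]; the other half goes to the characteristic functions. *)
have [N N0 Ne] : exists2 N, (0 < N)%N &
    (N%:R * gam ^+ 2)^-1 * (k%:R + 1) <= e / 2 :> R.
  pose r : R := (k%:R + 1) / (gam ^+ 2 * (e / 2)).
  exists (Num.truncn r).+1 => //; set N := _.+1.
  have rN : r < N%:R by exact: Num.Theory.truncnS_gt.
  have N0 : 0 < N%:R :> R by rewrite ltr0n.
  rewrite mulrC ler_pdivrMr; last by rewrite mulr_gt0// exprn_gt0.
  have g0 : 0 < gam ^+ 2 * (e / 2) by rewrite mulr_gt0 ?exprn_gt0//; lra.
  move: rN; rewrite ltr_pdivrMr// => /ltW.
  by rewrite (_ : e / 2 * (_ * _) = N%:R * (gam ^+ 2 * (e / 2)))//; ring.
pose del : R := (N%:R * gam ^+ 2)^-1.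
have del0 : 0 <= del by rewrite invr_ge0 mulr_ge0// sqr_ge0.
have k0 : 0 <= k%:R :> R by [].
(* [xi] and [1 - xi] have frequency [w] and coefficient bound 1, so each of the [N] binomial steps
   doubles the bound and adds [w] to the frequency; the product over [k] coordinates raises the
   bound to the power [k] and multiplies the frequency by [k]. *)
pose C : R := (2 ^+ N) ^+ k.
have C0 : 0 < C by rewrite !exprn_gt0.
pose M : R := w *+ N *+ k.
have w0 : 0 < w by rewrite divr_gt0// pi_gt0.
exists M, (e / (2 * C)); split => [||].
- by rewrite !mulrn_wge0// ltW.
- by rewrite divr_gt0// mulr_gt0.
move=> d1 T1 P1 X d2 T2 P2 Z mX mZ XZ t /andP[tge0 tle].
pose xi (z : R) := 2^-1 + 2^-1 * cos (w * z).
have xi01 z : 0 <= xi z <= 1.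
  by have := cos_geN1 (w * z); have := cos_le1 (w * z); rewrite /xi; lra.
pose y := (xi t + xi (t + b)) / 2.
have gap : gam *+ 2 <= xi t - xi (t + b).
  have := @cos_gap _ L t b b0 tge0; rewrite -/w => /(_ (ltac:(lra))).
  by rewrite /gam /xi -mulr_natr; lra.
have xi_norm (z z' : R) : `|z| <= `|z'| -> `|z'| <= L -> xi z' <= xi z.
  move=> zz zL; rewrite lerD2l ler_wpM2l//; apply: ler_cos_norm.
    by rewrite !normrM ler_wpM2l.
  rewrite normrM (gtr0_norm w0).
  by rewrite (_ : pi = w * L) ?ler_wpM2l ?(ltW w0)// /w divfK// gt_eqF.
pose h (z : 'I_k -> R) := \prod_j smooth_step N y (xi (z j)).
have q01 (z : R) : 0 <= smooth_step N y (xi z) <= 1.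
  by rewrite smooth_step_ge0// smooth_step_le1.
have h01 z : 0 <= h z <= 1.
  apply/andP; split; first by apply: prodr_ge0 => j _; case/andP: (q01 (z j)).
  exact: prodr_ile1.
have hP : trig_poly M C h.
  suff : forall j, trig_poly (w *+ N) (2 ^+ N)
      (fun z : 'I_k -> R => smooth_step N y (xi (z j))).
    move=> /(@trig_poly_prod _ _ _ (index_enum 'I_k)).
    rewrite (_ : size _ = k); first by apply; rewrite mulrn_wge0// ltW.
    by rewrite -[RHS](card_ord k) cardE enumT.
  move=> j; rewrite /smooth_step.
  have cosP : trig_poly w 1 (fun z : 'I_k -> R => cos (w * z j)).
    apply: (@trig_poly_eq _ _ _ _ (fun z =>
      cos (\sum_i (if i == j then w else 0) * z i + 0))).
      move=> z; rewrite addr0 (bigD1 j)//= eqxx big1 ?addr0// => i /negPf ->.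
      by rewrite mul0r.
    apply: trig_poly_cos => // i.
    by case: ifP => _; rewrite ?normr0 ?gtr0_norm// ltW.
  have halfP (a : R) : `|a| = 2^-1 ->
      trig_poly w 1 (fun z : 'I_k -> R => 2^-1 + a * cos (w * z j)).
    move=> a2; apply: (@trig_poly_add _ _ _ 2^-1 2^-1); last by lra.
      by apply: trig_poly_cst; [exact: ltW|rewrite ger0_norm].
    by apply: (trig_poly_scale cosP); rewrite a2 mulr1.
  have xiP : trig_poly w 1 (fun z : 'I_k -> R => xi (z j)).
    by apply: halfP; rewrite ger0_norm.
  have xiP' : trig_poly w 1 (fun z : 'I_k -> R => 1 - xi (z j)).
    apply: trig_poly_eq (halfP (- 2^-1) _); last by rewrite normrN ger0_norm.
    by move=> z; rewrite /xi; field.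
  suff : forall f : nat -> R, (forall i, `|f i| <= 1) -> trig_poly (w *+ N) (2 ^+ N)
      (fun z : 'I_k -> R => binomial_mean N f (xi (z j))).
    by apply => i; case: (N%:R * y <= i%:R); rewrite ?normr1 ?normr0.
  elim: (N) => [|n ih] f f1 /=; first by apply: trig_poly_cst.
  rewrite mulrS.
  have p1 := trig_poly_mul xiP (ih (fun i => f i.+1) (fun i => f1 i.+1)).
  have p2 := trig_poly_mul xiP' (ih f f1).
  by apply: (trig_poly_add p1 p2); rewrite exprS; lra.
have mh1 : P1.-integrable setT (EFin \o (fun x => h (X ^~ x))).
  exact: trig_poly_mean hP.
have mh2 : P2.-integrable setT (EFin \o (fun x => h (Z ^~ x))).
  exact: trig_poly_mean hP.
have eta0 : 0 <= e / (2 * C) by rewrite divr_ge0 ?mulr_ge0// ltW.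
have clos := cf_close_trig_poly mX mZ eta0 XZ hP.
have {clos}hh : `|\int[P1]_x h (X ^~ x) - \int[P2]_x h (Z ^~ x)| <= e / 2.
  by apply: le_trans clos _; rewrite le_eqVlt; apply/orP; left; apply/eqP; field;
     rewrite gt_eqF.
have del1 : del <= 1.
  rewrite -/del in Ne; have : 0 <= del * k%:R by rewrite mulr_ge0.
  by lra.
have intI d (T : measurableType d) (P : probability T R) (A : set T) :
    measurable A -> P.-integrable setT (EFin \o \1_A).
  by move=> mA; apply: integrable_indic.
have mbX := measurable_box t mX; have mbZ := measurable_box (t + b) mZ.
have mbL := measurableC (measurable_box L mZ).
(* On the box every factor of [h] is at least [1 - del], hence [h >= 1 - k * del] by Bernoulli's
   inequality. *)
have lo : (1 - k%:R * del) * pr P1 (box X t) <= \int[P1]_x h (X ^~ x).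
  rewrite -Rintegral_indic// -RintegralZl//; last exact: intI.
  apply: le_Rintegral => //.
    exact: (integrableZl measurableT _ (intI _ _ P1 _ mbX)).
  move=> x _; rewrite indicE; case: (boolP (x \in _)) => [|_]; last first.
    by rewrite mulr0; case/andP: (h01 (X ^~ x)).
  rewrite inE mulr1 => bx; apply: bernoulli_prod; first by rewrite del0 del1.
  move=> j; apply: smooth_step_hi => //.
  have := xi_norm (X j x) t; rewrite (ger0_norm tge0) => /(_ (bx j)).
  by rewrite /y; move: gap; rewrite -mulr_natr => gap /(_ (ltac:(lra))); lra.
(* Three cases: in the enlarged box [h <= 1]; outside it but within [L], one factor is at most
   [del]; beyond [L] periodicity spoils the estimate and only [h <= 1] is left. *)
have hi : \int[P2]_x h (Z ^~ x) <=
    pr P2 (box Z (t + b)) + del + pr P2 (~` box Z L).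
  rewrite -!Rintegral_indic// -[del](Rintegral_cst_probability P2).
  rewrite -RintegralD//; [|exact: intI|exact: finite_measure_integrable_cst].
  have int2 : P2.-integrable setT (EFin \o (fun x => \1_(box Z (t + b)) x + del)).
    exact: (integrableD measurableT (intI _ _ P2 _ mbZ)
      (finite_measure_integrable_cst P2 del measurableT)).
  rewrite -RintegralD//; last exact: intI.
  apply: le_Rintegral => //.
    exact: (integrableD measurableT int2 (intI _ _ P2 _ mbL)).
  move=> x _; have /andP[hx0 hx1] := h01 (Z ^~ x).
  have i0 (A : set T2) : 0 <= \1_A x :> R by rewrite indicE.
  have [bx|/existsNP[j /negP]] := pselect (box Z (t + b) x).
    rewrite [X in X + _ + _]indicE mem_set//=.
    by have := i0 (~` box Z L); lra.
  rewrite -ltNge => jx.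
  have [bL|nbL] := pselect (box Z L x); last first.
    rewrite [X in _ + X]indicE mem_set//=.
    by have := i0 (box Z (t + b)); lra.
  apply: (@le_trans _ _ del); last first.
    by have := i0 (box Z (t + b)); have := i0 (~` box Z L); lra.
  apply: (@le_trans _ _ (smooth_step N y (xi (Z j x)))).
    rewrite /h (bigD1 j)//= ler_piMr//; first by case/andP: (q01 (Z j x)).
    exact: prodr_ile1.
  apply: smooth_step_lo => //.
  have := xi_norm (t + b) (Z j x); rewrite (ger0_norm (ltac:(lra) : 0 <= t + b)).
  move=> /(_ (ltW jx) (bL j)).
  by rewrite /y; move: gap; rewrite -mulr_natr; lra.
rewrite -(pr_setC P2 (measurable_box L mZ)).
have p1 := pr_le1 P1 mbX; have p0 := pr_ge0 P1 (box X t).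
have : k%:R * del * pr P1 (box X t) <= k%:R * del.
  by rewrite ler_piMr// mulr_ge0.
move: hh; rewrite ler_norml => /andP[_ hh].
by move: Ne; rewrite -/del; lra.
Qed.

(** * Gaussian boxes and their quantiles *)

Section gaussian_box.
Context {R : realType} {k : nat}.
Implicit Types (A B G : 'M[R]_k).
Notation W := (@iid_normal R k).
Notation N := (normal_prob (0 : R) 1).

Definition lin_coord A (j : 'I_k) (w : k.-tuple (measurableTypeR R)) : R :=
  \sum_l A j l * tnth w l.

Lemma measurable_lin_coord A j : measurable_fun setT (lin_coord A j).
Proof.
apply: measurable_sum => l; apply: measurable_funM => //.
exact: measurable_tnth.
Qed.

(** [A] enters only through [A *m A^T], so that different factors of one covariance matrix have
    equal characteristic functions. *)
Lemma lin_coord_cos A (u : 'I_k -> R) c :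
  \int[W]_w cos (\sum_j u j * lin_coord A j w + c) =
  expR (- (\sum_i \sum_j u i * u j * (A *m A^T) i j) / 2) * cos c.
Proof.
transitivity (\int[W]_w cos (\sum_l (\sum_j u j * A j l) * tnth w l + c)).
  apply: eq_Rintegral => w _; congr (cos (_ + c)).
  under [RHS]eq_bigr do rewrite mulr_suml.
  rewrite exchange_big/=; apply: eq_bigr => j _.
  by rewrite mulr_sumr; apply: eq_bigr => l _; rewrite mulrA.
rewrite iid_normal_cos; congr (expR (- _ / 2) * _).
under eq_bigr do rewrite expr2 mulr_suml.
under eq_bigr do (under eq_bigr do rewrite mulr_sumr).
rewrite exchange_big/=; apply: eq_bigr => i _.
rewrite exchange_big/=; apply: eq_bigr => j _.
rewrite mxE mulr_sumr; apply: eq_bigr => l _; rewrite mxE; ring.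
Qed.

Lemma expR_half_lip (a b : R) : 0 <= a -> 0 <= b ->
  `|expR (- a / 2) - expR (- b / 2)| <= `|a - b|.
Proof.
wlog ab : a b / a <= b.
  move=> h a0 b0; have [/h|/ltW/h] := leP a b; first exact.
  by rewrite distrC (distrC a); apply.
move=> a0 b0; rewrite ger0_norm ?subr_ge0 ?ler_expR; last by lra.
rewrite ler0_norm ?subr_le0// opprB.
have -> : - b / 2 = - a / 2 + - ((b - a) / 2) by lra.
rewrite expRD; have h1 := expR_ge1Dx (- ((b - a) / 2)).
have h2 : expR (- a / 2) <= 1 by rewrite -[leRHS]expR0 ler_expR; lra.
have h3 := expR_ge0 (- a / 2).
have h4 : expR (- ((b - a) / 2)) <= 1 by rewrite -[leRHS]expR0 ler_expR; lra.
nra.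
Qed.

Lemma mulmx_tr_quad_ge0 A (u : 'I_k -> R) :
  0 <= \sum_i \sum_j u i * u j * (A *m A^T) i j.
Proof.
rewrite (_ : \sum_i _ = \sum_l (\sum_j u j * A j l) ^+ 2).
  by apply: sumr_ge0 => l _; exact: sqr_ge0.
under [RHS]eq_bigr do rewrite expr2 mulr_suml.
under [RHS]eq_bigr do (under eq_bigr do rewrite mulr_sumr).
rewrite [RHS]exchange_big/=; apply: eq_bigr => i _.
rewrite [RHS]exchange_big/=; apply: eq_bigr => j _.
rewrite mxE mulr_sumr; apply: eq_bigr => l _; rewrite mxE; ring.
Qed.

Lemma quad_close G G' (u : 'I_k -> R) (M e : R) : (forall j, `|u j| <= M) ->
  (forall i j, `|G i j - G' i j| <= e) ->
  `|\sum_i \sum_j u i * u j * G i j - \sum_i \sum_j u i * u j * G' i j| <=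
  (k ^ 2)%:R * (M ^+ 2 * e).
Proof.
move=> uM Ge; rewrite -sumrB.
apply: le_trans (ler_norm_sum _ _ _) _.
apply: (@le_trans _ _ (\sum_(i < k) \sum_(j < k) M ^+ 2 * e)); last first.
  by rewrite !sumr_const card_ord -mulrnA mulr_natl.
apply: ler_sum => i _; rewrite -sumrB; apply: le_trans (ler_norm_sum _ _ _) _.
apply: ler_sum => j _; rewrite -mulrBr !normrM.
by rewrite expr2 ler_pM// ?mulr_ge0// ler_pM.
Qed.

Lemma lin_coord_close A B (M e : R) :
  (forall i j, `|(A *m A^T) i j - (B *m B^T) i j| <= e) ->
  cf_close M ((k ^ 2)%:R * (M ^+ 2 * e)) W (lin_coord A) W (lin_coord B).
Proof.
move=> ABe u c uM; rewrite !lin_coord_cos -mulrBl normrM.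
rewrite -[leRHS]mulr1 ler_pM//; last by rewrite ler_norml cos_geN1 cos_le1.
apply: le_trans (quad_close uM ABe).
by apply: expR_half_lip; exact: mulmx_tr_quad_ge0.
Qed.

Lemma diag_mulmx_tr A j : (A *m A^T) j j = \sum_l A j l ^+ 2.
Proof. by rewrite mxE; apply: eq_bigr => l _; rewrite mxE. Qed.

Lemma lin_coord_diag0 A j w : (A *m A^T) j j = 0 -> lin_coord A j w = 0.
Proof.
rewrite diag_mulmx_tr => /eqP; rewrite psumr_eq0; last by move=> l _; exact: sqr_ge0.
move=> /allP A0; apply: big1 => l _.
have := A0 l (mem_index_enum _); rewrite /= sqrf_eq0 => /eqP ->.
by rewrite mul0r.
Qed.

Lemma box1E (T : Type) (X : T -> R) t :
  box (fun _ : 'I_1 => X) t = [set x | `|X x| <= t].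
Proof.
by apply/seteqP; split=> x /=; [apply; exact: ord0|move=> ? _].
Qed.

Let cf_close_marg A j M : (A *m A^T) j j = 1 ->
  cf_close M 0 W (fun _ : 'I_1 => lin_coord A j) N (fun _ : 'I_1 => id) /\
  cf_close M 0 N (fun _ : 'I_1 => id) W (fun _ : 'I_1 => lin_coord A j).
Proof.
move=> A1.
suff h (u : 'I_1 -> R) c : \int[W]_x cos (\sum_(i < 1) u i * lin_coord A j x + c) =
    \int[N]_x cos (\sum_(i < 1) u i * x + c).
  by split=> u c _; rewrite h subrr normr0.
transitivity (\int[W]_x cos (\sum_i (if i == j then u ord0 else 0) * lin_coord A i x + c)).
  apply: eq_Rintegral => x _; congr (cos (_ + c)).
  rewrite big_ord1 (bigD1 j)//= eqxx big1 ?addr0// => i /negPf ->.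
  by rewrite mul0r.
transitivity (\int[N]_x cos (u ord0 * x + c)); last first.
  by apply: eq_Rintegral => x _; rewrite big_ord1.
rewrite lin_coord_cos normal_cos mulrC; congr (_ * expR (- _ / 2)).
rewrite (bigD1 j)//= [X in _ + X]big1 ?addr0; last first.
  by move=> i /negPf ->; apply: big1 => l _; rewrite !mul0r.
rewrite eqxx (bigD1 j)//= eqxx [X in _ + X]big1 ?addr0; last first.
  by move=> i /negPf ->; rewrite mulr0 mul0r.
by rewrite A1 mulr1.
Qed.

Let mid : measurable_fun setT (fun x : measurableTypeR R => x).
Proof. exact: measurable_id. Qed.

Let mnorm t : measurable [set x : measurableTypeR R | `|x| <= t].
Proof. exact: measurable_norm_le. Qed.

Let mlin A j t : measurable [set w | `|lin_coord A j w| <= t].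
Proof. by apply: measurable_norm_le; exact: measurable_lin_coord. Qed.

(* With equal characteristic functions, [box_comparison] in dimension one
   identifies the two laws of absolute values. *)
Lemma lin_coord_le_normal A j t : (A *m A^T) j j = 1 -> 0 <= t ->
  pr W [set w | `|lin_coord A j w| <= t] <= pr N [set x | `|x| <= t].
Proof.
move=> A1 t0; apply/ler_addgt0Pr => e e0.
(* Enlarging the interval costs [2 * b], the comparison [b] and the tail beyond [L] another [b]:
   together [e]. *)
pose b := e / 4; have b0 : 0 < b by rewrite /b; lra.
have [L L0 Le] := pr_tail N mid b0.
pose L' := Num.max L (t + b).
have tb : t + b <= L' by rewrite le_max lexx orbT.
have [M [eta [_ eta0 H]]] := @box_comparison R 1 t b b L' b0 b0 tb.
have [close _] := cf_close_marg M A1.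
have close' : cf_close M eta W (fun _ : 'I_1 => lin_coord A j) N (fun _ : 'I_1 => id).
  by move=> u c uM; apply: le_trans (close u c uM) (ltW eta0).
have := H _ _ W _ _ _ N _ (fun=> measurable_lin_coord A j) (fun=> mid) close' t.
rewrite t0 lexx !box1E => /(_ isT) h.
have h1 := pr_normal_norm_cts t0 (ltW b0).
have h2 : pr N [set x | `|x| <= L] <= pr N [set x | `|x| <= L'].
  apply: pr_mono => // x /= /le_trans; apply.
  by rewrite le_max lexx.
by move: h h1 h2 Le; rewrite /b; lra.
Qed.

Lemma normal_le_lin_coord A j t : (A *m A^T) j j = 1 -> 0 <= t ->
  pr N [set x | `|x| <= t] <= pr W [set w | `|lin_coord A j w| <= t].
Proof.
move=> A1; rewrite le_eqVlt => /predU1P[<-|t0].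
  apply: le_trans (pr_ge0 _ _).
  rewrite (_ : [set _ | _] = `[0, 0]%classic).
    by apply: le_trans (pr_normal_itv_le (lexx 0)) _; rewrite subrr.
  apply/seteqP; split=> x /=; rewrite in_itv/= normr_le0.
    by move=> /eqP ->; rewrite lexx.
  by rewrite -eq_le eq_sym.
apply/ler_addgt0Pr => e e0.
(* The comparison starts from the radius [t - b], which must be nonnegative; this is why [t = 0] was
   settled apart. *)
pose b := Num.min (e / 4) t; have b0 : 0 < b by rewrite lt_min t0 andbT; lra.
have be : b <= e / 4 by rewrite ge_min lexx.
have bt : b <= t by rewrite ge_min lexx orbT.
have [L L0 Le] := pr_tail W (measurable_lin_coord A j) b0.
pose L' := Num.max L t.
have tb : t - b + b <= L' by rewrite subrK le_max lexx orbT.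
have [M [eta [_ eta0 H]]] := @box_comparison R 1 (t - b) b b L' b0 b0 tb.
have [_ close] := cf_close_marg M A1.
have close' : cf_close M eta N (fun _ : 'I_1 => id) W (fun _ : 'I_1 => lin_coord A j).
  by move=> u c uM; apply: le_trans (close u c uM) (ltW eta0).
have := H _ _ N _ _ _ W _ (fun=> mid) (fun=> measurable_lin_coord A j) close' (t - b).
rewrite subr_ge0 bt lexx !box1E subrK => /(_ isT) h.
have := @pr_normal_norm_cts _ (t - b) b; rewrite subr_ge0 subrK => h1.
have {}h1 := h1 bt (ltW b0).
have h2 : pr W [set w | `|lin_coord A j w| <= L] <=
    pr W [set w | `|lin_coord A j w| <= L'].
  apply: pr_mono => // x /= /le_trans; apply.
  by rewrite le_max lexx.
by move: h h1 h2 Le be; lra.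
Qed.

Definition box_prob A t := pr W (box (lin_coord A) t).

Lemma measurable_lin_box A t : measurable (box (lin_coord A) t).
Proof. by apply: measurable_box => j; exact: measurable_lin_coord. Qed.

(** A condition on the covariance [A *m A^T], met by the correlation matrix of a positive
    semidefinite matrix with some positive diagonal entry. The value 0 is allowed because of S_n;
    one entry equal to 1 excludes the degenerate law at 0. *)
Definition unit_diag A := (forall j, (A *m A^T) j j = 0 \/ (A *m A^T) j j = 1) /\
  exists j, (A *m A^T) j j = 1.

Lemma box_prob_mono A (s t : R) : s <= t -> box_prob A s <= box_prob A t.
Proof.
move=> st; apply: pr_mono; [exact: measurable_lin_box..|].
by move=> w ws j; apply: le_trans (ws j) st.
Qed.

(** Anticoncentration by a union bound: to leave the smaller box, some coordinate must have absolute
    value in ]t, t + e]. A standard normal coordinate does so with probability at most [2 * e], a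
    zero coordinate never since [t >= 0]. Dependence between coordinates is irrelevant, so singular
    covariances are covered. *)
Lemma box_prob_cts A (t e : R) : unit_diag A -> 0 <= t -> 0 <= e ->
  box_prob A (t + e) <= box_prob A t + 2 * k%:R * e.
Proof.
move=> [A01 _] t0 e0.
pose F j := [set w | t < `|lin_coord A j w| <= t + e].
have FE j : [set w | `|lin_coord A j w| <= t + e] `\`
    [set w | `|lin_coord A j w| <= t] = F j.
  rewrite /F; apply/seteqP; split=> w /=.
    by move=> [-> /negP]; rewrite -ltNge => ->.
  by move=> /andP[h1 ->]; split=> //; apply/negP; rewrite -ltNge.
have mF j : measurable (F j) by rewrite -FE; exact: measurableD.
have Fe j : pr W (F j) <= 2 * e.
  have [A0|A1] := A01 j.
    rewrite (_ : F j = set0); first by rewrite /pr measure0/= mulr_ge0.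
    apply/seteqP; split=> // w; rewrite /F/= lin_coord_diag0// normr0.
    by move=> /andP[]; lra.
  have h1 := lin_coord_le_normal A1 (addr_ge0 t0 e0).
  have h2 := normal_le_lin_coord A1 t0.
  have h3 := pr_normal_norm_cts t0 e0.
  suff : pr W (F j) <= pr W [set w | `|lin_coord A j w| <= t + e] -
      pr W [set w | `|lin_coord A j w| <= t] by lra.
  rewrite -FE -lee_fin -pr_EFin; last exact: measurableD.
  rewrite measureD//; last by rewrite ltey_eq fin_num_measure.
  rewrite EFinB -!pr_EFin// setIidr// => w /= /le_trans; apply.
  by rewrite lerDl.
have : pr W (box (lin_coord A) (t + e)) <=
    pr W (box (lin_coord A) t) + pr W [set w | exists j, F j w].
  apply: pr_union; [exact: measurable_lin_box..| |].
    rewrite (_ : [set _ | _] = \bigcup_(j in [set: 'I_k]) F j).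
      by apply: fin_bigcup_measurable.
    by apply/seteqP; split=> w [j]; exists j.
  move=> w wte; have [wt|/existsNP[j /negP]] := pselect (box (lin_coord A) t w).
    by left.
  by rewrite -ltNge => tj; right; exists j; rewrite /F/= tj wte.
move=> /le_trans; apply; rewrite lerD2l.
apply: le_trans (pr_bigcup W mF) _.
apply: le_trans (ler_sum _ (fun j _ => Fe j)) _.
by rewrite sumr_const card_ord -mulr_natr; nra.
Qed.

Lemma box_prob_le A (t : R) : unit_diag A -> 0 <= t -> box_prob A t <= 2 * t.
Proof.
move=> [_ [j Aj]] t0.
apply: (@le_trans _ _ (pr W [set w | `|lin_coord A j w| <= t])).
  by apply: pr_mono; [exact: measurable_lin_box|exact: mlin|move=> w; exact].
apply: le_trans (lin_coord_le_normal Aj t0) _.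
rewrite (_ : [set _ | _] = `[- t, t]%classic).
  by apply: le_trans (pr_normal_itv_le _) _; lra.
by apply/seteqP; split=> x /=; rewrite in_itv/= ler_norml.
Qed.

Lemma box_prob_ge A (t : R) : unit_diag A -> 0 <= t ->
  1 - k%:R * (1 - pr N [set x | `|x| <= t]) <= box_prob A t.
Proof.
move=> [A01 _] t0.
have -> : box_prob A t = 1 - pr W [set w | exists j, ~ (`|lin_coord A j w| <= t)].
  rewrite -pr_setC; first by congr (pr _ _); apply/seteqP; split=> w /=;
    [move=> wt [j]; apply; exact: wt|move=> wt j; apply: contrapT => wj; apply: wt; exists j].
  rewrite (_ : [set _ | _] = ~` box (lin_coord A) t).
    by apply: measurableC; exact: measurable_lin_box.
  by apply/seteqP; split=> w /=; [move=> [j wj] /(_ j)|move=> /existsNP[j wj]; exists j].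
rewrite lerD2l lerN2; set F := fun j => [set w | ~ (`|lin_coord A j w| <= t)].
have mF j : measurable (F j) by apply: measurableC; exact: mlin.
apply: le_trans (pr_bigcup W mF) _.
rewrite (_ : k%:R * _ = \sum_(j < k) (1 - pr N [set x | `|x| <= t])); last first.
  by rewrite sumr_const card_ord mulr_natl.
apply: ler_sum => j _; rewrite /F pr_setC//; last exact: mlin.
have [A0|A1] := A01 j; last first.
  by rewrite lerD2l lerN2; exact: normal_le_lin_coord.
rewrite [X in 1 - pr W X](_ : _ = setT).
  by rewrite pr_setT; have := pr_le1 N (mnorm t); lra.
by rewrite -subTset => w _ /=; rewrite lin_coord_diag0// normr0.
Qed.

End gaussian_box.

Section quantile.
Context {R : realType} {k : nat}.
Implicit Types (A B G : 'M[R]_k).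
Notation W := (@iid_normal R k).
Notation N := (normal_prob (0 : R) 1).

Lemma unit_diag_entry A i j : unit_diag A -> `|(A *m A^T) i j| <= 1.
Proof.
move=> [A01 _].
have d1 l : (A *m A^T) l l <= 1 by case: (A01 l) => ->.
have := d1 i; have := d1 j; rewrite !diag_mulmx_tr => dj di.
have E (s : R) : s ^+ 2 = 1 -> 0 <= \sum_l A i l ^+ 2 + (2 * s) * (A *m A^T) i j +
    \sum_l A j l ^+ 2.
  move=> s1; rewrite mxE mulr_sumr -!big_split/=.
  apply: sumr_ge0 => l _; rewrite mxE.
  have -> : A i l ^+ 2 + 2 * s * (A i l * A j l) + A j l ^+ 2 = (s * A i l + A j l) ^+ 2.
    by rewrite [RHS]sqrrD exprMn s1; ring.
  exact: sqr_ge0.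
have h1 := E 1 (expr1n _ _); have := E (-1); rewrite sqrrN expr1n => /(_ erefl) h2.
by rewrite ler_norml; move: h1 h2; lra.
Qed.

Lemma unit_diag_factor_entry A i l : unit_diag A -> `|A i l| <= 1.
Proof.
move=> uA; have := unit_diag_entry i i uA.
rewrite diag_mulmx_tr ger0_norm; last by apply: sumr_ge0 => m _; exact: sqr_ge0.
rewrite (bigD1 l)//= => h.
have h0 : 0 <= \sum_(m | m != l) A i m ^+ 2 by apply: sumr_ge0 => m _; exact: sqr_ge0.
rewrite -(@expr_le1 _ 2)// -normrX ger0_norm ?sqr_ge0//; lra.
Qed.

(* The point [(t + e / 2) *: row j A] with [(A A^T) j j = 1] is mapped by [A] to
   sup norm [t + e / 2]; a cube around it has probability bounded below. *)
Lemma box_prob_incr (t0 e : R) : 0 < e -> exists2 c, 0 < c &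
  forall A, unit_diag A -> forall t : R, 0 <= t <= t0 ->
  box_prob A t + c <= box_prob A (t + e).
Proof.
move=> e0; have [t00|t00] := ltP t0 0.
  by exists 1 => // A _ t /andP[t1 t2]; exfalso; lra.
(* Entries of [A] being at most 1, a move of size [r] in each of [k] variables changes a coordinate
   of the image by at most [k * r <= e / 4]. With [k.+1] the quotient is meaningful for [k = 0]. *)
pose r : R := e / (4 * k.+1%:R).
have k10 : 0 < k.+1%:R :> R by rewrite ltr0n.
have r0 : 0 < r by rewrite divr_gt0// mulr_gt0.
have kr : k%:R * r <= e / 4.
  have -> : e / 4 = k.+1%:R * r by rewrite /r; field; rewrite gt_eqF.
  by rewrite ler_wpM2r ?(ltW r0)// ler_nat.
have re : r <= e / 4.
  have -> : e / 4 = k.+1%:R * r by rewrite /r; field; rewrite gt_eqF.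
  by rewrite ler_peMl ?(ltW r0)// ler1n.
(* The cube of half-side [r] stays within [-S, S] in each variable, where the density is at least
   its value at [S]. *)
pose S := t0 + 2 * e.
have pdf0 : 0 < normal_pdf (0 : R) 1 S.
  by rewrite normal_pdf01E mulr_gt0 ?expR_gt0// normal_peak_gt0.
exists ((2 * r * normal_pdf (0 : R) 1 S) ^+ k).
  by rewrite exprn_gt0// !mulr_gt0.
move=> A uA t /andP[t1 t2]; have [_ [j1 Aj1]] := uA.
pose v l := (t + e / 2) * A j1 l.
pose D l : set R := `[v l - r, v l + r]%classic.
have mD l : measurable (D l : set (measurableTypeR R)) by exact: measurable_itv.
pose Q := [set w : k.-tuple (measurableTypeR R) | forall l, D l (tnth w l)].
have mQ : measurable Q.
  apply: measurable_forall_ord => l; rewrite -[X in measurable X]setTI.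
  by apply: measurable_tnth.
have QE : pr W Q = \prod_l pr N (D l).
  apply: EFin_inj; rewrite -pr_EFin// /Q iid_normal_product// -prodEFin.
  by apply: eq_bigr => l _; rewrite -pr_EFin.
have vS l : `|v l| <= t + e / 2.
  rewrite /v normrM ger0_norm; last by lra.
  by rewrite ler_piMr ?unit_diag_factor_entry//; lra.
have cQ : (2 * r * normal_pdf (0 : R) 1 S) ^+ k <= pr W Q.
  rewrite QE -[in leLHS](card_ord k) -prodr_const; apply: ler_prod => l _.
  rewrite !mulr_ge0//=; [|exact: ltW|exact: ltW].
  have := vS l; rewrite ler_norml => /andP[v1 v2].
  have := @pr_normal_itv_ge R (v l - r) (v l + r) S.
  rewrite (_ : v l + r - (v l - r) = 2 * r); last by ring.
  by apply; rewrite /S; lra.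
have Qe w j : Q w -> `|lin_coord A j w - (t + e / 2) * (A *m A^T) j j1| <= e / 4.
  move=> Qw; rewrite mxE mulr_sumr -sumrB.
  apply: le_trans (ler_norm_sum _ _ _) _; apply: le_trans kr.
  rewrite (_ : k%:R * r = \sum_(l < k) r); last first.
    by rewrite sumr_const card_ord mulr_natl.
  apply: ler_sum => l _; rewrite mxE.
  rewrite (_ : _ - _ = A j l * (tnth w l - v l)); last by rewrite /v; ring.
  rewrite normrM -[leRHS]mul1r ler_pM ?unit_diag_factor_entry//.
  by have := Qw l; rewrite /D/= in_itv/= ler_distl.
(* On the cube, coordinate [j1] is at least [t + e / 4], so the small box is missed; all coordinates
   are at most [t + 3 * e / 4] in absolute value, so the large box is not left. *)
have Qd : box (lin_coord A) t `&` Q = set0.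
  apply/seteqP; split=> // w [wt Qw]; have := Qe w j1 Qw; have := wt j1.
  by rewrite Aj1 mulr1 ler_norml ler_distl => /andP[_ ?] /andP[? _]; lra.
have mB := measurable_lin_box A t.
suff : pr W (box (lin_coord A) t `|` Q) <= box_prob A (t + e).
  apply: le_trans; rewrite (_ : pr W (_ `|` _) = box_prob A t + pr W Q) ?lerD2l//.
  apply: EFin_inj; rewrite -pr_EFin; last exact: measurableU.
  by rewrite EFinD /box_prob -!pr_EFin// measureU.
apply: pr_mono; [exact: measurableU|exact: measurable_lin_box|].
move=> w [wt|Qw] j; first by apply: le_trans (wt j) _; rewrite lerDl ltW.
have := Qe w j Qw; have := unit_diag_entry j j1 uA.
rewrite ler_distl !ler_norml => /andP[h1 h2] /andP[h3 h4].
by nra.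
Qed.

Lemma cov_factorK A : cov_factor (A *m A^T) *m (cov_factor (A *m A^T))^T = A *m A^T.
Proof. by rewrite /cov_factor; apply: (@xgetPex _ 0 [set B | B *m B^T = A *m A^T]); exists A. Qed.

Lemma mvnormal_box G (t : R) : 0 <= t ->
  mvnormal G [set z : 'cV[R]_k | `|z| <= t] = (box_prob (cov_factor G) t)%:E.
Proof.
move=> t0; rewrite /box_prob -pr_EFin; last exact: measurable_lin_box.
rewrite -[LHS]/(W (gaussian_vec G @^-1` [set z : 'cV[R]_k | `|z| <= t])).
have normE (z : 'cV[R]_k) : (`|z| <= t) = [forall i, `|z i 0| <= t].
  rewrite -[`|z|]/(mx_norm z) mx_normrE; apply/bigmax_leP/forallP.
    by move=> [_ h] i; exact: (h (i, 0)).
  by move=> h; split=> // -[i j] _; rewrite /= ord1.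
have gE w j : gaussian_vec G w j 0 = lin_coord (cov_factor G) j w.
  by rewrite mxE; under eq_bigr do rewrite mxE.
congr (W _); apply/seteqP; split=> w /=; rewrite normE.
  by move=> /forallP h j; rewrite -gE.
by move=> wt; apply/forallP => j; rewrite gE.
Qed.

(** The lower bound [p / 2] comes from [box_prob_le]: one standard normal coordinate already limits
    the box probability to [2 * t]. The upper bound [T0] comes from a union bound and is the same
    for all [A]. The factor [B] appears because the quantile is defined with [cov_factor], which may
    differ from [A]. *)
Lemma KquantileP (p : R) : 0 < p < 1 -> exists T0 : R, [/\ 0 <= T0 &
  forall A, unit_diag A -> exists B,
  [/\ B *m B^T = A *m A^T, p / 2 <= Kquantile p (A *m A^T) <= T0,
      p <= box_prob B (Kquantile p (A *m A^T)) &
      forall t : R, 0 <= t -> p <= box_prob B t -> Kquantile p (A *m A^T) <= t]].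
Proof.
move=> /andP[p0 p1].
have mid : measurable_fun setT (fun x : measurableTypeR R => x) by exact: measurable_id.
have k10 : 0 < k.+1%:R :> R by rewrite ltr0n.
(* Each of the [k] coordinates may exceed [T0] with this probability, in total at most [1 - p]. *)
have q0 : 0 < (1 - p) / k.+1%:R by rewrite divr_gt0// subr_gt0.
have [T0 T00 hT0] := pr_tail N mid q0.
exists T0; split; first exact: ltW.
move=> A uA; set G := A *m A^T; exists (cov_factor G).
have BG : cov_factor G *m (cov_factor G)^T = G by exact: cov_factorK.
have uB : unit_diag (cov_factor G) by rewrite /unit_diag BG.
set B := cov_factor G in BG uB *.
pose E := [set t : R | 0 <= t /\ p <= box_prob B t].
(* The infimum defining the quantile ranges over all reals; a negative radius gives the empty set,
   of probability 0 < [p]. *)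
have KE : Kquantile p G = inf E.
  congr (inf _); apply/seteqP; split=> t /=; last first.
    by move=> [t0 pt]; rewrite mvnormal_box// lee_fin.
  have [t0|t0] := leP 0 t; first by rewrite mvnormal_box// lee_fin.
  rewrite (_ : [set z | _] = set0) ?measure0 ?lee_fin; first by lra.
  apply/seteqP; split=> // z /=; rewrite leNgt => /negP; apply.
  exact: lt_le_trans t0 (normr_ge0 _).
have ET0 : E T0.
  split; first exact: ltW.
  apply: le_trans (box_prob_ge uB (ltW T00)).
  have : k%:R * (1 - pr N [set x | `|x| <= T0]) <= k%:R * ((1 - p) / k.+1%:R).
    by rewrite ler_wpM2l// lerBlDr -lerBlDl.
  move=> h1; have h2 : k%:R * ((1 - p) / k.+1%:R) <= 1 - p.
    by rewrite mulrCA ler_piMr ?ler_pdivrMr ?mul1r ?ler_nat//; lra.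
  by rewrite lerBrDr -lerBrDl; exact: le_trans h1 h2.
have lbE : lbound E 0 by move=> t [].
have hlE : has_lbound E by exists 0.
have K0 : 0 <= inf E by apply: lb_le_inf => //; exists T0.
have Kle t : 0 <= t -> p <= box_prob B t -> inf E <= t.
  by move=> t0 pt; apply: ge_inf.
(* The infimum is attained, by continuity of the box probability. *)
have pK : p <= box_prob B (inf E).
  apply/ler_addgt0Pr => e e0.
  pose c := e / (2 * k.+1%:R).
  have c0 : 0 < c by rewrite divr_gt0// mulr_gt0.
  have [t [t0 pt] tc] : exists2 t, E t & t < inf E + c.
    by apply: inf_adherent => //; split => //; exists T0.
  have h1 := box_prob_mono B (ltW tc).
  have h2 := box_prob_cts uB K0 (ltW c0).
  have h3 : 2 * k%:R * c <= e.
    rewrite /c mulrA ler_pdivrMr ?mulr_gt0// mulrC ler_wpM2l ?(ltW e0)//.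
    by rewrite ler_wpM2l// ler_nat.
  lra.
rewrite KE; split => //; last by apply/andP; split; [|exact: Kle (ltW T00) (proj2 ET0)];
  have := box_prob_le uB K0; lra.
Qed.

End quantile.

(** * Correlation matrices *)

(** Going from the quantile K to K + e / 2 raises the Gaussian box probability by at least [c],
    uniformly in [A] ([box_prob_incr]). Passing to the other covariance with a further enlargement
    by e / 2 loses at most [c / 3] for the comparison and [c / 3] for the tail. So K + e is large
    enough for the second quantile. *)
Lemma Kquantile_continuous (R : realType) k (p e : R) : 0 < p < 1 -> 0 < e ->
  exists2 tau, 0 < tau & forall A A' : 'M[R]_k, unit_diag A -> unit_diag A' ->
    (forall i j, `|(A *m A^T) i j - (A' *m A'^T) i j| <= tau) ->
    Kquantile p (A' *m A'^T) <= Kquantile p (A *m A^T) + e.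
Proof.
move=> p01 e0; have [T0 [T00 HK]] := @KquantileP R k p p01.
have e20 : 0 < e / 2 by lra.
have [c c0 Hc] := @box_prob_incr R k T0 (e / 2) e20.
have mid : measurable_fun setT (fun x : measurableTypeR R => x) by exact: measurable_id.
have k10 : 0 < k.+1%:R :> R by rewrite ltr0n.
have q0 : 0 < c / 3 / k.+1%:R by rewrite !divr_gt0.
have [L L0 hL] := pr_tail (normal_prob 0 1) mid q0.
pose L' := Num.max L (T0 + e).
have L'0 : 0 <= L' by rewrite le_max (ltW L0).
have tL : T0 + e / 2 + e / 2 <= L'.
  by rewrite le_max; apply/orP; right; lra.
have c30 : 0 < c / 3 by lra.
have [M [eta [M0 eta0 Hcmp]]] := @box_comparison R k (T0 + e / 2) (e / 2) (c / 3) L' e20 c30 tL.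
(* [k ^ 2 * M ^+ 2] is the factor in [lin_coord_close]; adding 1 makes [D] positive. *)
pose D := (k ^ 2)%:R * M ^+ 2 + 1.
have D0 : 0 < D by rewrite /D ltr_wpDl// mulr_ge0// sqr_ge0.
exists (eta / D); first by rewrite divr_gt0.
move=> A A' uA uA' AA'.
have [B [BA /andP[K0 KT] pK _]] := HK A uA.
have [B' [BA' _ _ Kle]] := HK A' uA'.
have uB : unit_diag B by rewrite /unit_diag BA.
have uB' : unit_diag B' by rewrite /unit_diag BA'.
set K := Kquantile p (A *m A^T) in K0 KT pK *.
have p0 : 0 < p by case/andP: p01.
have K0' : 0 <= K by lra.
apply: Kle; first by lra.
have close : cf_close M eta (iid_normal k) (lin_coord B) (iid_normal k) (lin_coord B').
  move=> u v uM.
  have BB' i j : `|(B *m B^T) i j - (B' *m B'^T) i j| <= eta / D.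
    by rewrite BA BA'; exact: AA'.
  apply: le_trans (lin_coord_close BB' _ uM) _.
  rewrite mulrA mulrCA ler_piMr ?(ltW eta0)// ler_pdivrMr// mul1r /D.
  by rewrite lerDl.
have hLL : pr (normal_prob 0 1) [set x : R | `|x| <= L] <=
    pr (normal_prob 0 1) [set x : R | `|x| <= L'].
  apply: pr_mono; [exact: (measurable_norm_le _ mid)..|].
  by move=> x /= /le_trans; apply; rewrite le_max lexx.
have tailB' : 1 - c / 3 <= box_prob B' L'.
  apply: le_trans (box_prob_ge uB' L'0); rewrite lerD2l lerN2.
  apply: (@le_trans _ _ (k%:R * (c / 3 / k.+1%:R))).
    by rewrite ler_wpM2l// lerBlDr -lerBlDl; exact: le_trans hL hLL.
  by rewrite mulrCA ler_piMr ?ler_pdivrMr ?mul1r ?ler_nat// ltW.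
have := Hcmp _ _ (iid_normal k) _ _ _ (iid_normal k) _
  (measurable_lin_coord B) (measurable_lin_coord B') close (K + e / 2).
have -> : 0 <= K + e / 2 <= T0 + e / 2 by apply/andP; split; lra.
have -> : K + e / 2 + e / 2 = K + e by lra.
move=> /(_ isT); rewrite -/(box_prob B _) -2!/(box_prob B' _) => h1.
have h2 := Hc B uB K; rewrite K0' KT in h2.
have {}h2 := h2 isT.
by move: h1 h2 tailB' pK; lra.
Qed.

(** * Factorization, pseudoinverse and square root of matrices *)

Section matrices.
Context {R : realType}.

(** Cholesky factorization, singular matrices included: if the pivot [s] is 0, nonnegativity of the
    quadratic form forces the rest of its row to vanish; otherwise the Schur complement is again
    positive semidefinite. *)
Let psd_factor_step n (G : 'M[R]_(1 + n)) :
  (forall D : 'M[R]_n, psd D -> exists A : 'M[R]_n, A *m A^T = D) ->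
  psd G -> exists A : 'M[R]_(1 + n), A *m A^T = G.
Proof.
move=> ih [Gs Gp].
pose a := ulsubmx G; pose b := ursubmx G; pose D := drsubmx G.
have GE : G = block_mx a b b^T D.
  by rewrite -[G in LHS]submxK; congr block_mx; rewrite /b trmx_ursub Gs.
have Ds : D^T = D by rewrite /D trmx_drsub Gs.
have a1 : a = (a 0 0)%:M by rewrite [LHS]mx11_scalar.
pose s := a 0 0.
have quad (x : R) (v : 'cV_n) :
    0 <= x ^+ 2 * s + 2 * x * (b *m v) 0 0 + (v^T *m D *m v) 0 0.
  have := Gp (col_mx x%:M v); rewrite GE tr_col_mx tr_scalar_mx.
  have addE (A B : 'M[R]_1) : (A + B) 0 0 = A 0 0 + B 0 0 by rewrite mxE.
  rewrite mul_row_block mul_row_col !mulmxDl !addE.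
  set q := (v^T *m D *m v) 0 0.
  have -> : (x%:M *m a *m x%:M) 0 0 = x ^+ 2 * s.
    by rewrite a1 -!scalar_mxM mxE/= mulr1n /s; ring.
  have -> : (v^T *m b^T *m x%:M) 0 0 = x * (b *m v) 0 0.
    by rewrite -trmx_mul mul_mx_scalar !mxE.
  have -> : (x%:M *m b *m v) 0 0 = x * (b *m v) 0 0.
    by rewrite mul_scalar_mx -scalemxAl mxE.
  by move/le_trans; apply; rewrite le_eqVlt; apply/orP; left; apply/eqP; ring.
have s0 : 0 <= s by have := quad 1 0; rewrite !mulmx0 !mxE; lra.
have [s00|sn0] := eqVneq s 0.
  have b0 : b = 0.
    apply/matrixP => i j; rewrite ord1 [RHS]mxE.
    have bj : (b *m delta_mx j (0 : 'I_1)) 0 0 = b 0 j.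
      by rewrite -colE mxE.
    set q := ((delta_mx j (0 : 'I_1))^T *m D *m delta_mx j (0 : 'I_1)) 0 0.
    have h x : 0 <= 2 * x * b 0 j + q.
      by have := quad x (delta_mx j 0); rewrite s00 mulr0 add0r bj.
    apply/eqP; apply: contraT => bj0.
    (* A form affine in [x] with nonzero slope takes the value -1 at this point. *)
    have := h (- (q + 1) / (2 * b 0 j)).
    rewrite (_ : 2 * _ * _ = - (q + 1)); last by field.
    lra.
  have [A' A'D] : exists A' : 'M[R]_n, A' *m A'^T = D.
    apply: ih; split=> // v; have := quad 0 v.
    by rewrite b0 mul0mx !mxE; lra.
  exists (block_mx 0 0 0 A').
  rewrite tr_block_mx !trmx0 mulmx_block !mul0mx !mulmx0 !add0r A'D.
  rewrite GE b0 trmx0 a1 -/s s00; congr block_mx.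
  by apply/matrixP => i j; rewrite !mxE mul0rn.
have sp : 0 < s by rewrite lt_neqAle eq_sym sn0.
have [A' A'D] : exists A' : 'M[R]_n, A' *m A'^T = D - s^-1 *: (b^T *m b).
  apply: ih; split.
    by rewrite linearB/= linearZ/= trmx_mul trmxK Ds.
  (* This [x] minimizes the quadratic form for fixed [v]; the minimum is the form of the Schur
     complement. *)
  move=> v; have := quad (- (b *m v) 0 0 / s) v.
  rewrite mulmxBr mulmxBl -scalemxAr -scalemxAl [X in _ -> 0 <= X]mxE.
  rewrite [X in _ -> 0 <= _ + X]mxE [X in _ -> 0 <= _ - X]mxE.
  have -> : (v^T *m (b^T *m b) *m v) 0 0 = (b *m v) 0 0 ^+ 2.
    by rewrite mulmxA -mulmxA -trmx_mul mxE big_ord1 mxE expr2.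
  by move/le_trans; apply; rewrite le_eqVlt; apply/orP; left; apply/eqP; field.
pose t := Num.sqrt s; have t0 : t != 0 by rewrite gt_eqF// sqrtr_gt0.
have tt : t * t = s by rewrite -expr2 sqr_sqrtr.
exists (block_mx t%:M 0 (t^-1 *: b^T) A').
rewrite tr_block_mx !trmx0 mulmx_block !mul0mx !mulmx0 !addr0 A'D.
rewrite tr_scalar_mx linearZ/= trmxK -scalar_mxM tt.
rewrite [RHS]GE; congr block_mx.
- by rewrite a1.
- by rewrite mul_scalar_mx scalerA mulfV// scale1r.
- by rewrite mul_mx_scalar scalerA mulfV// scale1r.
- rewrite -scalemxAl -scalemxAr scalerA -invfM tt addrC subrK//.
Qed.

Lemma psd_factor n (G : 'M[R]_n) : psd G -> exists A : 'M[R]_n, A *m A^T = G.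
Proof.
elim: n G => [|n ih] G; last exact: psd_factor_step.
by move=> _; exists 0; apply/matrixP => -[].
Qed.

Lemma pinv_unique n (A B C : 'M[R]_n) : is_pinv A B -> is_pinv A C -> B = C.
Proof.
move=> [B1 B2 B3 B4] [C1 C2 C3 C4].
have AB : A *m B = A *m C.
  have : (A *m C *m (A *m B))^T = (A *m B)^T by rewrite mulmxA C1.
  by rewrite trmx_mul B3 C3 mulmxA B1 => <-.
have BA : B *m A = C *m A.
  have : (B *m A *m (C *m A))^T = (B *m A)^T by rewrite -mulmxA (mulmxA A) C1.
  by rewrite trmx_mul B4 C4 -mulmxA (mulmxA A) B1 => <-.
by rewrite -B2 BA -mulmxA AB mulmxA C2.
Qed.

Lemma pinv_diag_part n (A : 'M[R]_n) :
  Defs.pinv (diag_part A) = diag_mx (\row_i (A i i)^-1).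
Proof.
have P : is_pinv (diag_part A) (diag_mx (\row_i (A i i)^-1)).
  split; rewrite /diag_part ?mulmx_diag ?tr_diag_mx//; congr diag_mx;
    apply/rowP => i; rewrite !mxE.
  - by have [->|?] := eqVneq (A i i) 0; [rewrite !mul0r|field].
  - by have [->|?] := eqVneq (A i i) 0; [rewrite invr0 !mul0r|field].
apply: (pinv_unique _ P); rewrite /Defs.pinv.
by apply: (@xgetPex _ 0 [set B | is_pinv (diag_part A) B]); exists (diag_mx (\row_i (A i i)^-1)).
Qed.

Lemma psd_diag n (d : 'rV[R]_n) : (forall i, 0 <= d 0 i) -> psd (diag_mx d).
Proof.
move=> d0; split; first exact: tr_diag_mx.
move=> x; rewrite -mulmxA mxE; apply: sumr_ge0 => i _.
by rewrite mul_diag_mx !mxE mulrCA mulr_ge0// -expr2 sqr_ge0.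
Qed.

(** Uniqueness of the root: [B] commutes with [C], so [w = (B - C) v] satisfies [B w = - C w]. Both
    quadratic forms being nonnegative, both vanish at [w]; hence [C w = 0 = B w], and
    [w^T w = v^T (B - C) w = 0]. *)
Lemma psd_sqrt_diag n (d : 'rV[R]_n) : (forall i, 0 <= d 0 i) ->
  psd_sqrt (diag_mx d) = diag_mx (map_mx Num.sqrt d).
Proof.
move=> d0; set C := diag_mx (map_mx _ d).
have Cp : psd C by apply: psd_diag => i; rewrite mxE sqrtr_ge0.
have CC : C *m C = diag_mx d.
  rewrite mulmx_diag; congr diag_mx; apply/rowP => i; rewrite !mxE.
  by rewrite -expr2 sqr_sqrtr.
have [[Bs Bp] BB] : psd (psd_sqrt (diag_mx d)) /\
    psd_sqrt (diag_mx d) *m psd_sqrt (diag_mx d) = diag_mx d.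
  rewrite /psd_sqrt; apply: (@xgetPex _ 0 [set B | psd B /\ B *m B = diag_mx d]).
  by exists C.
move: (psd_sqrt _) Bs Bp BB => B Bs Bp BB.
have BC : B *m C = C *m B.
  have : B *m diag_mx d = diag_mx d *m B by rewrite -BB mulmxA.
  (* Entrywise, [B] commuting with [diag_mx d] means that [B i j = 0] or [d 0 i = d 0 j]; in either
     case it commutes with the diagonal of the roots. *)
  move=> /matrixP h; apply/matrixP => i j.
  have := h i j; rewrite /C !mul_mx_diag !mul_diag_mx !mxE mulrC => /eqP.
  rewrite -subr_eq0 -mulrBl mulf_eq0 subr_eq0 => /orP[/eqP ->|/eqP ->].
    by rewrite mulrC.
  by rewrite mulr0 mul0r.
have dot0 (x : 'cV[R]_n) : (x^T *m x) 0 0 = 0 -> x = 0.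
  rewrite mxE => /eqP; rewrite psumr_eq0; last first.
    by move=> i _; rewrite mxE -expr2 sqr_ge0.
  move=> /allP x0; apply/colP => i; rewrite [RHS]mxE.
  have := x0 i (mem_index_enum _); rewrite /= mxE mulf_eq0 orbb.
  by move/eqP.
apply/matrixP => i j.
suff : (B - C) *m delta_mx j (0 : 'I_1) = 0.
  move=> /matrixP/(_ i 0); rewrite -colE mxE [RHS]mxE mxE mxE => /eqP.
  by rewrite subr_eq0 => /eqP.
set v := delta_mx _ _; set w := (B - C) *m v.
have Bw : B *m w = - (C *m w).
  apply/eqP; rewrite -addr_eq0 /w !mulmxA -mulmxDl !mulmxBr BB CC BC.
  by rewrite addrA subrK subrr mul0mx.
have qB := Bp w; have qC := Cp.2 w.
have qBC : (w^T *m B *m w) 0 0 = - (w^T *m C *m w) 0 0.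
  by rewrite -mulmxA Bw mulmxN mulmxA mxE.
have q0 : (w^T *m C *m w) 0 0 = 0 by apply/eqP; rewrite eq_le qC andbT; lra.
have Cw : C *m w = 0.
  apply/colP => l; rewrite [RHS]mxE /C mul_diag_mx !mxE.
  move: q0 => /eqP; rewrite -mulmxA mxE psumr_eq0; last first.
    by move=> m _; rewrite /C mul_diag_mx !mxE mulrCA mulr_ge0 ?sqrtr_ge0// -expr2 sqr_ge0.
  move=> /allP/(_ l (mem_index_enum _)); rewrite /= /C mul_diag_mx !mxE.
  rewrite mulf_eq0 mulf_eq0 => /orP[/eqP h|/orP[/eqP ->|/eqP h]].
  - by rewrite -[X in _ * X = _]/(\sum_j0 _) h mulr0.
  - by rewrite mul0r.
  - by rewrite h mulr0.
have BCs : (B - C)^T = B - C by rewrite linearB/= Bs Cp.1.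
apply: dot0; rewrite {1}/w trmx_mul BCs -mulmxA mulmxBl Bw Cw.
by rewrite oppr0 addr0 mulmx0 mxE.
Qed.

End matrices.

Section correlation.
Context {R : realType} {k : nat}.
Implicit Types A G : 'M[R]_k.

Lemma psd_diag_ge0 A j : psd A -> 0 <= A j j.
Proof.
move=> [_ /(_ (delta_mx j 0))]; rewrite trmx_delta -rowE -colE !mxE.
by [].
Qed.

(* Division by [0] being [0], the formula also covers vanishing variances. *)
Lemma corrE A i j : (forall l, 0 <= A l l) ->
  corr A i j = A i j / (Num.sqrt (A i i) * Num.sqrt (A j j)).
Proof.
move=> A0; rewrite /corr pinv_diag_part psd_sqrt_diag; last first.
  by move=> l; rewrite mxE invr_ge0.
rewrite mul_mx_diag mxE mul_diag_mx !mxE !sqrtrV// invfM.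
by rewrite mulrAC mulrC mulrA.
Qed.

Lemma psd_corr A : psd A -> psd (corr A).
Proof.
move=> Ap; have A0 l : 0 <= A l l by exact: psd_diag_ge0.
rewrite /corr pinv_diag_part psd_sqrt_diag; last by move=> l; rewrite mxE invr_ge0.
set D := diag_mx _; have Ds : D^T = D by exact: tr_diag_mx.
split; first by rewrite !trmx_mul Ds Ap.1 mulmxA.
move=> x; have := Ap.2 (D *m x); rewrite trmx_mul Ds.
by rewrite !mulmxA.
Qed.

Lemma corr_diag A j : psd A -> corr A j j = (0 < A j j)%R%:R.
Proof.
move=> Ap; rewrite corrE; last by move=> l; exact: psd_diag_ge0.
rewrite -expr2 sqr_sqrtr ?psd_diag_ge0// lt0r psd_diag_ge0// andbT.
by have [->|?] := eqVneq (A j j) 0; rewrite ?mul0r ?divff.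
Qed.

Lemma corr_unit_diag A : psd A -> (exists j, 0 < A j j) ->
  exists B : 'M[R]_k, unit_diag B /\ B *m B^T = corr A.
Proof.
move=> Ap [j Aj]; have [B BA] := psd_factor (psd_corr Ap).
exists B; split=> //; rewrite /unit_diag BA; split.
  by move=> l; rewrite corr_diag//; case: (0 < _); [right|left].
by exists j; rewrite corr_diag// Aj.
Qed.

Lemma corr_cases A : psd A ->
  (exists j, 0 < A j j) \/ corr A = 0.
Proof.
move=> Ap; have [|nA] := pselect (exists j, 0 < A j j); [by left|right].
have A0 l : A l l = 0.
  apply/eqP; rewrite eq_le psd_diag_ge0// andbT leNgt; apply/negP => Al.
  by apply: nA; exists l.
apply/matrixP => i j; rewrite corrE; last by move=> l; rewrite A0.
by rewrite !A0 sqrtr0 mul0r invr0 mulr0 mxE.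
Qed.

Lemma Kquantile_corr_uniform (p e : R) : 0 < p < 1 -> 0 < e ->
  exists2 tau, 0 < tau & forall A A' : 'M[R]_k, psd A -> psd A' ->
    (exists j, 0 < A j j) -> (exists j, 0 < A' j j) ->
    (forall i j, `|corr A i j - corr A' i j| <= tau) ->
    Kquantile p (corr A') <= Kquantile p (corr A) + e.
Proof.
move=> p01 e0; have [tau tau0 H] := @Kquantile_continuous R k p e p01 e0.
exists tau => // A A' Ap Ap' Aj Aj' AA'.
have [B [uB BA]] := corr_unit_diag Ap Aj.
have [B' [uB' BA']] := corr_unit_diag Ap' Aj'.
by rewrite -BA -BA'; apply: H => // i j; rewrite BA BA'.
Qed.

Lemma Kquantile_corr_ge (p : R) A : 0 < p < 1 -> psd A -> (exists j, 0 < A j j) ->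
  p / 2 <= Kquantile p (corr A).
Proof.
move=> p01 Ap Aj; have [B [uB BA]] := corr_unit_diag Ap Aj.
have [T0 [_ H]] := @KquantileP R k p p01.
by have [C [_ /andP[h _] _ _]] := H B uB; rewrite -BA.
Qed.

(** Extends the estimate to matrices with zero diagonal, as needed for measurability over all
    samples. *)
Let Kquantile_corr_lsc (p e : R) A : 0 < p < 1 -> 0 < e -> psd A ->
  exists2 tau, 0 < tau & forall A', psd A' ->
    (forall i j, `|corr A i j - corr A' i j| < tau) ->
    Kquantile p (corr A) <= Kquantile p (corr A') + e.
Proof.
move=> p01 e0 Ap; have [tau tau0 H] := Kquantile_corr_uniform p01 e0.
(* Diagonal entries of correlation matrices are 0 or 1, so at distance less than 1 the two matrices
   are both zero or both nonzero. *)
exists (Num.min tau 1); first by rewrite lt_min tau0 ltr01.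
move=> A' Ap' AA'.
have AA1 i j : `|corr A i j - corr A' i j| < 1.
  by apply: lt_le_trans (AA' i j) _; rewrite ge_min lexx orbT.
have AAt i j : `|corr A' i j - corr A i j| <= tau.
  by rewrite distrC; apply: ltW; apply: lt_le_trans (AA' i j) _; rewrite ge_min lexx.
have [Aj|A0] := corr_cases Ap; have [Aj'|A0'] := corr_cases Ap'.
- exact: H.
- have [j Ajj] := Aj; have := AA1 j j.
  by rewrite A0' corr_diag// Ajj mxE subr0 normr1 ltxx.
- have [j Ajj] := Aj'; have := AA1 j j.
  by rewrite A0 corr_diag// Ajj mxE sub0r normrN normr1 ltxx.
- by rewrite A0 A0' lerDl ltW.
Qed.

Lemma measurable_fun_invr d (T : measurableType d) (f : T -> R) :
  (forall x, 0 <= f x) -> measurable_fun setT f ->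
  measurable_fun setT (fun x => (f x)^-1).
Proof.
move=> f0 mf; rewrite (_ : (fun x => _) = fun x => (f x) `^ (-1)).
  by apply: (measurableT_comp (f := fun x : R => x `^ (-1))); first exact: measurable_powR.
by apply/funext => x; rewrite powR_inv1.
Qed.

Lemma measurable_fun_sqrt d (T : measurableType d) (f : T -> R) :
  measurable_fun setT f -> measurable_fun setT (fun x => Num.sqrt (f x)).
Proof.
move=> mf; have ms : measurable_fun setT (@Num.sqrt R).
  by apply: continuous_measurable_fun; exact: sqrt_continuous.
exact: (measurableT_comp ms mf).
Qed.

(** [corr] is measurable entry by entry, but not continuous. As a function of the correlation
    matrix, however, the quantile is lower semicontinuous: its superlevel sets are cut out by the
    open set [U], a union of balls around correlation matrices. *)
Lemma measurable_Kquantile_corr d (T : measurableType d) (p : R) (f : T -> 'M[R]_k) :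
  0 < p < 1 -> (forall y, psd (f y)) ->
  (forall i j, measurable_fun setT (fun y => f y i j)) ->
  measurable_fun setT (fun y => Kquantile p (corr (f y))).
Proof.
move=> p01 fp mf.
have mc : measurable_fun setT (fun y => corr (f y)).
  apply/measurable_fun_matrixP => i j.
  rewrite (_ : (fun y => _) =
    fun y => f y i j / (Num.sqrt (f y i i) * Num.sqrt (f y j j))); last first.
    by apply/funext => y; rewrite corrE// => l; exact: psd_diag_ge0.
  apply: measurable_funM => //.
  apply: measurable_fun_invr; first by move=> y; rewrite mulr_ge0 ?sqrtr_ge0.
  by apply: measurable_funM; exact: measurable_fun_sqrt.
apply: (measurability _ (RGenOInfty.measurableE R)) => _ [_ [a ->] <-].
rewrite setTI.
pose G := [set A : 'M[R]_k | psd A /\ a < Kquantile p (corr A)].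
have arith (x y b : R) : b < x -> x <= y + (x - b) / 2 -> b < y by lra.
have /choice[tau tauP] : forall A, exists tau : R, 0 < tau /\ (G A ->
    forall A', psd A' -> (forall i j, `|corr A i j - corr A' i j| < tau) ->
    a < Kquantile p (corr A')).
  move=> A; have [[Ap aA]|nG] := pselect (G A); last by exists 1.
  have e0 : 0 < (Kquantile p (corr A) - a) / 2 by rewrite divr_gt0// subr_gt0.
  have [tau tau0 H] := Kquantile_corr_lsc p01 e0 Ap.
  exists tau; split; first exact: tau0.
  move=> _ A' Ap' AA'.
  exact: (arith _ _ _ aA (H A' Ap' AA')).
pose U := \bigcup_(A in G) ball (corr A) (tau A).
have oU : open U.
  apply: bigcup_open => A _; apply: ball_open; exact: (tauP A).1.
rewrite (_ : _ @^-1` _ = (fun y => corr (f y)) @^-1` U).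
  rewrite -[X in measurable X]setTI; apply: mc => //.
  exact: sub_sigma_algebra.
apply/seteqP; split=> y /=; rewrite in_itv/= andbT.
  move=> ay; exists (f y); first by split.
  by apply: ballxx; exact: (tauP _).1.
move=> [A GA [_ Ay]]; exact: (tauP A).2.
Qed.

End correlation.

(** * Lindeberg arrays *)

Section square_integrable.
Context {d} {T : measurableType d} {R : realType} (P : probability T R).
Implicit Types f h : T -> R.

Definition sqr_integrable f :=
  measurable_fun setT f /\ P.-integrable setT (EFin \o (fun x => f x ^+ 2)).

Lemma integrable_dom f h : measurable_fun setT f ->
  P.-integrable setT (EFin \o h) -> (forall x, `|f x| <= h x) ->
  P.-integrable setT (EFin \o f).
Proof.
move=> mf inth fh; apply: (le_integrable measurableT _ _ inth).
  exact/measurable_EFinP.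
move=> x _; rewrite /= lee_fin; apply: le_trans (fh x) _; exact: ler_norm.
Qed.

Lemma integrable_add f h : P.-integrable setT (EFin \o f) ->
  P.-integrable setT (EFin \o h) ->
  P.-integrable setT (EFin \o (fun x => f x + h x)).
Proof. by move=> intf inth; exact: (integrableD measurableT intf inth). Qed.

Lemma integrable_sub f h : P.-integrable setT (EFin \o f) ->
  P.-integrable setT (EFin \o h) ->
  P.-integrable setT (EFin \o (fun x => f x - h x)).
Proof. by move=> intf inth; exact: (integrableB measurableT intf inth). Qed.

Lemma integrable_scale (a : R) f : P.-integrable setT (EFin \o f) ->
  P.-integrable setT (EFin \o (fun x => a * f x)).
Proof. by move=> intf; exact: (integrableZl measurableT a intf). Qed.

Lemma integrable_cst (a : R) : P.-integrable setT (EFin \o (fun=> a)).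
Proof. exact: finite_measure_integrable_cst. Qed.

Lemma integrable_bigsum (I : Type) (s : seq I) (F : I -> T -> R) :
  (forall i, P.-integrable setT (EFin \o F i)) ->
  P.-integrable setT (EFin \o (fun x => \sum_(i <- s) F i x)).
Proof.
move=> intF; elim: s => [|i s ih].
  rewrite (_ : (fun x => _) = fun=> 0); first exact: integrable_cst.
  by apply/funext => x; rewrite big_nil.
rewrite (_ : (fun x => _) = fun x => F i x + \sum_(j <- s) F j x).
  exact: integrable_add.
by apply/funext => x; rewrite big_cons.
Qed.

Lemma Rintegral_bigsum (I : Type) (s : seq I) (F : I -> T -> R) :
  (forall i, P.-integrable setT (EFin \o F i)) ->
  \int[P]_x (\sum_(i <- s) F i x) = \sum_(i <- s) \int[P]_x F i x.
Proof.
move=> intF; elim: s => [|i s ih].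
  rewrite big_nil; under eq_Rintegral do rewrite big_nil.
  exact: Rintegral_cst_probability.
under eq_Rintegral do rewrite big_cons.
by rewrite big_cons -ih -RintegralD//; exact: integrable_bigsum.
Qed.

Lemma sqr_integrable_int f : sqr_integrable f -> P.-integrable setT (EFin \o f).
Proof.
move=> [mf intf]; apply: (integrable_dom mf (integrable_add (integrable_cst 1) intf)).
move=> x; rewrite -(real_normK (num_real (f x))).
have := normr_ge0 (f x); nra.
Qed.

Lemma sqr_integrable_mul f h : sqr_integrable f -> sqr_integrable h ->
  P.-integrable setT (EFin \o (fun x => f x * h x)).
Proof.
move=> [mf intf] [mh inth].
apply: (integrable_dom _ (integrable_add intf inth)); first exact: measurable_funM.
move=> x; rewrite normrM -(real_normK (num_real (f x))) -(real_normK (num_real (h x))).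
have := normr_ge0 (f x); have := normr_ge0 (h x).
by have := sqr_ge0 (`|f x| - `|h x|); nra.
Qed.

Lemma sqr_sum_mean k (v : 'I_k -> R) (f : 'I_k -> T -> R) :
  (forall j, sqr_integrable (f j)) ->
  \int[P]_x (\sum_j v j * f j x) ^+ 2 =
  \sum_a \sum_b v a * v b * \int[P]_x (f a x * f b x).
Proof.
move=> f2; have iab a b : P.-integrable setT (EFin \o
    (fun x => v a * v b * (f a x * f b x))).
  by apply: integrable_scale; exact: sqr_integrable_mul.
transitivity (\int[P]_x (\sum_a \sum_b v a * v b * (f a x * f b x))).
  apply: eq_Rintegral => x _; rewrite expr2 mulr_suml; apply: eq_bigr => a _.
  by rewrite mulr_sumr; apply: eq_bigr => b _; ring.
rewrite Rintegral_bigsum; last by move=> a; exact: integrable_bigsum.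
apply: eq_bigr => a _; rewrite Rintegral_bigsum//; apply: eq_bigr => b _.
by rewrite RintegralZl//; exact: sqr_integrable_mul.
Qed.

Lemma sqr_integrable_scale (a : R) f : sqr_integrable f ->
  sqr_integrable (fun x => a * f x).
Proof.
move=> [mf intf]; split; first exact: measurable_funM.
rewrite (_ : (fun x => _) = fun x => a ^+ 2 * f x ^+ 2).
  exact: integrable_scale.
by apply/funext => x; rewrite exprMn.
Qed.

Lemma sqr_integrable_bounded f (M : R) : measurable_fun setT f ->
  (forall x, `|f x| <= M) -> sqr_integrable f.
Proof.
move=> mf fM; split=> //; apply: (@bounded_integrable _ _ _ _ _ (M ^+ 2)).
  exact: measurable_funX.
move=> x; rewrite normrX; have := fM x; have := normr_ge0 (f x); nra.
Qed.

Lemma pr_markov f (t : R) : 0 < t -> P.-integrable setT (EFin \o f) ->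
  pr P [set x | t <= `|f x|] <= (\int[P]_x `|f x|) / t.
Proof.
move=> t0 intf; have mf : measurable_fun setT f.
  by apply/measurable_EFinP; exact: measurable_int intf.
have mA : measurable [set x | t <= `|f x|] by exact: measurable_norm_ge.
rewrite ler_pdivlMr// mulrC -Rintegral_indic// -RintegralZl//; last first.
  exact: integrable_indic.
apply: le_Rintegral => //.
- by apply: integrable_scale; exact: integrable_indic.
- exact: integrable_norm.
move=> x _; rewrite indicE; case: (boolP (x \in _)) => [|_].
  by rewrite inE /= mulr1.
by rewrite mulr0.
Qed.

End square_integrable.

Section independent_sums.
Context d d' (T : measurableType d) (U : measurableType d') (R : realType).
Context (n : nat) (P : probability T R) (Q : 'I_n -> probability U R).
Variables (X : 'I_n -> T -> U).
Hypothesis mX : forall i, measurable_fun setT (X i).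
Hypothesis PQ : forall B, (forall i, measurable (B i)) ->
  P [set x | forall i, B i (X i x)] = (\prod_(i < n) Q i (B i))%E.

Lemma marginal_mean i (f : U -> R) : (Q i).-integrable setT (EFin \o f) ->
  P.-integrable setT (EFin \o (fun x => f (X i x))) /\
  \int[P]_x f (X i x) = \int[Q i]_u f u.
Proof.
move=> intf; pose F j := if j == i then f else fun=> 1.
have intF j : (Q j).-integrable setT (EFin \o F j).
  by rewrite /F; case: eqVneq => [->//|_]; exact: integrable_cst.
have FE x : \prod_j F j (X j x) = f (X i x).
  rewrite (bigD1 i)//= /F eqxx big1 ?mulr1// => j /negPf ->.
  by [].
have := integrable_prod mX PQ intF; have := Rintegral_prod mX PQ intF.
rewrite [in X in _ = X -> _](bigD1 i)//= {2}/F eqxx big1 ?mulr1; last first.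
  by move=> j /negPf ji; rewrite /F ji Rintegral_cst_probability.
move=> h1 h2; split.
  by apply: eq_integrable h2 => // x _; rewrite /= FE.
by rewrite -h1; apply: eq_Rintegral => x _; rewrite FE.
Qed.

Lemma pair_mean i j (f h : U -> R) : i != j ->
  (Q i).-integrable setT (EFin \o f) -> (Q j).-integrable setT (EFin \o h) ->
  P.-integrable setT (EFin \o (fun x => f (X i x) * h (X j x))) /\
  \int[P]_x (f (X i x) * h (X j x)) = \int[Q i]_u f u * \int[Q j]_u h u.
Proof.
move=> ij intf inth.
pose F l := if l == i then f else if l == j then h else fun=> 1.
have intF l : (Q l).-integrable setT (EFin \o F l).
  rewrite /F; case: eqVneq => [->//|_]; case: eqVneq => [->//|_].
  exact: integrable_cst.
have Fi : F i = f by rewrite /F eqxx.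
have Fj : F j = h by rewrite /F eq_sym (negPf ij) eqxx.
have Fl l : l != i -> l != j -> F l = fun=> 1 by rewrite /F => /negPf -> /negPf ->.
have FE x : \prod_j F j (X j x) = f (X i x) * h (X j x).
  rewrite (bigD1 i)//= (bigD1 j) 1?eq_sym//= Fi Fj big1 ?mulr1//.
  by move=> l /andP[li lj]; rewrite Fl.
have := integrable_prod mX PQ intF; have := Rintegral_prod mX PQ intF.
rewrite [in X in _ = X -> _](bigD1 i)//= (bigD1 j) 1?eq_sym//= Fi Fj.
rewrite [X in _ * (_ * X)]big1 ?mulr1; last first.
  by move=> l /andP[li lj]; rewrite Fl// Rintegral_cst_probability.
move=> h1 h2; split.
  by apply: eq_integrable h2 => // x _; rewrite /= FE.
by rewrite -h1; apply: eq_Rintegral => x _; rewrite FE.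
Qed.

(** Terms with two different indices factor by independence and vanish since [f] is centred; only
    the diagonal survives. *)
Lemma sum_mul_mean (f h : 'I_n -> U -> R) :
  (forall i, sqr_integrable (Q i) (f i)) -> (forall i, sqr_integrable (Q i) (h i)) ->
  (forall i, \int[Q i]_u f i u = 0) ->
  P.-integrable setT (EFin \o
    (fun x => (\sum_i f i (X i x)) * (\sum_i h i (X i x)))) /\
  \int[P]_x ((\sum_i f i (X i x)) * (\sum_i h i (X i x))) =
  \sum_i \int[Q i]_u (f i u * h i u).
Proof.
move=> f2 h2 f0.
have E x : (\sum_i f i (X i x)) * (\sum_i h i (X i x)) =
    \sum_i \sum_j f i (X i x) * h j (X j x).
  by rewrite mulr_suml; apply: eq_bigr => i _; rewrite mulr_sumr.
have int1 i j : P.-integrable setT (EFin \o (fun x => f i (X i x) * h j (X j x))).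
  have [<-|ij] := eqVneq i j.
    by have [] := @marginal_mean i _ (sqr_integrable_mul (f2 i) (h2 i)).
  by have [] := pair_mean ij (sqr_integrable_int (f2 i)) (sqr_integrable_int (h2 j)).
have int2 i : P.-integrable setT (EFin \o (fun x => \sum_j f i (X i x) * h j (X j x))).
  exact: integrable_bigsum.
split.
  rewrite (_ : (fun x => _ * _) =
      fun x => \sum_i \sum_j f i (X i x) * h j (X j x)); last exact/funext.
  exact: integrable_bigsum.
under eq_Rintegral do rewrite E.
rewrite Rintegral_bigsum//; apply: eq_bigr => i _.
rewrite Rintegral_bigsum// (bigD1 i)//= [X in _ + X]big1 ?addr0.
  by have [_ ->] := @marginal_mean i _ (sqr_integrable_mul (f2 i) (h2 i)).
move=> j ji.
have [_ ->] := pair_mean (i := i) (j := j) ltac:(by rewrite eq_sym)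
  (sqr_integrable_int (f2 i)) (sqr_integrable_int (h2 j)).
by rewrite f0 mul0r.
Qed.

End independent_sums.

Lemma sqr_sum_le (R : realType) k (a : 'I_k -> R) :
  (\sum_j a j) ^+ 2 <= k%:R * \sum_j a j ^+ 2.
Proof.
have : 0 <= \sum_i \sum_j (a i - a j) ^+ 2.
  by do 2 (apply: sumr_ge0 => ? _); exact: sqr_ge0.
have -> : \sum_i \sum_j (a i - a j) ^+ 2 =
    2 * (k%:R * \sum_j a j ^+ 2) - 2 * (\sum_j a j) ^+ 2.
  transitivity (\sum_i (k%:R * a i ^+ 2 + \sum_j a j ^+ 2 - 2 * a i * \sum_j a j)).
    apply: eq_bigr => i _; rewrite (_ : k%:R * _ = \sum_(j < k) a i ^+ 2); last first.
      by rewrite sumr_const card_ord mulr_natl.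
    rewrite mulr_sumr -big_split/= -sumrB; apply: eq_bigr => j _; ring.
  rewrite sumrB big_split/= -mulr_sumr sumr_const card_ord -mulr_suml -mulr_sumr.
  by rewrite -[in X in _ + X]mulr_natl; ring.
lra.
Qed.

Section array.
Context d d' (T : measurableType d) (U : measurableType d') (R : realType).
Context (n k : nat) (P : probability T R) (Q : 'I_n -> probability U R).
Variables (X : 'I_n -> T -> U) (x : 'I_n -> 'I_k -> U -> R) (e : R).
Hypothesis mX : forall i, measurable_fun setT (X i).
Hypothesis PQ : forall B, (forall i, measurable (B i)) ->
  P [set x | forall i, B i (X i x)] = (\prod_(i < n) Q i (B i))%E.
Hypothesis x2 : forall i j, sqr_integrable (Q i) (x i j).
Hypothesis x0 : forall i j, \int[Q i]_u x i j u = 0.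
Hypothesis x1 : forall j, \sum_i \int[Q i]_u x i j u ^+ 2 = 1.
Hypotheses (e0 : 0 < e) (e1 : e <= 1).

(** The same [e] is the truncation level here and the bound in [lindeberg] below, so one number
    measures how far the array is from its limit. *)
Definition tail_sqr (f : U -> R) (u : U) : R := f u ^+ 2 * (e <= `|f u|)%R%:R.

Hypothesis lindeberg : forall j, \sum_i \int[Q i]_u tail_sqr (x i j) u <= e.

Definition array_cov (a b : 'I_k) : R := \sum_i \int[Q i]_u (x i a u * x i b u).

Let tail_ge0 f u : 0 <= tail_sqr f u.
Proof. by rewrite /tail_sqr mulr_ge0 ?sqr_ge0. Qed.

Let tail_le f u : tail_sqr f u <= f u ^+ 2.
Proof. by rewrite /tail_sqr ler_piMr ?sqr_ge0//; case: (e <= `|f u|). Qed.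

Let measurable_large (f : U -> R) : measurable_fun setT f ->
  measurable_fun setT (fun u => (e <= `|f u|)%R%:R : R).
Proof.
move=> mf; have mA : measurable [set u | e <= `|f u|] by exact: measurable_norm_ge.
rewrite (_ : (fun u => _) = \1_[set u | e <= `|f u|]); first exact: measurable_indic.
apply/funext => u; rewrite indicE; congr (nat_of_bool _)%:R.
by apply/idP/idP; rewrite inE.
Qed.

Let int_tail i j : (Q i).-integrable setT (EFin \o tail_sqr (x i j)).
Proof.
have [mx ix] := x2 i j; apply: (integrable_dom _ ix).
  by apply: measurable_funM; [exact: measurable_funX|exact: measurable_large].
by move=> u; rewrite ger0_norm.
Qed.

(** Feller's condition, that no single row dominates: below the level the square is at most
    [e ^+ 2 <= e], above it the tail bound applies. *)
Let mean_sqr_le i j : \int[Q i]_u x i j u ^+ 2 <= 2 * e.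
Proof.
have [mx ix] := x2 i j.
have h1 : \int[Q i]_u x i j u ^+ 2 <= \int[Q i]_u (e + tail_sqr (x i j) u).
  apply: le_Rintegral => //; first exact: (integrable_add (integrable_cst _ e) (int_tail i j)).
  move=> u _; rewrite /tail_sqr; case: (leP e `|x i j u|) => /= [h|h].
    by rewrite mulr1 lerDr ltW.
  rewrite mulr0 addr0 -(real_normK (num_real (x i j u))).
  by rewrite -[leRHS]mulr1 expr2 ler_pM// ltW//; exact: lt_le_trans e1.
apply: le_trans h1 _; have -> : \int[Q i]_u (e + tail_sqr (x i j) u) = e + \int[Q i]_u tail_sqr (x i j) u.
  rewrite RintegralD//; [|exact: integrable_cst|exact: int_tail].
  by rewrite Rintegral_cst_probability.
have : \int[Q i]_u tail_sqr (x i j) u <= \sum_i \int[Q i]_u tail_sqr (x i j) u.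
  rewrite [leRHS](bigD1 i)//= lerDl; apply: sumr_ge0 => l _.
  by apply: Rintegral_ge0.
by have := lindeberg j; lra.
Qed.

Section clt.
Variables (M : R) (v : 'I_k -> R).
Hypotheses (M1 : 1 <= M) (vM : forall j, `|v j| <= M).

Ltac mlra := have := e0; have := e1; have := M1; lra.

(** If all [|x i j u|] are below [e], then [|h i u|] is below [D * e], which therefore is the
    truncation level of the combination [h]. Thanks to [k.+1], [D >= 1] holds also for [k = 0]. *)
Let D : R := M * k.+1%:R.
Let h i u : R := \sum_j v j * x i j u.
Let s i : R := \sum_j \int[Q i]_u x i j u ^+ 2.
Let tau i : R := \sum_j (e * \int[Q i]_u x i j u ^+ 2 + \int[Q i]_u tail_sqr (x i j) u).

Let D1 : 1 <= D.
Proof.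
have k1 : 1 <= k.+1%:R :> R by rewrite ler1n.
by rewrite /D -[leLHS]mulr1 ler_pM.
Qed.

Let kMD : k%:R * M <= D.
Proof. by rewrite /D mulrC ler_wpM2l ?ler_nat//; mlra. Qed.

Let h_sqr i u : h i u ^+ 2 <= k%:R * M ^+ 2 * \sum_j x i j u ^+ 2.
Proof.
apply: le_trans (sqr_sum_le _) _; rewrite -mulrA ler_wpM2l// mulr_sumr.
apply: ler_sum => j _; rewrite exprMn ler_wpM2r ?sqr_ge0//.
by rewrite -(real_normK (num_real (v j))) ler_sqr ?nnegrE//; mlra.
Qed.

Let sum_sqr_ge0 i u : 0 <= \sum_j x i j u ^+ 2.
Proof. by apply: sumr_ge0 => j _; exact: sqr_ge0. Qed.

Let sum_tail_ge0 i u : 0 <= \sum_j tail_sqr (x i j) u.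
Proof. by apply: sumr_ge0. Qed.

Let kM2 : k%:R * M ^+ 2 <= D ^+ 2.
Proof.
rewrite /D exprMn mulrC ler_wpM2l ?sqr_ge0// -natrX ler_nat.
by rewrite (leq_trans (leqnSn k))// -{1}[k.+1]expn1 leq_pexp2l.
Qed.

Ltac dlra := have := D1; mlra.

(** A large [h i u] forces some entry [j0] to be at least [e]. The entries below [e] are then
    dominated by that one, so the sum of all squares is at most [k] times the sum of the tails. *)
Let remainder i u : D * e * h i u ^+ 2 + h i u ^+ 2 * (D * e <= `|h i u|)%R%:R <=
  D ^+ 3 * (e * \sum_j x i j u ^+ 2 + \sum_j tail_sqr (x i j) u).
Proof.
have q0 := sum_sqr_ge0 i u; have t0 := sum_tail_ge0 i u.
have h2 : h i u ^+ 2 <= D ^+ 2 * \sum_j x i j u ^+ 2.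
  by apply: le_trans (h_sqr i u) _; rewrite ler_wpM2r.
have D2 : D ^+ 2 <= D ^+ 3 by exact: (ler_weXn2l D1).
have D0 : 0 <= D ^+ 2 by rewrite sqr_ge0.
have De : 0 <= D * e by rewrite mulr_ge0; dlra.
have first : D * e * h i u ^+ 2 <= D ^+ 3 * (e * \sum_j x i j u ^+ 2).
  rewrite (_ : D ^+ 3 * (e * _) = D * e * (D ^+ 2 * \sum_j x i j u ^+ 2)).
    by rewrite ler_wpM2l.
  by ring.
rewrite mulrDr lerD//.
case: (leP (D * e) `|h i u|) => /= [Dh|_]; last first.
  by rewrite mulr0 mulr_ge0//; dlra.
rewrite mulr1.
have [j0 j0e] : exists j0, e <= `|x i j0 u|.
  apply: contrapT => /forallNP small.
  suff : `|h i u| < D * e by rewrite ltNge Dh.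
  apply: (@le_lt_trans _ _ (M * k%:R * e)); last first.
    by rewrite ltr_pM2r// /D ltr_pM2l ?ltr_nat//; dlra.
  apply: le_trans (ler_norm_sum _ _ _) _.
  rewrite (_ : M * k%:R * e = \sum_(j < k) M * e); last first.
    by rewrite sumr_const card_ord -mulr_natr; ring.
  apply: ler_sum => j _; rewrite normrM ler_pM//.
  by have /negP := small j; rewrite -ltNge => /ltW.
have sq : \sum_j x i j u ^+ 2 <= k%:R * \sum_j tail_sqr (x i j) u.
  rewrite (_ : k%:R * _ = \sum_(j < k) \sum_j tail_sqr (x i j) u); last first.
    by rewrite sumr_const card_ord mulr_natl.
  apply: ler_sum => j _.
  have tle l : tail_sqr (x i l) u <= \sum_j tail_sqr (x i j) u.
    by rewrite [leRHS](bigD1 l)//= lerDl; apply: sumr_ge0.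
  have [je|je] := leP e `|x i j u|.
    by apply: le_trans (tle j); rewrite /tail_sqr je mulr1.
  apply: le_trans (tle j0); rewrite /tail_sqr j0e mulr1.
  rewrite -(real_normK (num_real (x i j u))) -(real_normK (num_real (x i j0 u))).
  by rewrite ler_sqr ?nnegrE//; dlra.
apply: le_trans (h_sqr i u) _.
apply: (@le_trans _ _ (k%:R * M ^+ 2 * (k%:R * \sum_j tail_sqr (x i j) u))).
  by rewrite ler_wpM2l// mulr_ge0// sqr_ge0.
rewrite mulrA ler_wpM2r//; apply: le_trans D2.
rewrite (_ : _ * k%:R = (k%:R * M) ^+ 2); last by ring.
by rewrite ler_sqr ?nnegrE ?mulr_ge0//; dlra.
Qed.

Let h2 i : sqr_integrable (Q i) (h i).
Proof.
have mh : measurable_fun setT (h i).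
  by apply: measurable_sum => j; apply: measurable_funM => //; case: (x2 i j).
split=> //.
apply: (@integrable_dom _ _ _ _ _ (fun u => k%:R * M ^+ 2 * \sum_j x i j u ^+ 2)).
- exact: measurable_funX.
- apply: integrable_scale; apply: integrable_bigsum => j.
  by case: (x2 i j).
- by move=> u; rewrite ger0_norm ?sqr_ge0.
Qed.

Let h_mean i : \int[Q i]_u h i u = 0.
Proof.
rewrite Rintegral_bigsum; last first.
  by move=> j; apply: integrable_scale; exact: sqr_integrable_int.
apply: big1 => j _; rewrite RintegralZl ?x0 ?mulr0//.
exact: (sqr_integrable_int (x2 i j)).
Qed.

Let h_var i : \int[Q i]_u h i u ^+ 2 =
  \sum_a \sum_b v a * v b * \int[Q i]_u (x i a u * x i b u).
Proof. exact: sqr_sum_mean. Qed.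

(** Both sides are compared with [(1 - S / 2) * cos c]. The Taylor errors of [cos] and [sin] give
    [2 * D ^+ 3 * tau i]. The error of the exponential is quadratic in S, and one factor S is of
    order [e] by [mean_sqr_le]. *)
Let cos_h_le i c : `|\int[Q i]_u cos (h i u + c) -
    expR (- (\int[Q i]_u h i u ^+ 2) / 2) * cos c| <=
  2 * D ^+ 3 * tau i + D ^+ 4 * k%:R * e * s i.
Proof.
have [mh ih2] := h2 i; have ih := sqr_integrable_int (h2 i).
pose b u := D ^+ 3 * (e * \sum_j x i j u ^+ 2 + \sum_j tail_sqr (x i j) u).
have int_q : (Q i).-integrable setT (EFin \o (fun u => \sum_j x i j u ^+ 2)).
  by apply: integrable_bigsum => j; case: (x2 i j).
have int_t : (Q i).-integrable setT (EFin \o (fun u => \sum_j tail_sqr (x i j) u)).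
  exact: integrable_bigsum.
have int_b : (Q i).-integrable setT (EFin \o b).
  by apply: integrable_scale; apply: integrable_add => //; exact: integrable_scale.
have b_mean : \int[Q i]_u b u = D ^+ 3 * tau i.
  rewrite RintegralZl//; last by apply: integrable_add => //; exact: integrable_scale.
  congr (_ * _); rewrite RintegralD//; last exact: integrable_scale.
  rewrite RintegralZl// !Rintegral_bigsum//; last by move=> j; case: (x2 i j).
  by rewrite mulr_sumr -big_split.
have De : 0 < D * e by rewrite mulr_gt0//; dlra.
have mcos : measurable_fun setT (fun u => cos (h i u)).
  apply: (measurableT_comp (f := cos)) => //.
  by apply: continuous_measurable_fun; exact: continuous_cos.
have msin : measurable_fun setT (fun u => sin (h i u)).
  apply: (measurableT_comp (f := sin)) => //.
  by apply: continuous_measurable_fun; exact: continuous_sin.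
have int_cos : (Q i).-integrable setT (EFin \o (fun u => cos (h i u))).
  apply: (bounded_integrable _ mcos (M := 1)) => u.
  by rewrite ler_norml cos_geN1 cos_le1.
have int_sin : (Q i).-integrable setT (EFin \o (fun u => sin (h i u))).
  apply: (bounded_integrable _ msin (M := 1)) => u.
  by rewrite ler_norml sin_geN1 sin_le1.
set S := \int[Q i]_u h i u ^+ 2.
have norm_mean (f : U -> R) : (Q i).-integrable setT (EFin \o f) ->
    (forall u, `|f u| <= b u) -> `|\int[Q i]_u f u| <= D ^+ 3 * tau i.
  move=> intf fb; apply: le_trans (le_normr_Rintegral measurableT intf) _.
  rewrite -b_mean; apply: le_Rintegral => //; exact: integrable_norm.
have int_c2 : (Q i).-integrable setT (EFin \o (fun u => 2^-1 * h i u ^+ 2)).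
  exact: integrable_scale.
have int_1c2 : (Q i).-integrable setT (EFin \o (fun u => 1 - 2^-1 * h i u ^+ 2)).
  by apply: integrable_sub => //; exact: integrable_cst.
have cosE : `|\int[Q i]_u cos (h i u) - (1 - S / 2)| <= D ^+ 3 * tau i.
  rewrite (_ : _ - _ = \int[Q i]_u (cos (h i u) - (1 - 2^-1 * h i u ^+ 2))).
    apply: norm_mean; first exact: integrable_sub.
    move=> u; apply: le_trans (remainder i u).
    by rewrite mulrC; exact: cos_lindeberg.
  rewrite RintegralB// RintegralB//; last exact: integrable_cst.
  by rewrite Rintegral_cst_probability RintegralZl// mulrC.
have sinE : `|\int[Q i]_u sin (h i u)| <= D ^+ 3 * tau i.
  rewrite (_ : \int[Q i]_u _ = \int[Q i]_u (sin (h i u) - h i u)); last first.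
    by rewrite RintegralB// h_mean subr0.
  apply: norm_mean; first exact: integrable_sub.
  by move=> u; apply: le_trans (remainder i u); exact: sin_lindeberg.
have S0 : 0 <= S by apply: Rintegral_ge0 => u _; exact: sqr_ge0.
have s0 : 0 <= s i.
  by apply: sumr_ge0 => j _; apply: Rintegral_ge0 => u _; exact: sqr_ge0.
have SD : S <= D ^+ 2 * s i.
  apply: (@le_trans _ _ (\int[Q i]_u (D ^+ 2 * \sum_j x i j u ^+ 2))).
    apply: le_Rintegral => //; first exact: integrable_scale.
    by move=> u _; apply: le_trans (h_sqr i u) _; rewrite ler_wpM2r.
  by rewrite RintegralZl// Rintegral_bigsum// => j; case: (x2 i j).
have sk : s i <= 2 * k%:R * e.
  rewrite (_ : _ * e = \sum_(j < k) 2 * e); last first.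
    by rewrite sumr_const card_ord -mulr_natr; ring.
  by apply: ler_sum => j _; exact: mean_sqr_le.
have expE : `|expR (- S / 2) - (1 - S / 2)| <= D ^+ 4 * k%:R * e * s i.
  have := @expR_remainder R (S / 2); rewrite -mulNr => /(_ (ltac:(dlra))) /le_trans.
  apply; apply: (@le_trans _ _ ((D ^+ 2 * s i) ^+ 2 / 4)).
    rewrite (_ : (S / 2) ^+ 2 = S ^+ 2 / 4); last by field.
    rewrite ler_wpM2r// ler_sqr ?nnegrE//; first exact: le_trans SD.
  rewrite (_ : _ / 4 = D ^+ 4 * s i * (s i / 4)); last by field.
  rewrite (_ : D ^+ 4 * k%:R * e * s i = D ^+ 4 * s i * (k%:R * e)); last by ring.
  apply: ler_wpM2l; first by rewrite mulr_ge0// exprn_ge0//; dlra.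
  have : 0 <= k%:R * e by rewrite mulr_ge0// ltW.
  by move: sk; dlra.
rewrite (_ : \int[Q i]_u cos (h i u + c) =
    cos c * \int[Q i]_u cos (h i u) - sin c * \int[Q i]_u sin (h i u)); last first.
  rewrite -!RintegralZl// -RintegralB//; [|exact: integrable_scale..].
  by apply: eq_Rintegral => u _; rewrite cosD; ring.
set C := \int[Q i]_u cos (h i u) in cosE *.
set Sn := \int[Q i]_u sin (h i u) in sinE *.
set E := expR _ in expE *.
rewrite (_ : _ - _ = cos c * (C - (1 - S / 2)) - cos c * (E - (1 - S / 2)) - sin c * Sn);
  last by ring.
have hc : `|cos c| <= 1 by rewrite ler_norml cos_geN1 cos_le1.
have hs : `|sin c| <= 1 by rewrite ler_norml sin_geN1 sin_le1.
apply: le_trans (ler_normB _ _) _.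
apply: le_trans (lerD (ler_normB _ _) (lexx _)) _; rewrite !normrM.
have p1 := ler_pM (normr_ge0 _) (normr_ge0 _) hc cosE.
have p2 := ler_pM (normr_ge0 _) (normr_ge0 _) hc expE.
have p3 := ler_pM (normr_ge0 _) (normr_ge0 _) hs sinE.
by move: p1 p2 p3; rewrite !mul1r; dlra.
Qed.

(** Summing [cos_h_le] over the rows: the [s i] add up to [k] and the [tau i] to at most
    [2 * k * e], whence the constant [4 * k + k ^+ 2]. *)
Lemma lindeberg_cf c :
  `|\int[P]_y cos (\sum_j v j * (\sum_i x i j (X i y)) + c) -
    expR (- (\sum_a \sum_b v a * v b * array_cov a b) / 2) * cos c| <=
  (M * k.+1%:R) ^+ 4 * (4 * k%:R + k%:R ^+ 2) * e.
Proof.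
have mh i : measurable_fun setT (h i) by case: (h2 i).
pose r i := expR (- (\int[Q i]_u h i u ^+ 2) / 2).
have r1 i : `|r i| <= 1.
  rewrite ger0_norm ?expR_ge0// -[leRHS]expR0 ler_expR.
  have : 0 <= \int[Q i]_u h i u ^+ 2 by apply: Rintegral_ge0 => u _; exact: sqr_ge0.
  by dlra.
have := cos_product_approx mX PQ mh r1 cos_h_le c.
rewrite (_ : \prod_i r i = expR (- (\sum_a \sum_b v a * v b * array_cov a b) / 2)); last first.
  rewrite /r -expR_sum; congr expR; rewrite -mulr_suml; congr (_ / _).
  rewrite sumrN; congr (- _).
  under eq_bigr do rewrite h_var.
  rewrite exchange_big/=; apply: eq_bigr => a _.
  rewrite exchange_big/=; apply: eq_bigr => b _.
  by rewrite mulr_sumr.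
rewrite (_ : \int[P]_x0 _ = \int[P]_y cos (\sum_j v j * (\sum_i x i j (X i y)) + c)); last first.
  apply: eq_Rintegral => y _; congr (cos (_ + c)).
  rewrite exchange_big/=; apply: eq_bigr => j _.
  by rewrite mulr_sumr.
move=> /le_trans; apply.
rewrite big_split/= -!mulr_sumr.
have -> : \sum_i s i = k%:R.
  rewrite exchange_big/=; transitivity (\sum_(j < k) (1 : R)).
    by apply: eq_bigr => j _; exact: x1.
  by rewrite sumr_const card_ord.
have tau_le : \sum_i tau i <= 2 * k%:R * e.
  rewrite exchange_big/= (_ : _ * e = \sum_(j < k) 2 * e); last first.
    by rewrite sumr_const card_ord -mulr_natr; ring.
  apply: ler_sum => j _; rewrite big_split/= -mulr_sumr x1.
  by have := lindeberg j; dlra.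
rewrite -/D.
have D34 : D ^+ 3 <= D ^+ 4 by exact: (ler_weXn2l D1).
have D30 : 0 <= D ^+ 3 by rewrite exprn_ge0//; dlra.
have ke : 0 <= k%:R * e by rewrite mulr_ge0// ltW.
have : D ^+ 3 * \sum_i tau i <= D ^+ 4 * (2 * (k%:R * e)).
  apply: (@le_trans _ _ (D ^+ 3 * (2 * k%:R * e))); first by rewrite ler_wpM2l.
  by rewrite -mulrA ler_wpM2r// mulr_ge0.
rewrite (_ : D ^+ 4 * (4 * k%:R + k%:R ^+ 2) * e =
  2 * (D ^+ 4 * (2 * (k%:R * e))) + D ^+ 4 * k%:R * e * k%:R); last by ring.
by rewrite -mulrA; dlra.
Qed.

End clt.

Lemma array_second_moment j : \int[P]_y (\sum_i x i j (X i y)) ^+ 2 = 1.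
Proof.
have [_] := sum_mul_mean mX PQ (fun i => x2 i j) (fun i => x2 i j) (x0 ^~ j).
rewrite (_ : \sum_i _ = 1) => [<-|]; last by rewrite -(x1 j).
by apply: eq_Rintegral => y _; rewrite expr2.
Qed.

Section weak_law.
Variables a b : 'I_k.

(** The product truncated to both entries below [e]. Since [|w| <= e * |x i a|], the variances of
    the [w i] sum to at most [e ^+ 2], although the products themselves need not be square
    integrable; the rest [r] is controlled by the tails. *)
Let w i u : R := x i a u * x i b u *
  (1 - (e <= `|x i a u|)%R%:R) * (1 - (e <= `|x i b u|)%R%:R).
Let r i u : R := x i a u * x i b u - w i u.

Let mw i : measurable_fun setT (w i).
Proof.
have [ma _] := x2 i a; have [mb _] := x2 i b.
apply: measurable_funM; first apply: measurable_funM.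
- exact: measurable_funM.
- by apply: measurable_funB => //; exact: measurable_large.
- by apply: measurable_funB => //; exact: measurable_large.
Qed.

Let w_cases i u : w i u = 0 /\ (e <= `|x i a u| \/ e <= `|x i b u|) \/
  [/\ w i u = x i a u * x i b u, `|x i a u| < e & `|x i b u| < e].
Proof.
rewrite /w; have [ha|ha] := leP e `|x i a u|.
  by left; rewrite /= subrr mulr0 mul0r; split=> //; left.
have [hb|hb] := leP e `|x i b u|; last by right; rewrite /= subr0 !mulr1.
by left; rewrite /= subrr mulr0; split=> //; right.
Qed.

Let w_le i u : `|w i u| <= e * `|x i a u| /\ `|w i u| <= e ^+ 2.
Proof.
have e0' := e0; have [[-> _]|[-> ha hb]] := w_cases i u.
  by rewrite normr0 sqr_ge0 mulr_ge0// ltW.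
by rewrite normrM mulrC expr2 ler_wpM2r ?ler_pM// ltW.
Qed.

Let r_le i u : `|r i u| <= tail_sqr (x i a) u + tail_sqr (x i b) u.
Proof.
rewrite /r; have [[-> h]|[-> _ _]] := w_cases i u; last first.
  by rewrite subrr normr0 addr_ge0.
have e0' := e0; rewrite subr0 normrM /tail_sqr.
have na := normr_ge0 (x i a u); have nb := normr_ge0 (x i b u).
rewrite -(real_normK (num_real (x i a u))) -(real_normK (num_real (x i b u))).
move: h; have [ha|ha] := leP e `|x i a u|; have [hb|hb] := leP e `|x i b u| => h;
  rewrite /= ?mulr1 ?mulr0 ?addr0 ?add0r; [|nra|nra|by case: h].
by have := sqr_ge0 (`|x i a u| - `|x i b u|); nra.
Qed.

Let w2 i : sqr_integrable (Q i) (w i).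
Proof.
by apply: (@sqr_integrable_bounded _ _ _ _ _ (e ^+ 2)) => // u; case: (w_le i u).
Qed.

Let wm i := \int[Q i]_u w i u.
Let wc i u := w i u - wm i.

Let wc2 i : sqr_integrable (Q i) (wc i).
Proof.
apply: (@sqr_integrable_bounded _ _ _ _ _ (e ^+ 2 + `|wm i|)).
  exact: measurable_funB.
move=> u; apply: le_trans (ler_normB _ _) _; rewrite lerD2r.
by case: (w_le i u).
Qed.

Let wc_mean i : \int[Q i]_u wc i u = 0.
Proof.
rewrite RintegralB//; [|exact: sqr_integrable_int|exact: integrable_cst].
by rewrite Rintegral_cst_probability subrr.
Qed.

Let wc_var i : \int[Q i]_u (wc i u * wc i u) <= e ^+ 2 * \int[Q i]_u x i a u ^+ 2.
Proof.
have [_ iw2] := w2 i; have iw := sqr_integrable_int (w2 i).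
have [_ ia] := x2 i a.
have -> : \int[Q i]_u (wc i u * wc i u) = \int[Q i]_u (w i u ^+ 2) - wm i ^+ 2.
  transitivity (\int[Q i]_u (w i u ^+ 2 - (2 * wm i * w i u - wm i ^+ 2))).
    by apply: eq_Rintegral => u _; rewrite /wc; ring.
  have i2 : (Q i).-integrable setT (EFin \o (fun u => 2 * wm i * w i u)).
    exact: integrable_scale.
  rewrite RintegralB//; last by apply: integrable_sub => //; exact: integrable_cst.
  rewrite RintegralB//; last exact: integrable_cst.
  rewrite RintegralZl// Rintegral_cst_probability -/(wm i); ring.
apply: (@le_trans _ _ (\int[Q i]_u (w i u ^+ 2))).
  by rewrite gerBl sqr_ge0.
rewrite -RintegralZl//; apply: le_Rintegral => //; first exact: integrable_scale.
move=> u _; have [h _] := w_le i u.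
rewrite -(real_normK (num_real (w i u))) -(real_normK (num_real (x i a u))).
rewrite -exprMn ler_sqr ?nnegrE// mulr_ge0//; exact: ltW e0.
Qed.

Let Y y : R := \sum_i wc i (X i y).

Let Y_mean : P.-integrable setT (EFin \o Y) /\ \int[P]_y `|Y y| <= e.
Proof.
have [iY2 Y2] := sum_mul_mean mX PQ wc2 wc2 wc_mean.
have iY : P.-integrable setT (EFin \o Y).
  apply: integrable_bigsum => i.
  by have [] := marginal_mean mX PQ (sqr_integrable_int (wc2 i)).
split=> //.
have Y2le : \int[P]_y (Y y * Y y) <= e ^+ 2.
  rewrite Y2 -[leRHS]mulr1 -(x1 a) mulr_sumr; exact: ler_sum.
have e0' := e0.
have iB : P.-integrable setT (EFin \o (fun y => (2 * e)^-1 * (Y y * Y y))).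
  exact: integrable_scale.
(* The inequality |Y| <= Y^2 / (2 e) + e / 2 replaces Cauchy-Schwarz and, as Y has second moment at
   most e^2, yields [e]. *)
apply: (@le_trans _ _ (\int[P]_y ((2 * e)^-1 * (Y y * Y y) + e / 2))).
  apply: le_Rintegral => //; first exact: integrable_norm.
    by apply: integrable_add => //; exact: integrable_cst.
  move=> y _; rewrite -(ler_pM2l (_ : 0 < 2 * e)); last by rewrite mulr_gt0.
  rewrite (_ : 2 * e * (_ + _) = Y y * Y y + e ^+ 2); last by field; rewrite gt_eqF.
  rewrite -expr2 -(real_normK (num_real (Y y))).
  by have := sqr_ge0 (`|Y y| - e); nra.
rewrite RintegralD//; last exact: integrable_cst.
rewrite Rintegral_cst_probability RintegralZl//.
suff : (2 * e)^-1 * \int[P]_y (Y y * Y y) <= e / 2 by lra.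
apply: (@le_trans _ _ ((2 * e)^-1 * e ^+ 2)).
  by rewrite ler_wpM2l// invr_ge0 mulr_ge0// ltW.
by rewrite le_eqVlt; apply/orP; left; apply/eqP; field; rewrite gt_eqF.
Qed.

(** Markov's inequality. The mean absolute error is at most [5 * e]: [e] for the centred truncated
    sum, [2 * e] for the remainder and [2 * e] for the mean of the remainder. *)
Lemma lindeberg_weak_law (t : R) : 0 < t ->
  pr P [set y | t <= `|\sum_i x i a (X i y) * x i b (X i y) - array_cov a b|] <=
  5 * e / t.
Proof.
move=> t0; pose F y := \sum_i x i a (X i y) * x i b (X i y) - array_cov a b.
have ixx i := sqr_integrable_mul (x2 i a) (x2 i b).
have iw i := sqr_integrable_int (w2 i).
have ir i : (Q i).-integrable setT (EFin \o r i) by exact: integrable_sub.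
have irn i : (Q i).-integrable setT (EFin \o (fun u => `|r i u|)).
  exact: integrable_norm (ir i).
have [iY Ye] := Y_mean.
have iF : P.-integrable setT (EFin \o F).
  apply: integrable_sub; last exact: integrable_cst.
  apply: integrable_bigsum => i.
  by have [] := marginal_mean mX PQ (ixx i).
have iR : P.-integrable setT (EFin \o (fun y => \sum_i `|r i (X i y)|)).
  apply: integrable_bigsum => i.
  by have [] := marginal_mean mX PQ (irn i).
have Re : \sum_i \int[Q i]_u `|r i u| <= 2 * e.
  apply: (@le_trans _ _ (\sum_i (\int[Q i]_u tail_sqr (x i a) u +
      \int[Q i]_u tail_sqr (x i b) u))).
    apply: ler_sum => i _; rewrite -RintegralD//; [|exact: int_tail..].
    have it := integrable_add (int_tail i a) (int_tail i b).
    apply: (le_Rintegral measurableT (irn i) it).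
    by move=> u _; exact: r_le.
  by rewrite big_split/=; have := lindeberg a; have := lindeberg b; lra.
have F_le y : `|F y| <= `|Y y| + \sum_i `|r i (X i y)| + \sum_i \int[Q i]_u `|r i u|.
  have -> : F y = Y y + \sum_i r i (X i y) - \sum_i \int[Q i]_u r i u.
    rewrite /F /Y /array_cov -big_split/= -sumrB -sumrB; apply: eq_bigr => i _.
    rewrite /wc /wm (_ : \int[Q i]_u r i u =
      \int[Q i]_u (x i a u * x i b u) - \int[Q i]_u w i u); last first.
      exact: (RintegralB measurableT (ixx i) (iw i)).
    by rewrite /r; ring.
  apply: le_trans (ler_normB _ _) _; apply: lerD.
    apply: le_trans (ler_normD _ _) _; rewrite lerD2l; exact: ler_norm_sum.
  apply: le_trans (ler_norm_sum _ _ _) _; apply: ler_sum => i _.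
  exact: (le_normr_Rintegral measurableT (ir i)).
apply: le_trans (pr_markov t0 iF) _; rewrite ler_wpM2r ?invr_ge0 ?(ltW t0)//.
apply: (@le_trans _ _ (\int[P]_y (`|Y y| + \sum_i `|r i (X i y)| +
    \sum_i \int[Q i]_u `|r i u|))).
  apply: le_Rintegral => //; first exact: integrable_norm.
  apply: integrable_add; last exact: integrable_cst.
  by apply: integrable_add => //; exact: integrable_norm.
have iYR : P.-integrable setT (EFin \o (fun y => `|Y y| + \sum_i `|r i (X i y)|)).
  by apply: integrable_add => //; exact: integrable_norm.
rewrite RintegralD//; last exact: integrable_cst.
rewrite RintegralD//; last exact: integrable_norm.
rewrite Rintegral_cst_probability Rintegral_bigsum; last first.
  by move=> i; have [] := marginal_mean mX PQ (irn i).
rewrite (eq_bigr (fun i => \int[Q i]_u `|r i u|)); last first.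
  by move=> i _; have [_ ->] := marginal_mean mX PQ (irn i).
by lra.
Qed.

End weak_law.

End array.

(** * Asymptotics in the model *)

Lemma Rcovariance_mean0 (R : realType) d (T : measurableType d)
    (P : probability T R) (X Y : T -> R) :
  \int[P]_x X x = 0 -> \int[P]_x Y x = 0 ->
  fine (covariance P X Y) = \int[P]_x (X x * Y x).
Proof.
move=> X0 Y0; rewrite unlock [in LHS]unlock.
rewrite /Rintegral in X0 Y0; congr fine; apply: eq_integral => x _ /=.
rewrite X0 Y0 -[LHS]/(((X x - 0) * (Y x - 0))%:E) !subr0; by [].
Qed.

Lemma measurable_row (R : realType) n l (i : 'I_n) :
  measurable_fun setT (fun y : 'M[R]_(n, l) => row i y).
Proof.
apply/measurable_fun_matrixP => a b; under eq_fun do rewrite mxE.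
exact: measurable_entry.
Qed.

Section row_model.
Context {R : realType} {l k n : nat}.
Variable P : forall n, probability 'M[R]_(n, l) R.
Variable Pm : forall n, 'I_n -> probability 'rV[R]_l R.
Variable g : forall n, 'I_n -> 'rV[R]_l -> 'cV[R]_k.
Variable e : R.
Hypothesis hP : product_law P Pm n.
Hypothesis mg : forall i : 'I_n, measurable_fun [set: 'rV[R]_l] (@g n i).
Hypothesis g0 : forall (j : 'I_k) (i : 'I_n),
  'E_(@Pm n i)[(fun x => @g n i x j 0)%R]%E = 0%E.
Hypothesis gvar : forall j, (0 < rvar P g n j < +oo)%E.
Hypotheses (e0 : 0 < e) (e1 : e <= 1).
Hypothesis glind : forall j : 'I_k,
  ((fine (rvar P g n j))^-1%:E * \sum_(i < n)
     \int[@Pm n i]_(x in [set x | (e * Num.sqrt (fine (rvar P g n j))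
                                  <= `|@g n i x j 0|)%R])
       ((@g n i x j 0) ^+ 2)%:E <= e%:E)%E.

Let V j : R := fine (rvar P g n j).
Definition row_sd j : R := Num.sqrt (fine (rvar P g n j)).
Let s := row_sd.
Let G (i : 'I_n) (j : 'I_k) (u : 'rV[R]_l) : R := @g n i u j 0.
Let Q (i : 'I_n) := @Pm n i.
Let X (i : 'I_n) (y : 'M[R]_(n, l)) := row i y.

Let mX i : measurable_fun setT (X i). Proof. exact: measurable_row. Qed.

Let PQ B : (forall i, measurable (B i)) ->
  P n [set x | forall i, B i (X i x)] = (\prod_(i < n) Q i (B i))%E.
Proof. exact: hP. Qed.

Let V0 j : 0 < V j.
Proof. by apply: fine_gt0; exact: gvar. Qed.

Lemma row_sd_gt0 j : 0 < row_sd j.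
Proof. by rewrite /row_sd sqrtr_gt0; exact: V0. Qed.

Let sV j : s j ^+ 2 = V j.
Proof. by rewrite /s /row_sd sqr_sqrtr//; exact: ltW (V0 j). Qed.

Let mG i j : measurable_fun setT (G i j).
Proof. exact: (measurableT_comp (measurable_entry j 0) (mg i)). Qed.

Let D i j := [set u | e * s j <= `|G i j u|].

Let mD i j : measurable (D i j).
Proof. exact: measurable_norm_ge. Qed.

Let tailG i j u : R := G i j u ^+ 2 * \1_(D i j) u.

Let tailG_ge0 i j u : 0 <= tailG i j u.
Proof. by rewrite /tailG mulr_ge0 ?sqr_ge0// indicE. Qed.

Let mtailG i j : measurable_fun setT (tailG i j).
Proof. by apply: measurable_funM; [exact: measurable_funX|exact: measurable_indic]. Qed.

Let tailGE i j : (\int[Q i]_(x in D i j) (G i j x ^+ 2)%:E =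
  \int[Q i]_x (tailG i j x)%:E)%E.
Proof.
rewrite integral_mkcond; apply: eq_integral => u _.
by rewrite patchE /tailG indicE; case: ifP => _; rewrite ?mulr1 ?mulr0.
Qed.

Let sum_tailG j : (\sum_(i < n) \int[Q i]_x (tailG i j x)%:E <= (V j * e)%:E)%E.
Proof.
have := glind j; rewrite lee_pdivrMl ?V0// -EFinM => h.
by apply: le_trans h; apply: lee_sum => i _; rewrite -tailGE.
Qed.

Let int_tailG i j : (Q i).-integrable setT (EFin \o tailG i j).
Proof.
apply/integrableP; split; first exact/measurable_EFinP.
rewrite (eq_integral (EFin \o tailG i j)); last first.
  by move=> u _; rewrite /= ger0_norm.
apply: (@le_lt_trans _ _ (\sum_(i < n) \int[Q i]_x (tailG i j x)%:E)%E).
  rewrite (bigD1 i)//= leeDl// sume_ge0// => a _.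
  by apply: integral_ge0 => u _; rewrite lee_fin.
by apply: le_lt_trans (sum_tailG j) (ltry _).
Qed.

(** Square integrability of a single row term is read off Lindeberg's bound: its square is at most
    [(e * s j) ^+ 2] plus the tail part, whose integral is finite. *)
Let G2 i j : sqr_integrable (Q i) (G i j).
Proof.
split=> //.
apply: (@integrable_dom _ _ _ _ _ (fun u => (e * s j) ^+ 2 + tailG i j u)).
- exact: measurable_funX.
- by apply: integrable_add => //; exact: integrable_cst.
move=> u; rewrite ger0_norm ?sqr_ge0// /tailG indicE.
have s0 := row_sd_gt0 j.
case: (boolP (u \in _)) => [_|]; first by rewrite /= mulr1 lerDr sqr_ge0.
rewrite notin_setE /D/= => /negP; rewrite -ltNge => Gs.
rewrite mulr0 addr0 -(real_normK (num_real (G i j u))) ler_sqr ?nnegrE//.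
  exact: ltW.
by rewrite mulr_ge0// ltW.
Qed.

Let x i j u := (s j)^-1 * G i j u.

Let x2 i j : sqr_integrable (Q i) (x i j).
Proof. exact: sqr_integrable_scale. Qed.

Let G_mean i j : \int[Q i]_u G i j u = 0.
Proof. by have := g0 j i; rewrite unlock /Rintegral => ->. Qed.

Let x0 i j : \int[Q i]_u x i j u = 0.
Proof.
rewrite RintegralZl ?G_mean ?mulr0//.
exact: (sqr_integrable_int (G2 i j)).
Qed.

Let rsumE y j : rsum g y j 0 = \sum_(i < n) G i j (X i y).
Proof. by rewrite /rsum summxE. Qed.

Let rsum_mean j : \int[P n]_y rsum g y j 0 = 0.
Proof.
under eq_Rintegral do rewrite rsumE.
have iG i := marginal_mean mX PQ (sqr_integrable_int (G2 i j)).
rewrite Rintegral_bigsum; last by move=> i; case: (iG i).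
by apply: big1 => i _; have [_ ->] := iG i.
Qed.

Lemma rcovE a b : rcov P g n a b = \sum_(i < n) \int[Q i]_u (G i a u * G i b u).
Proof.
rewrite mxE Rcovariance_mean0//.
have [_ <-] := sum_mul_mean mX PQ (G2 ^~ a) (G2 ^~ b) (G_mean ^~ a).
by apply: eq_Rintegral => y _; rewrite !rsumE.
Qed.

Lemma rcov_diag j : rcov P g n j j = row_sd j ^+ 2.
Proof. by rewrite mxE -/s sV. Qed.

Lemma psd_rcov : psd (rcov P g n).
Proof.
split.
  by apply/matrixP => a b; rewrite mxE !rcovE; apply: eq_bigr => i _;
    apply: eq_Rintegral => u _; rewrite mulrC.
move=> v.
have -> : (v^T *m rcov P g n *m v) 0 0 =
    \sum_(i < n) \int[Q i]_u (\sum_a v a 0 * G i a u) ^+ 2.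
  under [RHS]eq_bigr do rewrite (sqr_sum_mean (v ^~ 0) (G2 _)).
  have quadE (A : 'M[R]_k) : (v^T *m A *m v) 0 0 =
      \sum_a \sum_b v a 0 * v b 0 * A a b.
    rewrite mxE exchange_big/=; apply: eq_bigr => b _.
    by rewrite mxE mulr_suml; apply: eq_bigr => a _; rewrite mxE; ring.
  rewrite quadE [RHS]exchange_big/=; apply: eq_bigr => a _.
  rewrite [RHS]exchange_big/=; apply: eq_bigr => b _.
  by rewrite rcovE -mulr_sumr.
apply: sumr_ge0 => i _; apply: Rintegral_ge0 => u _; exact: sqr_ge0.
Qed.

Let int_GG i a b : (Q i).-integrable setT (EFin \o (fun u => G i a u * G i b u)).
Proof. exact: sqr_integrable_mul. Qed.

Let array_covE a b : array_cov Q x a b = corr (rcov P g n) a b.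
Proof.
rewrite corrE; last by move=> j; rewrite rcov_diag sqr_ge0.
rewrite !rcov_diag !sqrtr_sqr !ger0_norm ?(ltW (row_sd_gt0 _))//.
rewrite rcovE mulr_suml; apply: eq_bigr => i _.
transitivity (\int[Q i]_u ((s a)^-1 * (s b)^-1 * (G i a u * G i b u))).
  by apply: eq_Rintegral => u _; rewrite /x; ring.
rewrite RintegralZl//; last exact: int_GG.
by rewrite mulrC invfM.
Qed.

Let x1 j : \sum_i \int[Q i]_u x i j u ^+ 2 = 1.
Proof.
have -> : \sum_i \int[Q i]_u x i j u ^+ 2 = array_cov Q x j j.
  by apply: eq_bigr => i _; apply: eq_Rintegral => u _; rewrite expr2.
by rewrite array_covE corr_diag ?rcov_diag ?exprn_gt0 ?row_sd_gt0//; exact: psd_rcov.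
Qed.

Let lindeberg j : \sum_i \int[Q i]_u tail_sqr e (x i j) u <= e.
Proof.
have s0 := row_sd_gt0 j.
have E i : \int[Q i]_u tail_sqr e (x i j) u = (V j)^-1 * \int[Q i]_u tailG i j u.
  rewrite -RintegralZl//; last exact: int_tailG.
  apply: eq_Rintegral => u _; rewrite /tail_sqr /tailG /x exprMn exprVn sV -mulrA.
  congr (_ * (_ * _)); rewrite indicE; congr (nat_of_bool _)%:R.
  rewrite normrM ger0_norm ?invr_ge0 ?(ltW s0)// ler_pdivlMl// mulrC.
  by apply/idP/idP; rewrite inE.
under eq_bigr do rewrite E.
rewrite -mulr_sumr ler_pdivrMl ?V0// -lee_fin -sumEFin.
apply: le_trans (sum_tailG j); rewrite le_eqVlt; apply/orP; left; apply/eqP.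
apply: eq_bigr => i _; rewrite /Rintegral fineK//; apply: integrable_fin_num => //.
exact: int_tailG.
Qed.

Let std_sumE y j : \sum_i x i j (X i y) = rsum g y j 0 / row_sd j.
Proof. by rewrite rsumE -mulr_sumr mulrC. Qed.

Let SmatE y a b : \sum_i x i a (X i y) * x i b (X i y) =
  Smat g y a b / (row_sd a * row_sd b).
Proof.
rewrite /Smat summxE mulr_suml; apply: eq_bigr => i _.
by rewrite mxE big_ord1 mxE /x invfM mulrACA mulrC.
Qed.

Lemma row_clt_cf (M : R) (v : 'I_k -> R) c : 1 <= M -> (forall j, `|v j| <= M) ->
  `|\int[P n]_y cos (\sum_j v j * (rsum g y j 0 / row_sd j) + c) -
    expR (- (\sum_a \sum_b v a * v b * corr (rcov P g n) a b) / 2) * cos c| <=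
  (M * k.+1%:R) ^+ 4 * (4 * k%:R + k%:R ^+ 2) * e.
Proof.
move=> M1 vM; have := lindeberg_cf mX PQ x2 x0 x1 e0 e1 lindeberg M1 vM c.
under eq_Rintegral do under eq_bigr do rewrite std_sumE.
by under [in X in expR X]eq_bigr do under eq_bigr do rewrite array_covE.
Qed.

Lemma row_weak_law a b (t : R) : 0 < t ->
  pr (P n) [set y | t <= `|Smat g y a b / (row_sd a * row_sd b) -
    corr (rcov P g n) a b|] <= 5 * e / t.
Proof.
move=> t0; have := lindeberg_weak_law mX PQ x2 x1 e0 lindeberg a b t0.
rewrite array_covE (_ : [set y | _] = [set y | t <= `|Smat g y a b / (row_sd a * row_sd b) -
    corr (rcov P g n) a b|])//.
by apply/seteqP; split=> y /=; rewrite SmatE.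
Qed.

Lemma measurable_rsum j : measurable_fun setT (fun y : 'M[R]_(n, l) => rsum g y j 0).
Proof.
under eq_fun do rewrite rsumE; apply: measurable_sum => i.
exact: measurableT_comp.
Qed.

Lemma measurable_Smat a b : measurable_fun setT (fun y : 'M[R]_(n, l) => Smat g y a b).
Proof.
rewrite (_ : (fun y => _) = fun y => \sum_(i < n) G i a (X i y) * G i b (X i y)).
  by apply: measurable_sum => i; apply: measurable_funM; exact: measurableT_comp.
by apply/funext => y; rewrite /Smat summxE; apply: eq_bigr => i _;
  rewrite mxE big_ord1 mxE.
Qed.

(** Markov's inequality for the squares, each standardized sum having second moment 1, and a union
    bound. It controls the periodicity term of [box_comparison]. *)
Lemma row_tail (L : R) : 0 < L ->
  1 - k%:R / L ^+ 2 <= pr (P n) (box (fun j (y : 'M[R]_(n, l)) => rsum g y j 0 / row_sd j) L).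
Proof.
move=> L0; pose S j (y : 'M[R]_(n, l)) := rsum g y j 0 / row_sd j.
have mS j : measurable_fun setT (S j).
  by apply: measurable_funM => //; exact: measurable_rsum.
have L20 : 0 < L ^+ 2 by rewrite exprn_gt0.
have Sj j : pr (P n) [set y | L ^+ 2 <= `|S j y ^+ 2|] <= (L ^+ 2)^-1.
  have m2 := array_second_moment mX PQ x2 x0 x1 j.
  have [i2 _] := sum_mul_mean mX PQ (fun i => x2 i j) (fun i => x2 i j) (x0 ^~ j).
  have iS : (P n).-integrable setT (EFin \o (fun y => S j y ^+ 2)).
    rewrite (_ : (fun y => _) = fun y => (\sum_i x i j (X i y)) * (\sum_i x i j (X i y)))//.
    by apply/funext => y; rewrite std_sumE expr2.
  apply: le_trans (pr_markov L20 iS) _.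
  rewrite -[leRHS]mul1r ler_wpM2r ?invr_ge0 ?(ltW L20)// -m2.
  rewrite le_eqVlt; apply/orP; left; apply/eqP; apply: eq_Rintegral => y _.
  by rewrite std_sumE ger0_norm ?sqr_ge0.
have mF j : measurable [set y | L ^+ 2 <= `|S j y ^+ 2|].
  by apply: measurable_norm_ge; exact: measurable_funX.
have mB := measurable_box L mS.
have mU : measurable [set y | exists j, L ^+ 2 <= `|S j y ^+ 2|].
  rewrite (_ : [set _ | _] = \bigcup_(j in [set: 'I_k]) [set y | L ^+ 2 <= `|S j y ^+ 2|]).
    exact: fin_bigcup_measurable.
  by apply/seteqP; split=> y [j]; exists j.
have : pr (P n) (~` box S L) <= \sum_(j < k) (L ^+ 2)^-1.
  apply: le_trans (ler_sum _ (fun j _ => Sj j)); apply: le_trans (pr_bigcup _ mF).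
  apply: pr_mono => //; first exact: measurableC.
  move=> y /existsNP[j /negP]; rewrite -ltNge => Lj; exists j => /=.
  rewrite ger0_norm ?sqr_ge0// -(real_normK (num_real (S j y))) ler_sqr ?nnegrE//;
    exact: ltW.
rewrite pr_setC// sumr_const card_ord -mulr_natl; lra.
Qed.

End row_model.

(** * Events of vanishing probability *)

Section null_events.
Context {R : realType} {l : nat}.
Variable P : forall n, probability 'M[R]_(n, l) R.
Implicit Types A B : forall n, set 'M[R]_(n, l).

(* The axioms of a measure say nothing about nonmeasurable sets, so measurability
   is part of the notion. *)
Definition null_seq A := forall e : R, 0 < e ->
  \forall n \near \oo, measurable (A n) /\ pr (P n) (A n) <= e.

Lemma null_seq_sub A B : null_seq B ->
  (\forall n \near \oo, measurable (A n) /\ A n `<=` B n) -> null_seq A.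
Proof.
move=> nB AB e e0; near=> n.
have [mB PB] : measurable (B n) /\ pr (P n) (B n) <= e by near: n; exact: nB.
have [mA AsB] : measurable (A n) /\ A n `<=` B n by near: n.
by split=> //; apply: le_trans PB; exact: pr_mono.
Unshelve. all: by end_near. Qed.

Lemma null_seqU A B : null_seq A -> null_seq B -> null_seq (fun n => A n `|` B n).
Proof.
move=> nA nB e e0; have e2 : 0 < e / 2 by lra.
near=> n.
have [mB PB] : measurable (B n) /\ pr (P n) (B n) <= e / 2 by near: n; exact: nB.
have [mA PA] : measurable (A n) /\ pr (P n) (A n) <= e / 2 by near: n; exact: nA.
split; first exact: measurableU.
have := pr_union (P n) (measurableU _ _ mA mB) mA mB (@subset_refl _ _).
lra.
Unshelve. all: by end_near. Qed.

Lemma null_seq_exists k (A : 'I_k -> forall n, set 'M[R]_(n, l)) :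
  (forall j, null_seq (A j)) -> null_seq (fun n => [set y | exists j, A j n y]).
Proof.
move=> nA e e0; have e2 : 0 < e / k.+1%:R by rewrite divr_gt0.
have near_all : \forall n \near \oo, forall j,
    measurable (A j n) /\ pr (P n) (A j n) <= e / k.+1%:R.
  by apply: filter_forall => j; exact: nA.
near=> n.
have An : forall j, measurable (A j n) /\ pr (P n) (A j n) <= e / k.+1%:R by near: n.
split.
  rewrite (_ : [set _ | _] = \bigcup_(j in [set: 'I_k]) A j n).
    by apply: fin_bigcup_measurable => // j _; case: (An j).
  by apply/seteqP; split=> y [j]; exists j.
apply: le_trans (pr_bigcup _ (fun j => (An j).1)) _.
apply: le_trans (ler_sum _ (fun j _ => (An j).2)) _.
rewrite sumr_const card_ord -[_ *+ k]mulr_natr -mulrA ler_piMr ?(ltW e0)//.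
by rewrite ler_pdivrMl// mulr1 ler_nat.
Unshelve. all: by end_near. Qed.

Lemma null_seqP A : (\forall n \near \oo, measurable (A n)) ->
  null_seq A <-> P n (A n) @[n --> \oo] --> 0%E.
Proof.
move=> mA; split=> [nA|/fine_cvgP[_ /cvgrPdist_le cA] e e0].
  apply/fine_cvgP; split.
    by near=> n; rewrite pr_EFin//; near: n.
  apply/cvgrPdist_le => e e0; near=> n.
  rewrite sub0r normrN ger0_norm; last exact: pr_ge0.
  have : measurable (A n) /\ pr (P n) (A n) <= e by near: n; exact: nA.
  by case.
near=> n; split; first by near: n.
have : `|0 - pr (P n) (A n)| <= e by near: n; exact: cA.
by rewrite sub0r normrN ger0_norm//; exact: pr_ge0.
Unshelve. all: by end_near. Qed.

Lemma null_seqCP A : (\forall n \near \oo, measurable (A n)) ->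
  null_seq (fun n => ~` A n) <-> P n (A n) @[n --> \oo] --> 1%E.
Proof.
move=> mA; split=> [nA|/fine_cvgP[_ /cvgrPdist_le cA] e e0].
  apply/fine_cvgP; split.
    by near=> n; rewrite pr_EFin//; near: n.
  apply/cvgrPdist_le => e e0; near=> n.
  have mAn : measurable (A n) by near: n.
  have : measurable (~` A n) /\ pr (P n) (~` A n) <= e by near: n; exact: nA.
  case=> _; rewrite pr_setC// => h.
  by rewrite ger0_norm// subr_ge0; exact: pr_le1.
near=> n.
have mAn : measurable (A n) by near: n.
split; first exact: measurableC.
have : `|1 - pr (P n) (A n)| <= e by near: n; exact: cA.
by rewrite pr_setC// ger0_norm// subr_ge0; exact: pr_le1.
Unshelve. all: by end_near. Qed.

Variable wd : forall n, set 'M[R]_(n, l).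
Hypothesis mwd : \forall n \near \oo, measurable (@wd n).

Lemma asym_le1P (X : forall n, 'M[R]_(n, l) -> R) :
  (\forall n \near \oo, measurable_fun setT (X n)) ->
  asym_le1 P wd X <-> null_seq (fun n => ~` @wd n) /\
    forall e : R, 0 < e -> null_seq (fun n => @wd n `&` [set y | 1 + e <= X n y]).
Proof.
move=> mX; have mXe (e : R) :
    \forall n \near \oo, measurable (@wd n `&` [set y | 1 + e <= X n y]).
  near=> n; apply: measurableI; first by near: n.
  by apply: measurable_ge_set; near: n.
split=> -[h1 h2].
  by split=> [|e e0]; [exact/null_seqCP|apply/null_seqP => //; exact: h2].
by split=> [|e e0]; [exact/null_seqCP|apply/null_seqP => //; exact: h2].
Unshelve. all: by end_near. Qed.

(** The way to exchange S_n and V_n(r_n) in a ratio: off a null event the two ratios differ by a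
    factor close to 1. *)
Lemma asym_le1_trans (X Y : forall n, 'M[R]_(n, l) -> R) :
  (\forall n \near \oo, measurable_fun setT (X n)) ->
  (\forall n \near \oo, measurable_fun setT (Y n)) ->
  (forall e : R, 0 < e -> e <= 1 -> exists2 B, null_seq B &
    \forall n \near \oo, forall y, wd y -> ~ B n y -> Y n y <= (1 + e) * X n y) ->
  asym_le1 P wd X -> asym_le1 P wd Y.
Proof.
move=> mX mY XY /(asym_le1P mX)[h1 h2]; apply/(asym_le1P mY); split=> // e e0.
have [e' [e'0 e'1 ee]] : exists e' : R, [/\ 0 < e', e' <= 1 & (1 + e') ^+ 2 <= 1 + e].
  (* For t <= 1, (1 + t / 3)^2 = 1 + 2 t / 3 + t^2 / 9 <= 1 + t. *)
  exists (Num.min e 1 / 3).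
  have : 0 < Num.min e 1 by rewrite lt_min e0 ltr01.
  have : Num.min e 1 <= e by rewrite ge_min lexx.
  have : Num.min e 1 <= 1 by rewrite ge_min lexx orbT.
  move: (Num.min e 1) => t t1 te t0.
  by split; [lra|lra|rewrite expr2; nra].
have [B nB hB] := XY _ e'0 e'1.
apply: (null_seq_sub (null_seqU nB (h2 _ e'0))); near=> n; split.
  apply: measurableI; first by near: n.
  by apply: measurable_ge_set; near: n.
have hBn : forall y, wd y -> ~ B n y -> Y n y <= (1 + e') * X n y by near: n.
move=> y [wy /= Yy]; have [By|nBy] := pselect (B n y); [by left|right; split=> //=].
have := le_trans (le_trans ee Yy) (hBn _ wy nBy).
by rewrite expr2 ler_pM2l//; lra.
Unshelve. all: by end_near. Qed.

End null_events.

(** * Stability of correlation matrices and their quantiles *)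

Section correlation_perturbation.
Context {R : realType} {k : nat}.
Implicit Types A B V S : 'M[R]_k.

Lemma psd_entry_le A a b : psd A -> `|A a b| <= (A a a + A b b) / 2.
Proof.
move=> /psd_factor[B <-].
have E i j : (B *m B^T) i j = \sum_h B i h * B j h.
  by rewrite mxE; apply: eq_bigr => h _; rewrite mxE.
rewrite !E -big_split mulr_suml; apply: le_trans (ler_norm_sum _ _ _) _.
apply: ler_sum => h _; rewrite normrM.
have amgm (u v : R) : `|u| * `|v| <= (u * u + v * v) / 2.
  have := sqr_ge0 (`|u| - `|v|); rewrite -!expr2.
  have := real_normK (num_real u); have := real_normK (num_real v).
  by move=> <- <-; rewrite !expr2; lra.
exact: amgm.
Qed.

Lemma corr_le1 A a b : psd A -> `|corr A a b| <= 1.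
Proof.
move=> Ap; apply: le_trans (psd_entry_le a b (psd_corr Ap)) _.
rewrite !corr_diag//; case: (0 < A a a)%R; case: (0 < A b b)%R => /=; lra.
Qed.

(** The hypothesis normalizes [S] with the deviations [s] of [V], not with its own. Its diagonal
    case puts the squared ratios [r j ^+ 2] of the two scales within [e] of 1, and changing the
    scale costs at most another [e]. The factor [1 + 2 * e] comes from 1 <= (1 + 2 e)(1 - e) for e
    <= 1 / 2. *)
Lemma corr_perturbation V S (s : 'I_k -> R) (e : R) : 0 < e -> e <= 2^-1 ->
  psd V -> psd S -> (forall j, 0 < s j) -> (forall j, V j j = s j ^+ 2) ->
  (forall a b, `|S a b / (s a * s b) - corr V a b| < e) ->
  [/\ forall j, S j j <= (1 + e) * V j j, forall j, V j j <= (1 + 2 * e) * S j j,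
      forall j, 0 < S j j & forall a b, `|corr S a b - corr V a b| <= 2 * e].
Proof.
move=> e0 e12 Vp Sp s0 Vs SV.
have s20 j : 0 < s j ^+ 2 by rewrite exprn_gt0.
have SJ j : (1 - e) * s j ^+ 2 <= S j j <= (1 + e) * s j ^+ 2.
  have := SV j j; rewrite corr_diag// Vs s20/= -expr2 ltr_norml => /andP[h1 h2].
  have l1 : 1 - e <= S j j / s j ^+ 2 by lra.
  have l2 : S j j / s j ^+ 2 <= 1 + e by lra.
  by move: l1 l2; rewrite ler_pdivlMr// ler_pdivrMr// => -> ->.
split=> [j|j|j|a b].
- by rewrite Vs; case/andP: (SJ j).
- rewrite Vs; case/andP: (SJ j) => h _; have arith (x z : R) : 0 < x -> (1 - e) * x <= z -> x <= (1 + 2 * e) * z.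
    move=> x0 xz; have e2 : 0 < 1 + 2 * e by lra.
    have := xz; rewrite -(ler_pM2l e2).
    have := mulr_ge0 (ltW x0) (mulr_ge0 (ltW e0) (_ : 0 <= 1 - 2 * e)).
    by move=> /(_ ltac:(lra)); lra.
  exact: arith.
- case/andP: (SJ j) => h _; apply: lt_le_trans h; rewrite mulr_gt0//; lra.
pose r j := Num.sqrt (S j j) / s j.
have r2 j : 1 - e <= r j ^+ 2 <= 1 + e.
  rewrite /r exprMn exprVn sqr_sqrtr; last exact: psd_diag_ge0.
  by rewrite ler_pdivlMr// ler_pdivrMr.
have r0 j : 0 <= r j by rewrite divr_ge0 ?sqrtr_ge0 ?(ltW (s0 _)).
have rr : 1 - e <= r a * r b <= 1 + e.
  have e1 : 0 <= 1 - e by lra.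
  have e2 : 0 <= 1 + e by lra.
  have ab0 : 0 <= r a * r b by rewrite mulr_ge0.
  case/andP: (r2 a) (r2 b) => a1 a2 /andP[b1 b2].
  rewrite -[_ <= r a * r b]ler_sqr ?nnegrE// -[r a * r b <= _]ler_sqr ?nnegrE//.
  rewrite exprMn ![(_ + _) ^+ 2]expr2; apply/andP; split.
    by apply: ler_pM.
  by apply: ler_pM => //; exact: sqr_ge0.
have rab : 0 < r a * r b by case/andP: rr => h _; lra.
have E : corr S a b * (r a * r b) = S a b / (s a * s b).
  have ra0 : r a != 0 by apply: contraTneq rab => ->; rewrite mul0r ltxx.
  have rb0 : r b != 0 by apply: contraTneq rab => ->; rewrite mulr0 ltxx.
  have Sr j : Num.sqrt (S j j) = r j * s j by rewrite /r divfK// gt_eqF.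
  rewrite corrE; last by move=> j; exact: psd_diag_ge0.
  by rewrite !Sr; field; rewrite ra0 rb0 !gt_eqF.
(* The change of scale multiplies [corr S a b], at most 1 in absolute value, by [r a * r b]. *)
have h1 : `|corr S a b - S a b / (s a * s b)| <= e.
  rewrite -E -[X in X - _]mulr1 -mulrBr normrM -[leRHS]mul1r ler_pM//.
    exact: corr_le1.
  by rewrite ler_norml; case/andP: rr => ? ?; apply/andP; split; lra.
have := SV a b; move: (corr S a b) (corr V a b) (S a b / _) h1 => u v w.
rewrite ler_norml ltr_norml ler_norml => /andP[? ?] /andP[? ?].
by apply/andP; split; lra.
Qed.

Lemma corr_ratio_close (p e : R) : 0 < p < 1 -> 0 < e -> exists2 c, 0 < c &
  forall V S (s : 'I_k -> R), (0 < k)%N -> psd V -> psd S ->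
    (forall j, 0 < s j) -> (forall j, V j j = s j ^+ 2) ->
    (forall a b, `|S a b / (s a * s b) - corr V a b| < c) ->
    [/\ forall j, S j j <= (1 + e) * V j j, forall j, V j j <= (1 + e) * S j j,
        Kquantile p (corr S) <= (1 + e) * Kquantile p (corr V) &
        Kquantile p (corr V) <= (1 + e) * Kquantile p (corr S)].
Proof.
move=> p01 e0; have p0 : 0 < p by case/andP: p01.
(* Quantiles being at least [p / 2], this additive error amounts to at most the factor [1 + e]. *)
have t0 : 0 < e * (p / 2) by rewrite mulr_gt0// divr_gt0.
have [tau tau0 Htau] := @Kquantile_corr_uniform R k p _ p01 t0.
pose c := Num.min (2^-1) (Num.min (e / 2) (tau / 2)).
have c0 : 0 < c by rewrite !lt_min invr_gt0 ltr0n !divr_gt0.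
have c1 : c <= 2^-1 by rewrite ge_min lexx.
have c2 : c <= e / 2 by rewrite !ge_min lexx orbT.
have c3 : c <= tau / 2 by rewrite !ge_min lexx !orbT.
exists c => // V S s k0 Vp Sp s0 Vs SV.
have [S1 S2 S3 S4] := corr_perturbation c0 c1 Vp Sp s0 Vs SV.
have Vj : exists j, 0 < V j j.
  by exists (Ordinal k0); rewrite Vs exprn_gt0.
have Sj : exists j, 0 < S j j by exists (Ordinal k0).
have rel (x y : R) : p / 2 <= x -> y <= x + e * (p / 2) -> y <= (1 + e) * x.
  move=> px yx; apply: le_trans yx _; rewrite mulrDl mul1r lerD2l.
  by rewrite ler_pM2l.
have arith (x y : R) : `|x - y| <= 2 * c -> `|x - y| <= tau.
  by move=> h; apply: le_trans h _; lra.
have c4 : 1 + c <= 1 + e by lra.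
have c5 : 1 + 2 * c <= 1 + e by lra.
split.
- move=> j; apply: le_trans (S1 j) _; apply: ler_wpM2r c4; exact: psd_diag_ge0.
- move=> j; apply: le_trans (S2 j) _; apply: ler_wpM2r c5; exact: psd_diag_ge0.
- apply: (rel _ _ (Kquantile_corr_ge p01 Vp Vj)).
  by apply: (Htau _ _ Vp Sp Vj Sj) => a b; rewrite distrC; exact: (arith _ _ (S4 a b)).
- apply: (rel _ _ (Kquantile_corr_ge p01 Sp Sj)).
  by apply: (Htau _ _ Sp Vp Sj Vj) => a b; exact: (arith _ _ (S4 a b)).
Qed.

Lemma sqrt_ratio_le (a b c e : R) : 0 <= e -> 0 <= c -> 0 <= b ->
  a <= (1 + e) * b -> Num.sqrt (a / c) <= (1 + e) * Num.sqrt (b / c).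
Proof.
move=> e0 c0 b0 ab; have e1 : 0 <= 1 + e by lra.
have ci : 0 <= c^-1 by rewrite invr_ge0.
have eE : 1 + e = Num.sqrt ((1 + e) ^+ 2) by rewrite sqrtr_sqr ger0_norm.
rewrite [in leRHS]eE.
rewrite -sqrtrM ?sqr_ge0//.
apply: ler_wsqrtr; rewrite mulrA; apply: ler_wpM2r => //.
by apply: le_trans ab _; apply: ler_wpM2r => //; rewrite expr2; nra.
Qed.

End correlation_perturbation.

Lemma measurable_fun_bigmax d (T : measurableType d) (R : realType) k
    (F : 'I_k -> T -> R) : (forall j, measurable_fun setT (F j)) ->
  measurable_fun setT (fun y => \big[Num.max/0]_(j < k) F j y).
Proof.
move=> mF; elim: (index_enum _) => [|j s ih].
  by under eq_fun do rewrite big_nil; exact: measurable_cst.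
by under eq_fun do rewrite big_cons; exact: measurable_maxr.
Qed.

Lemma psd_Smat (R : realType) l k (g : forall n, 'I_n -> 'rV[R]_l -> 'cV[R]_k)
    n (y : 'M[R]_(n, l)) : psd (Smat g y).
Proof.
split=> [|x].
  rewrite /Smat raddf_sum/=; apply: eq_bigr => i _.
  by rewrite trmx_mul trmxK.
rewrite /Smat mulmx_sumr mulmx_suml summxE; apply: sumr_ge0 => i _.
rewrite mulmxA -mulmxA -[x^T *m _]trmxK trmx_mul trmxK.
by rewrite mxE big_ord1 mxE -expr2 sqr_ge0.
Qed.

(** * The conditions on kappa *)

Section kappa_facts.
Context {R : realType} {l k : nat}.
Variable P : forall n, probability 'M[R]_(n, l) R.
Variable nu2 : forall n, 'I_k -> 'M[R]_(n, l) -> R.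
Variable Khat : forall n, 'M[R]_(n, l) -> R.
Variable alpha : R.
Hypothesis alpha01 : 0 < alpha < 1.
Hypothesis hnu2 : forall n, (0 < n)%N -> forall j,
  measurable_fun [set: 'M[R]_(n, l)] (@nu2 n j) /\ forall y, 0 <= @nu2 n j y.
Hypothesis hKhat : forall n, (0 < n)%N ->
  measurable_fun [set: 'M[R]_(n, l)] (@Khat n) /\ forall y, 0 <= @Khat n y.

Let p01 : 0 < 1 - alpha < 1.
Proof. by have /andP[a0 a1] := alpha01; apply/andP; split; lra. Qed.

Lemma measurable_gt0_set n (X : 'M[R]_(n, l) -> R) :
  measurable_fun setT X -> measurable [set y | 0 < X y].
Proof.
move=> mX; rewrite -[X in measurable X]setTI.
rewrite (_ : [set y | _] = X @^-1` `]0, +oo[); first exact: mX.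
by apply/seteqP; split=> y /=; rewrite in_itv/= andbT.
Qed.

Lemma measurable_marginal_wd j :
  \forall n \near \oo, measurable [set y : 'M[R]_(n, l) | 0 < nu2 j y].
Proof.
near=> n; have n0 : (0 < n)%N by near: n; exact: nbhs_infty_gt.
by apply: measurable_gt0_set; case: (hnu2 n0 j).
Unshelve. all: by end_near. Qed.

Lemma measurable_kappa_wd : \forall n \near \oo, measurable (kappa_wd nu2 Khat (n := n)).
Proof.
near=> n; have n0 : (0 < n)%N by near: n; exact: nbhs_infty_gt.
rewrite (_ : kappa_wd nu2 Khat (n := n) = [set y | 0 < Khat y] `&`
    [set y | forall j, [set y' | 0 < nu2 j y'] y]).
  apply: measurableI.
    by apply: measurable_gt0_set; case: (hKhat n0).
  apply: measurable_forall_ord => j.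
  by apply: measurable_gt0_set; case: (hnu2 n0 j).
by apply/seteqP; split=> y [].
Unshelve. all: by end_near. Qed.

Lemma measurable_ratio n (A : 'M[R]_(n, l) -> R) j : (0 < n)%N ->
  measurable_fun setT A -> measurable_fun setT (fun y => Num.sqrt (A y / nu2 j y)).
Proof.
move=> n0 mA; apply: measurable_fun_sqrt; apply: measurable_funM => //.
by apply: measurable_fun_invr; case: (hnu2 n0 j).
Qed.

Lemma measurable_kappa (A : forall n, 'M[R]_(n, l) -> 'M[R]_k) n : (0 < n)%N ->
  (forall y : 'M[R]_(n, l), psd (A n y)) ->
  (forall i j, measurable_fun [set: 'M[R]_(n, l)] (fun y => A n y i j)) ->
  measurable_fun [set: 'M[R]_(n, l)] (kappa nu2 Khat alpha A (n := n)).
Proof.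
move=> n0 Ap mA; apply: measurable_funM.
  apply: measurable_funM; first exact: measurable_Kquantile_corr.
  by apply: measurable_fun_invr; case: (hKhat n0).
by apply: measurable_fun_bigmax => j; exact: measurable_ratio.
Qed.

(** Quantile and maximum each contribute a factor [1 + e / 3], and (1 + e / 3)^2 <= 1 + e for
    [e <= 1]. *)
Lemma kappa_le (A B : forall n, 'M[R]_(n, l) -> 'M[R]_k) n (y : 'M[R]_(n, l)) (e : R) :
  (0 < k)%N -> 0 < e -> e <= 1 -> psd (B n y) -> (forall j, 0 < B n y j j) -> kappa_wd nu2 Khat y ->
  (forall j, A n y j j <= (1 + e / 3) * B n y j j) ->
  Kquantile (1 - alpha) (corr (A n y)) <=
    (1 + e / 3) * Kquantile (1 - alpha) (corr (B n y)) ->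
  kappa nu2 Khat alpha A y <= (1 + e) * kappa nu2 Khat alpha B y.
Proof.
move=> k0 e0 e1 Bp Bj [Kh0 nu0] AB.
have e3 : 0 <= e / 3 by lra.
have e13 : 0 <= 1 + e / 3 by lra.
have e13' : 0 < 1 + e / 3 by lra.
have KB : 0 <= Kquantile (1 - alpha) (corr (B n y)).
  apply: le_trans (Kquantile_corr_ge p01 Bp _); last by exists (Ordinal k0).
  by apply: divr_ge0 => //; have /andP[/ltW] := p01.
rewrite /kappa; move: KB; move: (Kquantile _ _) (Kquantile _ _) => a b b0 ab.
have mm : \big[Num.max/0]_(j < k) Num.sqrt (A n y j j / nu2 j y) <=
    (1 + e / 3) * \big[Num.max/0]_(j < k) Num.sqrt (B n y j j / nu2 j y).
  apply: bigmax_le => [|j _]; first by apply: mulr_ge0 => //; exact: bigmax_ge_id.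
  apply: le_trans (sqrt_ratio_le e3 (ltW (nu0 j)) (ltW (Bj j)) (AB j)) _.
  apply: (ler_wpM2l e13).
  exact: (le_bigmax 0 (fun j => Num.sqrt (B n y j j / nu2 j y))).
have M0 : 0 <= \big[Num.max/0]_(j < k) Num.sqrt (A n y j j / nu2 j y).
  exact: bigmax_ge_id.
move: (\big[_/_]_(_ < _) _) (\big[_/_]_(_ < _) _) mm M0 => u v vu v0.
have i0 : 0 < (Khat y)^-1 by rewrite invr_gt0.
have h1 : a / Khat y <= (1 + e / 3) * b / Khat y by rewrite ler_pM2r.
have h0 : 0 <= (1 + e / 3) * b / Khat y by apply: mulr_ge0 (ltW i0); exact: mulr_ge0.
have u0 : 0 <= u by rewrite -(pmulr_rge0 _ e13'); apply: le_trans vu.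
have : a / Khat y * v <= (1 + e / 3) * b / Khat y * ((1 + e / 3) * u).
  by apply: le_trans (ler_wpM2r v0 h1) _; exact: ler_wpM2l.
move/le_trans; apply.
have -> : (1 + e / 3) * b / Khat y * ((1 + e / 3) * u) =
  (1 + e / 3) ^+ 2 * (b / Khat y * u) by ring.
apply: ler_wpM2r; first by apply: mulr_ge0 u0; exact: mulr_ge0 (ltW i0).
have : e * e <= e * 1 by rewrite ler_pM2l.
rewrite expr2; lra.
Qed.

Section moment_conditions.
Variable Pm : forall n, 'I_n -> probability 'rV[R]_l R.
Variable g : forall n, 'I_n -> 'rV[R]_l -> 'cV[R]_k.
Hypothesis k0 : (0 < k)%N.
Hypothesis hP : forall n, (0 < n)%N -> product_law P Pm n.
Hypothesis mg : forall n, (0 < n)%N -> forall i : 'I_n,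
  measurable_fun [set: 'rV[R]_l] (g i).
Hypothesis hmom : forall n, (0 < n)%N -> forall j : 'I_k,
  (forall i : 'I_n, 'E_(Pm i)[(fun x => g i x j 0)%R]%E = 0%E) /\
  (0 < rvar P g n j < +oo)%E.
Hypothesis hlind : forall (j : 'I_k) (eps : R), 0 < eps ->
  ((fine (rvar P g n j))^-1%:E * \sum_(i < n)
    \int[Pm i]_(x in [set x | (eps * Num.sqrt (fine (rvar P g n j))
                                 <= `|g i x j 0|)%R])
      ((g i x j 0) ^+ 2)%:E)%E @[n --> \oo] --> 0%E.

Lemma near_lindeberg (e : R) : 0 < e -> \forall n \near \oo, forall j : 'I_k,
  ((fine (rvar P g n j))^-1%:E * \sum_(i < n)
     \int[@Pm n i]_(x in [set x | (e * Num.sqrt (fine (rvar P g n j))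
                                  <= `|@g n i x j 0|)%R])
       ((@g n i x j 0) ^+ 2)%:E <= e%:E)%E.
Proof.
move=> e0; apply: filter_forall => j.
have /fine_cvgP[fL /cvgrPdist_le L] := hlind j e0.
near=> n.
have fLn : ((fine (rvar P g n j))^-1%:E * \sum_(i < n)
     \int[@Pm n i]_(x in [set x | (e * Num.sqrt (fine (rvar P g n j))
                                  <= `|@g n i x j 0|)%R])
       ((@g n i x j 0) ^+ 2)%:E)%E \is a fin_num by near: n.
rewrite -(fineK fLn) lee_fin; apply: le_trans (ler_norm _) _.
rewrite -normrN -sub0r; near: n; exact: L.
Unshelve. all: by end_near. Qed.

Let V n (_ : 'M[R]_(n, l)) := rcov P g n.
Let S n := @Smat R l k g n.
Let sd n := row_sd P g (n := n).
Let Z n j (y : 'M[R]_(n, l)) := rsum g y j 0 / sd n j.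
Let gmean n (n0 : (0 < n)%N) j i := (hmom n0 j).1 i.
Let gvar n (n0 : (0 < n)%N) j := (hmom n0 j).2.
Let Kq (A : 'M[R]_k) := Kquantile (1 - alpha) (corr A).

Let ratio_close e n (y : 'M[R]_(n, l)) :=
  [/\ forall j, S y j j <= (1 + e) * V y j j,
      forall j, V y j j <= (1 + e) * S y j j,
      Kq (S y) <= (1 + e) * Kq (V y) & Kq (V y) <= (1 + e) * Kq (S y)].

Let near_psd_rcov : \forall n \near \oo, psd (rcov P g n).
Proof.
near=> n; have n0 : (0 < n)%N by near: n; exact: nbhs_infty_gt.
apply: (psd_rcov (hP n0) (mg n0) (gmean n0) (gvar n0) ltr01).
by near: n; exact: near_lindeberg ltr01.
Unshelve. all: by end_near. Qed.

Lemma Smat_rcov_close (e : R) : 0 < e -> exists2 B, null_seq P B &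
  \forall n \near \oo, forall y, ~ B n y -> ratio_close e y.
Proof.
move=> e0; have [c c0 Hc] := @corr_ratio_close R k _ _ p01 e0.
pose D (a b : 'I_k) n (y : 'M[R]_(n, l)) :=
  c <= `|Smat g y a b / (sd n a * sd n b) - corr (rcov P g n) a b|.
exists (fun n => [set y | exists a, [set y' | exists b, D a b n y'] y]).
  apply: null_seq_exists => a; apply: null_seq_exists => b d d0.
  (* With Lindeberg bound [d'] and threshold [c], the weak law gives the probability [5 * d' / c],
     at most [d]. *)
  pose d' := Num.min 1 (d * c / 5).
  have d'0 : 0 < d' by rewrite lt_min ltr01 divr_gt0// mulr_gt0.
  have near_d := near_lindeberg d'0.
  near=> n; have n0 : (0 < n)%N by near: n; exact: nbhs_infty_gt.
  split.
    apply: measurable_ge_set; apply: measurableT_comp => //.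
    apply: measurable_funB => //; apply: measurable_funM => //.
    exact: (measurable_Smat (mg n0)).
  apply: le_trans (row_weak_law (hP n0) (mg n0) (gmean n0) (gvar n0) d'0 _ a b c0) _; first by near: n.
  rewrite ler_pdivrMr//.
  have : d' <= d * c / 5 by rewrite ge_min lexx orbT.
  lra.
near=> n; have n0 : (0 < n)%N by near: n; exact: nbhs_infty_gt.
have Vp : psd (rcov P g n) by near: n.
move=> y nB; apply: (Hc _ _ (sd n) k0 Vp (psd_Smat g y)).
- by move=> j; exact: (row_sd_gt0 (gvar n0)).
- by move=> j; exact: (rcov_diag (gvar n0)).
- move=> a b; rewrite ltNge; apply/negP => h; apply: nB.
  by exists a; exists b.
Unshelve. all: by end_near. Qed.

Let mV : \forall n \near \oo, measurable_fun setT (kappa nu2 Khat alpha V (n := n)).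
Proof.
near=> n; have n0 : (0 < n)%N by near: n; exact: nbhs_infty_gt.
apply: measurable_kappa => // y; rewrite /V.
by near: n; exact: near_psd_rcov.
Unshelve. all: by end_near. Qed.

Let mS : \forall n \near \oo, measurable_fun setT (kappa nu2 Khat alpha S (n := n)).
Proof.
near=> n; have n0 : (0 < n)%N by near: n; exact: nbhs_infty_gt.
apply: measurable_kappa => // [y|i j]; first exact: psd_Smat.
exact: (measurable_Smat (mg n0)).
Unshelve. all: by end_near. Qed.

Let rcov_gt0 n j : (0 < n)%N -> 0 < rcov P g n j j.
Proof.
move=> n0; rewrite (rcov_diag (gvar n0)) exprn_gt0//.
exact: (row_sd_gt0 (gvar n0)).
Qed.

Let Smat_gt0 n (y : 'M[R]_(n, l)) e j : (0 < n)%N -> 0 < e ->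
  rcov P g n j j <= (1 + e) * Smat g y j j -> 0 < Smat g y j j.
Proof.
move=> n0 e0 h; have e1 : 0 < 1 + e :> R by lra.
by rewrite -(pmulr_rgt0 _ e1); apply: lt_le_trans h; exact: rcov_gt0.
Qed.

Lemma kappa_condition_equiv :
  kappa_condition P nu2 Khat alpha V <-> kappa_condition P nu2 Khat alpha S.
Proof.
split; apply: asym_le1_trans => //; try exact: measurable_kappa_wd;
  move=> e e0 e1; have e3 : 0 < e / 3 by lra.
- have [B nB hB] := Smat_rcov_close e3; exists B => //; near=> n.
  have n0 : (0 < n)%N by near: n; exact: nbhs_infty_gt.
  have hBn : forall y, ~ B n y -> ratio_close (e / 3) y by near: n.
  have Vp : psd (rcov P g n) by near: n; exact: near_psd_rcov.
  move=> y wy /hBn[h1 _ h3 _]; apply: kappa_le => // j.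
  exact: rcov_gt0.
- have [B nB hB] := Smat_rcov_close e3; exists B => //; near=> n.
  have n0 : (0 < n)%N by near: n; exact: nbhs_infty_gt.
  have hBn : forall y, ~ B n y -> ratio_close (e / 3) y by near: n.
  move=> y wy /hBn[_ h2 _ h4]; apply: kappa_le => //; first exact: psd_Smat.
  by move=> j; exact: (Smat_gt0 n0 e3 (h2 j)).
Unshelve. all: by end_near. Qed.

Lemma marginal_condition_equiv :
  marginal_condition P nu2 S <-> marginal_condition P nu2 V.
Proof.
have mVj j : \forall n \near \oo,
    measurable_fun setT (fun y : 'M[R]_(n, l) => Num.sqrt (V y j j / nu2 j y)).
  near=> n; have n0 : (0 < n)%N by near: n; exact: nbhs_infty_gt.
  by apply: measurable_ratio => //; exact: measurable_cst.
have mSj j : \forall n \near \oo,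
    measurable_fun setT (fun y : 'M[R]_(n, l) => Num.sqrt (S y j j / nu2 j y)).
  near=> n; have n0 : (0 < n)%N by near: n; exact: nbhs_infty_gt.
  by apply: measurable_ratio => //; exact: (measurable_Smat (mg n0)).
split=> h j; apply: (asym_le1_trans (measurable_marginal_wd j)) (h j) => // e e0 e1;
  have [B nB hB] := Smat_rcov_close e0; exists B => //; near=> n;
  have n0 : (0 < n)%N by [near: n; exact: nbhs_infty_gt];
  have hBn : forall y, ~ B n y -> ratio_close e y by [near: n];
  move=> y nu0 /hBn[h1 h2 _ _]; apply: (sqrt_ratio_le (ltW e0) (ltW nu0)) => //.
  exact: (ltW (Smat_gt0 n0 e0 (h2 j))).
exact: (ltW (rcov_gt0 j n0)).
Unshelve. all: by end_near. Qed.

(** The quantile ratio is at most 1, so [kappa >= 1 + e] forces one of the [k] ratios to be at least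
    [1 + e]. Positivity of the true quantile makes [Khat] positive, so kappa is well defined
    wherever all [nu2 j] are positive. *)
Lemma kappa_condition_of_marginal :
  (\forall n \near \oo, forall y : 'M[R]_(n, l),
     Kquantile (1 - alpha) (corr (rcov P g n)) <= Khat y) ->
  marginal_condition P nu2 S -> kappa_condition P nu2 Khat alpha V.
Proof.
move=> KV /marginal_condition_equiv mc; apply/asym_le1P.
- exact: measurable_kappa_wd.
- exact: mV.
have mVj j : \forall n \near \oo,
    measurable_fun setT (fun y : 'M[R]_(n, l) => Num.sqrt (V y j j / nu2 j y)).
  near=> n; have n0 : (0 < n)%N by near: n; exact: nbhs_infty_gt.
  by apply: measurable_ratio => //; exact: measurable_cst.
have h1 j := ((asym_le1P P (measurable_marginal_wd j) (mVj j)).1 (mc j)).1.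
have h2 j := ((asym_le1P P (measurable_marginal_wd j) (mVj j)).1 (mc j)).2.
have mwd := measurable_kappa_wd.
have K0 : \forall n \near \oo, forall y : 'M[R]_(n, l),
    0 < Kquantile (1 - alpha) (corr (rcov P g n)) <= Khat y.
  near=> n; have n0 : (0 < n)%N by near: n; exact: nbhs_infty_gt.
  have KVn : forall y : 'M[R]_(n, l),
    Kquantile (1 - alpha) (corr (rcov P g n)) <= Khat y by near: n.
  have Vp : psd (rcov P g n) by near: n; exact: near_psd_rcov.
  move=> y; rewrite KVn andbT.
  apply: lt_le_trans (Kquantile_corr_ge p01 Vp _); last first.
    by exists (Ordinal k0); exact: rcov_gt0.
  by apply: divr_gt0 => //; have /andP[] := p01.
split=> [|e e0].
  apply: (null_seq_sub (null_seq_exists h1)); near=> n; split.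
    by apply: measurableC; near: n.
  have KVn : forall y : 'M[R]_(n, l),
    0 < Kquantile (1 - alpha) (corr (rcov P g n)) <= Khat y by near: n.
  move=> y nwd; apply: contrapT => nu0; apply: nwd; split.
    by have /andP[a b] := KVn y; exact: lt_le_trans a b.
  by move=> j; apply: contrapT => nj; apply: nu0; exists j.
apply: (null_seq_sub (null_seq_exists (fun j => h2 j e e0))); near=> n; split.
  apply: measurableI; first by near: n.
  by apply: measurable_ge_set; near: n; exact: mV.
have KVn : forall y : 'M[R]_(n, l),
  0 < Kquantile (1 - alpha) (corr (rcov P g n)) <= Khat y by near: n.
move=> y [[Kh0 nu0] /=]; have := KVn y; rewrite /kappa /V.
move: (Kquantile _ _) => K /andP[K00 KKh] h.
have e1 : 0 < 1 + e by apply: addr_gt0.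
apply: contrapT => nj.
have mx : \big[Num.max/0]_(j < k) Num.sqrt (rcov P g n j j / nu2 j y) < 1 + e.
  elim/big_ind : _ => // [u v u1 v1|j _]; first by rewrite gt_max u1 v1.
  by rewrite ltNge; apply/negP => hj; apply: nj; exists j.
have M0 : 0 <= \big[Num.max/0]_(j < k) Num.sqrt (rcov P g n j j / nu2 j y).
  exact: bigmax_ge_id.
have : K / Khat y * \big[Num.max/0]_(j < k) Num.sqrt (rcov P g n j j / nu2 j y) < 1 + e.
  apply: le_lt_trans mx; rewrite ler_piMl// ler_pdivrMr// mul1r; exact: KKh.
by rewrite ltNge h.
Unshelve. all: by end_near. Qed.

(** * Simultaneous coverage of all coordinates *)

Variable Delta : forall n, 'M[R]_(n, l) -> 'cV[R]_k.
Hypothesis mDelta : forall n, (0 < n)%N ->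
  measurable_fun [set: 'M[R]_(n, l)] (@Delta n).
Hypothesis hDelta : forall (j : 'I_k) (eps : R), 0 < eps ->
  P n [set y | eps <= `|(Num.sqrt (fine (rvar P g n j)))^-1 * Delta y j 0|]
    @[n --> \oo] --> 0%E.

Let Kn n := Kquantile (1 - alpha) (corr (rcov P g n)).

Lemma near_cf_close (M e : R) : 0 < e -> \forall n \near \oo,
  forall B : 'M[R]_k, B *m B^T = corr (rcov P g n) ->
  cf_close M e (iid_normal k) (lin_coord B)
    (P n) (Z (n := n)).
Proof.
move=> e0; pose M' := Num.max 1 M.
have M1 : 1 <= M' by rewrite le_max lexx.
pose c : R := (M' * k.+1%:R) ^+ 4 * (4 * k%:R + k%:R ^+ 2).
have c0 : 0 <= c.
  rewrite mulr_ge0// ?exprn_ge0 ?addr_ge0 ?mulr_ge0 ?exprn_ge0//.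
  exact: le_trans ler01 M1.
pose d := Num.min 1 (e / (c + 1)).
have c1 : 0 < c + 1 by lra.
have d0 : 0 < d by rewrite lt_min ltr01 divr_gt0.
have d1 : d <= 1 by rewrite ge_min lexx.
have cd : c * d <= e.
  have : (c + 1) * d <= e.
    by rewrite mulrC -ler_pdivlMr// ge_min lexx orbT.
  by apply: le_trans; rewrite mulrDl mul1r lerDl ltW.
near=> n; have n0 : (0 < n)%N by near: n; exact: nbhs_infty_gt.
have hl : forall j : 'I_k, ((fine (rvar P g n j))^-1%:E * \sum_(i < n)
     \int[@Pm n i]_(x in [set x | (d * Num.sqrt (fine (rvar P g n j))
                                  <= `|@g n i x j 0|)%R])
       ((@g n i x j 0) ^+ 2)%:E <= d%:E)%E by near: n; exact: near_lindeberg d0.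
move=> B BV u c' uM; rewrite lin_coord_cos BV distrC.
apply: le_trans cd; apply: (row_clt_cf (hP n0) (mg n0) (gmean n0) (gvar n0) d0 d1 hl c' M1).
by move=> j; rewrite le_max uM orbT.
Unshelve. all: by end_near. Qed.

(* The joint law of the standardized sums is compared with N(0, corr V) on boxes,
   shrinking the quantile K by c to make room for the remainder Delta. *)
Lemma near_box_ge (d : R) : 0 < d -> exists2 c0 : R, 0 < c0 &
  forall c : R, 0 < c -> c <= c0 -> \forall n \near \oo,
  1 - alpha - d <= pr (P n)
    (box (Z (n := n)) (Kn n - c)).
Proof.
move=> d0; have [T0 [T00 HT]] := @KquantileP R k _ p01.
have p0 : 0 < 1 - alpha by case/andP: p01.
have k1 : 0 < 4 * k.+1%:R :> R by rewrite mulr_gt0// ltr0n.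
(* The first bound keeps [Kn n - 2 * c] nonnegative, as the quantile is at least [(1 - alpha) / 2].
   The second limits the Gaussian mass lost between the radii [Kn n - 2 * c] and [Kn n], at most
   [4 * k * c], to [d / 2]. *)
exists (Num.min ((1 - alpha) / 4) (d / 2 / (4 * k.+1%:R))).
  by rewrite lt_min !divr_gt0.
move=> c c0; rewrite le_min => /andP[c1 c2].
have [L [L0 L1 L2]] : exists L : R, [/\ 0 < L, T0 + c <= L & k%:R / L ^+ 2 <= d / 4].
  (* Here L >= 1 and L >= 4 k / d, so L^2 >= L >= 4 k / d. *)
  exists (T0 + c + 1 + k%:R * 4 / d).
  have kd : 0 <= k%:R * 4 / d by rewrite !mulr_ge0// invr_ge0 ltW.
  split; [lra|lra|].
  have L1 : 1 <= T0 + c + 1 + k%:R * 4 / d by lra.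
  have L2 : 0 < T0 + c + 1 + k%:R * 4 / d by lra.
  rewrite ler_pdivrMr ?exprn_gt0//.
  apply: (@le_trans _ _ (d / 4 * (T0 + c + 1 + k%:R * 4 / d))); last first.
    rewrite ler_wpM2l ?divr_ge0// ?(ltW d0)// expr2 -[leLHS]mulr1 ler_pM2l//.
  have -> : d / 4 * (T0 + c + 1 + k%:R * 4 / d) = d / 4 * (T0 + c + 1) + k%:R.
    by field; rewrite gt_eqF.
  by rewrite lerDr mulr_ge0//; lra.
have d4 : 0 < d / 4 by lra.
have [M [eta [M0 eta0 Hcmp]]] := @box_comparison R k T0 c (d / 4) L c0 d4 L1.
near=> n; have n0 : (0 < n)%N by near: n; exact: nbhs_infty_gt.
have Vp : psd (rcov P g n) by near: n; exact: near_psd_rcov.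
have Vj : exists j, 0 < rcov P g n j j by exists (Ordinal k0); exact: rcov_gt0.
have [A [Au AV]] := corr_unit_diag Vp Vj.
have [B [BA]] := HT A Au; rewrite AV -/(Kn n) => /andP[K1 K2] K3 _.
have Bu : unit_diag B by rewrite /unit_diag BA.
have BV : B *m B^T = corr (rcov P g n) by rewrite BA.
have Kc0 : 0 <= Kn n - 2 * c by apply: (@le_trans _ _ ((1 - alpha) / 2 - 2 * c)); lra.
have c4 : 4 * k%:R * c <= d / 2.
  apply: (@le_trans _ _ (4 * k.+1%:R * c)).
    by rewrite ler_pM2r// ler_pM2l// ler_nat.
  by rewrite mulrC -ler_pdivlMr.
have hcf : cf_close M eta (iid_normal k) (lin_coord B)
    (P n) (Z (n := n)).
  by move: (B) BV; near: n; exact: near_cf_close.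
have mZ j : measurable_fun [set: 'M[R]_(n, l)] (Z j).
  by apply: measurable_funM => //; exact: (measurable_rsum (mg n0)).
have Kt : 0 <= Kn n - 2 * c <= T0.
  by rewrite Kc0/=; apply: le_trans K2; rewrite gerBl; lra.
(* The Gaussian law comes first, since a lower bound for the data is wanted: its box of radius
   [Kn n - 2 * c] is enlarged by [c]. *)
have := Hcmp _ _ (iid_normal k) _ _ _ (P n) _ (measurable_lin_coord B) mZ hcf _ Kt.
rewrite (_ : Kn n - 2 * c + c = Kn n - c); last by lra.
have tl : 1 - k%:R / L ^+ 2 <= pr (P n) (box (Z (n := n)) L).
  apply: (row_tail (hP n0) (mg n0) (gmean n0) (gvar n0) ltr01 _ L0).
  by near: n; exact: near_lindeberg ltr01.
have c20 : 0 <= 2 * c by lra.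
have := box_prob_cts Bu Kc0 c20; rewrite subrK.
rewrite -/(box_prob B (Kn n - 2 * c)).
move: (box_prob B (Kn n)) (box_prob B (Kn n - 2 * c)) (pr _ _) (pr _ _) K3 tl.
move=> b1 b2 q1 q2 K3 tl h1 h2.
have : 2 * k%:R * (2 * c) = 4 * k%:R * c by ring.
lra.
Unshelve. all: by end_near. Qed.

Lemma near_coverage (d : R) : 0 < d -> kappa_condition P nu2 Khat alpha V ->
  \forall n \near \oo,
    let E := [set y : 'M[R]_(n, l) | forall j,
      `|(rsum g y + Delta y) j 0| <= Num.sqrt (nu2 j y) * Khat y] in
    measurable E /\ 1 - alpha - d <= pr (P n) E.
Proof.
move=> d0 /(asym_le1P P measurable_kappa_wd mV)[wd0 kap0].
have [T0 [T00 HT]] := @KquantileP R k _ p01.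
have p0 : 0 < 1 - alpha by case/andP: p01.
have d2 : 0 < d / 2 by lra.
(* The box takes [d / 2], and each of three exceptional events [d / 6]: kappa undefined, kappa at
   least [1 + e], a large remainder [Delta]. *)
have d6 : 0 < d / 6 by lra.
have [c0 c00 Hc] := near_box_ge d2.
(* With [c0 = (T0 + 1) * e], adding the remainder [e] to the radius [K - c0] leaves [K - T0 * e]. As
   [K <= T0], multiplication by [1 + e] stays below [K], which absorbs the error factor of kappa. *)
pose e := c0 / (T0 + 1).
have T1 : 0 < T0 + 1 by lra.
have e0 : 0 < e by rewrite divr_gt0.
have c0E : c0 = (T0 + 1) * e by rewrite /e mulrC divfK// gt_eqF.
have box0 := Hc c0 c00 (lexx _).
pose D j n := [set y : 'M[R]_(n, l) |
  e <= `|(Num.sqrt (fine (rvar P g n j)))^-1 * Delta y j 0|].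
have D0 j : null_seq P (D j).
  apply/null_seqP; last exact: hDelta.
  near=> n; have n0 : (0 < n)%N by near: n; exact: nbhs_infty_gt.
  apply: measurable_ge_set; apply: measurableT_comp => //.
  apply: measurable_funM => //.
  exact: (measurableT_comp (measurable_entry j 0) (mDelta n0)).
have D1 := null_seq_exists D0.
near=> n; have n0 : (0 < n)%N by near: n; exact: nbhs_infty_gt.
pose E := [set y : 'M[R]_(n, l) | forall j,
      `|(rsum g y + Delta y) j 0| <= Num.sqrt (nu2 j y) * Khat y].
have mE : measurable E.
  apply: (@measurable_forall_ord _ _ _ (fun j => [set y : 'M[R]_(n, l) |
      `|(rsum g y + Delta y) j 0| <= Num.sqrt (nu2 j y) * Khat y])) => j.
  have mh : measurable_fun setT (fun y : 'M[R]_(n, l) =>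
      Num.sqrt (nu2 j y) * Khat y - `|(rsum g y + Delta y) j 0|).
    apply: measurable_funB.
      apply: measurable_funM; last by case: (hKhat n0).
      by apply: measurable_fun_sqrt; case: (hnu2 n0 j).
    apply: measurableT_comp => //; under eq_fun do rewrite mxE.
    apply: measurable_funD; first exact: (measurable_rsum (mg n0)).
    exact: (measurableT_comp (measurable_entry j 0) (mDelta n0)).
  have := measurable_ge_set 0 mh.
  rewrite (_ : [set y | 0 <= _] = [set y : 'M[R]_(n, l) |
      `|(rsum g y + Delta y) j 0| <= Num.sqrt (nu2 j y) * Khat y])//.
  by apply/seteqP; split=> y /=; rewrite subr_ge0.
split=> //; rewrite -/E.
have [m1 q1] : measurable (~` kappa_wd nu2 Khat (n := n)) /\
    pr (P n) (~` kappa_wd nu2 Khat (n := n)) <= d / 6.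
  by near: n; exact: wd0.
have [m2 q2] : measurable (kappa_wd nu2 Khat (n := n) `&`
      [set y | 1 + e <= kappa nu2 Khat alpha V y]) /\
    pr (P n) (kappa_wd nu2 Khat (n := n) `&`
      [set y | 1 + e <= kappa nu2 Khat alpha V y]) <= d / 6.
  by near: n; exact: kap0.
have [m3 q3] : measurable [set y | exists j, D j n y] /\
    pr (P n) [set y | exists j, D j n y] <= d / 6.
  by near: n; exact: D1.
have q4 : 1 - alpha - d / 2 <= pr (P n)
    (box (Z (n := n)) (Kn n - c0)) by near: n.
have mB : measurable (box (Z (n := n)) (Kn n - c0)).
  apply: measurable_box => j; apply: measurable_funM => //.
  exact: (measurable_rsum (mg n0)).
have Vp : psd (rcov P g n) by near: n; exact: near_psd_rcov.
have Vj : exists j, 0 < rcov P g n j j by exists (Ordinal k0); exact: rcov_gt0.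
have [A [Au AV]] := corr_unit_diag Vp Vj.
have [B [_]] := HT A Au; rewrite AV -/(Kn n) => /andP[K1 K2] _ _.
have K0 : 0 < Kn n by apply: lt_le_trans K1; rewrite divr_gt0.
set F1 := ~` _ in m1 q1; set F2 := _ `&` _ in m2 q2; set F3 := [set y | _] in m3 q3.
set G := box _ _ in q4 mB.
have GE : G `<=` E `|` (F1 `|` (F2 `|` F3)).
  move=> y Gy; apply: contrapT => /not_orP[nE /not_orP[/contrapT[Kh0 nu0] /not_orP[nF2 nF3]]].
  apply: nE => j; have sj : 0 < sd n j := row_sd_gt0 (gvar n0) j.
  have Dj : `|Delta y j 0| <= sd n j * e.
    have : ~ D j n y by move=> Djy; apply: nF3; exists j.
    move/negP; rewrite -ltNge normrM ger0_norm; last by rewrite invr_ge0 sqrtr_ge0.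
    by rewrite -/(sd n j) ltr_pdivrMl// => /ltW.
  have Rj : `|rsum g y j 0| <= sd n j * (Kn n - c0).
    have := Gy j; rewrite normrM [X in _ * X]ger0_norm ?invr_ge0 ?(ltW sj)//.
    by rewrite ler_pdivrMr// mulrC.
  have kj : sd n j * Kn n <= (1 + e) * (Num.sqrt (nu2 j y) * Khat y).
    have kl : kappa nu2 Khat alpha V y < 1 + e.
      by rewrite ltNge; apply/negP => h; apply: nF2.
    have nuj : 0 < Num.sqrt (nu2 j y) by rewrite sqrtr_gt0.
    have -> : (1 + e) * (Num.sqrt (nu2 j y) * Khat y) =
      (1 + e) * Num.sqrt (nu2 j y) * Khat y by rewrite mulrA.
    rewrite -ler_pdivrMr// -ler_pdivrMr//; apply: le_trans (ltW kl).
    have -> : sd n j * Kn n / Khat y / Num.sqrt (nu2 j y) =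
        Kn n / Khat y * (sd n j / Num.sqrt (nu2 j y)).
      by field; rewrite !gt_eqF.
    rewrite /kappa -/(Kn n) ler_pM2l ?divr_gt0//.
    have -> : sd n j / Num.sqrt (nu2 j y) = Num.sqrt (V y j j / nu2 j y).
      rewrite sqrtrM; last exact: psd_diag_ge0.
      by rewrite sqrtrV ?(ltW (nu0 j))// /V (rcov_diag (gvar n0))
        sqrtr_sqr ger0_norm// ltW.
    exact: (le_bigmax 0 (fun j => Num.sqrt (V y j j / nu2 j y))).
  rewrite mxE; apply: le_trans (ler_normD _ _) _.
  apply: le_trans (lerD Rj Dj) _; rewrite -mulrDr.
  move: kj K0 K2 sj; rewrite c0E; move: (Num.sqrt _ * _) (Kn n) (sd _ _) => h K s.
  move=> sK K0 KT s0.
  have e1 : 0 < 1 + e by lra.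
  rewrite -(ler_pM2l e1); apply: le_trans sK.
  have -> : (1 + e) * (s * (K - (T0 + 1) * e + e)) = s * ((1 + e) * (K - T0 * e)) by ring.
  rewrite ler_pM2l//.
  have : 0 <= (T0 - K) * e by apply: mulr_ge0 (ltW e0); rewrite subr_ge0.
  have : 0 <= T0 * e * e by apply: mulr_ge0 (ltW e0); apply: mulr_ge0 (ltW e0).
  lra.
have m23 : measurable (F2 `|` F3) by exact: measurableU.
have m123 : measurable (F1 `|` (F2 `|` F3)) by exact: measurableU.
have u1 := pr_union (P n) mB mE m123 GE.
have u2 := pr_union (P n) m123 m1 m23 (@subset_refl _ _).
have u3 := pr_union (P n) m23 m2 m3 (@subset_refl _ _).
move: (pr _ _) (pr _ _) (pr _ _) (pr _ _) (pr _ _) (pr _ _) (pr _ _) q1 q2 q3 q4 u1 u2 u3.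
move=> a1 a2 a3 a4 a5 a6 a7; lra.
Unshelve. all: by end_near. Qed.

End moment_conditions.
End kappa_facts.

Lemma mxcol_Rank (T : Type) d (m : 'I_d -> nat) n (B : forall j, 'M[T]_(m j, n))
    (j : 'I_d) (i : 'I_(m j)) (a : 'I_n) :
  (\mxcol_(j < d) B j) (tagnat.Rank j i) a = B j i a.
Proof. by have /matrixP/(_ i a) := mxcolK B j; rewrite mxE. Qed.

Lemma limn_einf_ge (R : realType) (u : (\bar R)^nat) (x : R) :
  (forall e : R, 0 < e -> \forall n \near \oo, ((x - e)%:E <= u n)%E) ->
  (x%:E <= limn_einf u)%E.
Proof.
move=> h; apply/lee_subgt0Pr => e e0; rewrite -EFinB limn_einf_lim.
apply: lime_ge; first exact: is_cvg_einfs.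
have [N _ hN] := h e e0; exists N => // n Nn /=.
by apply: le_ereal_inf_tmp => _ [k /= nk <-]; apply: hN; exact: leq_trans nk.
Qed.

Lemma measurable_cover (R : realType) l d n (m : 'I_d -> nat)
    (thetastar : forall j, 'cV[R]_(m j))
    (thetahat : forall j, 'M[R]_(n, l) -> 'cV[R]_(m j))
    (nu2 : 'I_(\sum_(j < d) m j) -> 'M[R]_(n, l) -> R)
    (Khat : 'M[R]_(n, l) -> R) (F : 'I_d -> set 'M[R]_(n, l)) :
  (forall j, measurable_fun setT (thetahat j)) ->
  (forall j, measurable_fun setT (nu2 j)) -> measurable_fun setT Khat ->
  (forall j, measurable (F j)) ->
  measurable [set y | forall j, F j y -> forall i : 'I_(m j),
    thetastar j i 0 \in CI thetahat nu2 Khat y i].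
Proof.
move=> mt mn mK mF; pose I j y := [set y' | forall i : 'I_(m j),
    [set y'' | thetastar j i 0 \in CI thetahat nu2 Khat y'' i] y'] y.
rewrite (_ : [set _ | _] = [set y | forall j, (~` F j `|` I j) y]); last first.
  apply/seteqP; split=> y h j.
    by have [Fj|nFj] := pselect (F j y); [right; exact: h|left].
  by case: (h j).
apply: measurable_forall_ord => j; apply: measurableU; first exact: measurableC.
apply: measurable_forall_ord => i.
have mh : measurable_fun setT (fun y =>
    Num.sqrt (nu2 (tagnat.Rank j i) y) * Khat y - `|thetahat j y i 0 - thetastar j i 0|).
  apply: measurable_funB.
    by apply: measurable_funM => //; exact: measurable_fun_sqrt.
  apply: measurableT_comp => //; apply: measurable_funB => //.
  exact: (measurableT_comp (measurable_entry i 0) (mt j)).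
have := measurable_ge_set 0 mh; congr measurable.
by apply/seteqP; split=> y /=; rewrite /CI in_itv/= subr_ge0 distrC ler_distl.
Qed.

Theorem theorem2p6 (R : realType) (l d : nat) (hl : (0 < l)%N) (hd : (0 < d)%N)
  (m : 'I_d -> nat) (hk : (0 < \sum_(j < d) m j)%N)
  (P : forall n, probability 'M[R]_(n, l) R)
  (Pm : forall n, 'I_n -> probability 'rV[R]_l R)
  (hP : forall n, (0 < n)%N -> product_law P Pm n)
  (M : forall n, 'I_d -> set (probability 'M[R]_(n, l) R))
  (hM0 : forall n, (0 < n)%N -> forall j, M n j !=set0)
  (hMinj : forall n, (0 < n)%N -> injective (M n))
  (thetastar : forall (n : nat) (j : 'I_d), 'cV[R]_(m j))
  (thetahat : forall (n : nat) (j : 'I_d), 'M[R]_(n, l) -> 'cV[R]_(m j))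
  (hthetahat : forall n, (0 < n)%N -> forall j,
     measurable_fun [set: 'M[R]_(n, l)] (thetahat n j))
  (g : forall n, 'I_n -> 'rV[R]_l -> 'cV[R]_(\sum_(j < d) m j))
  (Delta : forall n, 'M[R]_(n, l) -> 'cV[R]_(\sum_(j < d) m j))
  (hE : expansion P Pm g Delta (fun n y =>
     (\mxcol_(j < d) thetahat n j y) - (\mxcol_(j < d) thetastar n j)))
  (alpha : R) (halpha : 0 < alpha < 1)
  (nu2 : forall n, 'I_(\sum_(j < d) m j) -> 'M[R]_(n, l) -> R)
  (hnu2 : forall n, (0 < n)%N -> forall j,
     measurable_fun [set: 'M[R]_(n, l)] (nu2 n j) /\ forall y, 0 <= nu2 n j y)
  (Khat : forall n, 'M[R]_(n, l) -> R)
  (hKhat : forall n, (0 < n)%N ->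
     measurable_fun [set: 'M[R]_(n, l)] (Khat n) /\ forall y, 0 <= Khat n y) :
  let V := fun n (_ : 'M[R]_(n, l)) => rcov P g n in
  let S := fun n => @Smat R l _ g n in
  [/\ kappa_condition P nu2 Khat alpha V <-> kappa_condition P nu2 Khat alpha S,
      kappa_condition P nu2 Khat alpha V ->
      forall Mhat : forall n, 'M[R]_(n, l) -> set (probability 'M[R]_(n, l) R),
        (forall n, (0 < n)%N ->
           (forall y, exists j, Mhat n y = M n j) /\
           (forall j, measurable [set y | Mhat n y = M n j])) ->
        ((1 - alpha)%:E <= limn_einf (fun n => P n
           [set y | forall j, Mhat n y = M n j -> forall i : 'I_(m j),
              thetastar n j i 0%R \in CI (thetahat n) (nu2 n) (Khat n) y i]))%E,
      (\forall n \near \oo, forall y,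
         Kquantile (1 - alpha) (corr (rcov P g n)) <= Khat n y) ->
      marginal_condition P nu2 S -> kappa_condition P nu2 Khat alpha V
    & marginal_condition P nu2 S <-> marginal_condition P nu2 V].
Proof.
move=> V S; have [mgD errE hmom hlind hDelta] := hE.
have mg n (n0 : (0 < n)%N) := (mgD n n0).1.
have mD n (n0 : (0 < n)%N) := (mgD n n0).2.
split.
- exact: (kappa_condition_equiv halpha hnu2 hKhat hk hP mg hmom hlind).
- move=> kV Mhat hMhat; apply: limn_einf_ge => e e0.
  have cov := near_coverage halpha hnu2 hKhat hk hP mg hmom hlind mD hDelta e0 kV.
  near=> n; have n0 : (0 < n)%N by near: n; exact: nbhs_infty_gt.
  have [mE PE] : let E := [set y : 'M[R]_(n, l) | forall j,
      `|(rsum g y + Delta n y) j 0| <= Num.sqrt (nu2 n j y) * Khat n y] in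
    measurable E /\ 1 - alpha - e <= pr (P n) E by near: n.
  have [_ mM] := hMhat n n0.
  have mC := measurable_cover (thetastar n) (hthetahat n n0)
    (fun j => (hnu2 n n0 j).1) (hKhat n n0).1 mM.
  rewrite pr_EFin// lee_fin; apply: le_trans PE _; apply: pr_mono => //.
  (* The event bounds the stacked coordinates of all models at once, hence those of whichever model
     is selected. *)
  move=> y hy j _ i; rewrite /CI in_itv/= -ler_distl distrC.
  have <- : (rsum g y + Delta n y) (tagnat.Rank j i) 0 =
      thetahat n j y i 0 - thetastar n j i 0.
    by rewrite -errE// mxE [X in _ + X]mxE !mxcol_Rank.
  exact: hy.
- exact: (kappa_condition_of_marginal halpha hnu2 hKhat hk hP mg hmom hlind).
- exact: (marginal_condition_equiv halpha hnu2 hk hP mg hmom hlind).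
Unshelve. all: by end_near. Qed.
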